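(* For all types $\sigma,\tau\Vdash n$, the coefficient of $s_{\tau}^{\otimes}$ in the $s^{\otimes}$-expansion of $H_{\sigma}$ is \[ \mathcal{M}(H,s^{\otimes})_{\tau,\sigma}= \sum_{T\in\mathrm{TPRT}(\tau,\sigma)} \operatorname{sgn}(T). \]
   Context: An integer partition is a finite (possibly empty) weakly decreasing sequence of positive integers; $m_k(\lambda)$ is the number of parts of $\lambda$ equal to $k$. A block is an ordered pair of positive integers written $d^m$ (degree $d$, multiplicity $m$). Blocks are ordered by $a^b\ge d^e$ iff $a>d$, or $a=d$ and $b\ge e$. A type is a finite (possibly empty) weakly decreasing sequence of blocks $\tau=(d_1^{m_1},\dots,d_s^{m_s})$; its weight is $|\tau|=\sum_id_im_i$, and $\tau\Vdash n$ means $|\tau|=n$. For $k\ge1$, $\tau|_k$ denotes the integer partition formed by the multiplicities of the blocks of $\tau$ of degree $k$; the type $\tau$ is determined by $(\tau|_k)_{k\ge1}$. Variables: $x_{k,j}$ for $k,j\ge 1$, with $\deg x_{k,j}=k$; $\mathbf{x}_{k*}=(x_{k,1},x_{k,2},\dots)$. The graded algebra $\mathsf{P\Lambda}=\bigoplus_n\mathsf{P\Lambda}^n$ of polysymmetric functions consists of the formal series over $\mathbb{Q}$ of bounded degree in all the $x_{k,j}$ that, for each fixed $k$, are unchanged by any permutation of the variables $\mathbf{x}_{k*}$. Define $s^{\otimes}_\tau=\prod_{k\ge1}s_{\tau|_k}(\mathbf{x}_{k*})$, where $s_\lambda$ is the Schur symmetric function; $\{s^\otimes_\tau:\tau\Vdash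 n\}$ is a basis of $\mathsf{P\Lambda}^n$. $H_d$ is the sum of all distinct monomials of degree $d$ in the variables $x_{k,j}$ (with $\deg x_{k,j}=k$), $H_{d^r}$ is obtained from $H_d$ by replacing every variable $x_{k,j}$ by $x_{k,j}^r$, and $H_\sigma=\prod_{i=1}^sH_{d_i^{r_i}}$ for $\sigma=(d_1^{r_1},\dots,d_s^{r_s})$. The transition matrix is defined by $H_\sigma=\sum_{\tau\Vdash n}\mathcal{M}(H,s^\otimes)_{\tau,\sigma}s^\otimes_\tau$ for $\sigma\Vdash n$. The diagram $\mathrm{dg}(\mu)$ is the set of boxes $(i,j)$ with $1\le i\le\ell(\mu)$, $1\le j\le\mu_i$ (row $1$ at the top). For $\mathrm{dg}(\mu)\subseteq\mathrm{dg}(\nu)$, $\nu/\mu=\mathrm{dg}(\nu)\setminus\mathrm{dg}(\mu)$. It is an $r$-ribbon if it consists of $r$ boxes that can be labeled $b_1,\dots,b_r$ so that for $1<i\le r$, $b_i$ is one unit left of or one unit below $b_{i-1}$. If a ribbon $R$ has boxes in exactly $q$ different rows, $\operatorname{sgn}(R)=(-1)^{q-1}$, and $\mathrm{top}(R)$ is the least index of a row containing a box of $R$. A skew shape $\lambda/\mu$ is an $r^n$-polyribbon ($n\ge0$) if there exist partitions $\mu=\gamma_{(0)}\subseteq\gamma_{(1)}\subseteq\cdots\subseteq\gamma_{(n)}=\lambda$ such that $\gamma_{(i)}/\gamma_{(i-1)}$ is an $r$-ribbon for $1\le i\le n$ and $\mathrm{top}(\gamma_{(i)}/\gamma_{(i-1)})\ge\mathrm{top}(\gamma_{(i+1)}/\gamma_{(i)})$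 for $1\le i\le n-1$ (such a list is unique if it exists; for $n=0$ the shape is empty). Its sign is $\operatorname{sgn}_r(\lambda/\mu)=\prod_{i=1}^n\operatorname{sgn}(\gamma_{(i)}/\gamma_{(i-1)})$. For types $\tau,\rho$, $\tau/\rho$ is a $d^r$-tensor polyribbon if for some partition $\lambda$ of $d$, $(\tau|_k)/(\rho|_k)$ is an $r^{m_k(\lambda)}$-polyribbon for all $k\ge1$; then $\operatorname{sgn}_r^\otimes(\tau/\rho)=\prod_{k\ge1}\operatorname{sgn}_r((\tau|_k)/(\rho|_k))$. For $\sigma=(d_1^{r_1},\dots,d_s^{r_s})$, $\mathrm{TPRT}(\tau,\sigma)$ is the set of tensor polyribbon tableaux of shape $\tau$ and content $\sigma$: sequences of types $\varnothing=\tau_{(0)},\tau_{(1)},\dots,\tau_{(s)}=\tau$ (starting at the empty type) such that, for $1\le i\le s$, $\tau_{(i)}/\tau_{(i-1)}$ is a $d_i^{r_i}$-tensor polyribbon. The sign is $\operatorname{sgn}(T)=\prod_{i=1}^s\operatorname{sgn}_{r_i}^\otimes(\tau_{(i)}/\tau_{(i-1)})$. *)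

(* Defs.v *)
From HB Require Import structures.
From mathcomp Require Import all_boot all_order all_algebra.
From mathcomp Require Import finmap.
From mathcomp Require Import all_classical.
From mathcomp.multinomials Require Import monalg.

Set Implicit Arguments.
Unset Strict Implicit.
Unset Printing Implicit Defensive.

Import Order.TTheory GRing.Theory Num.Theory.

Local Open Scope classical_set_scope.
Local Open Scope nat_scope.

Definition is_part (s : seq nat) : bool := sorted geq s && all (ltn 0) s.

Record intpart := IntPart { parts :> seq nat; partsP : is_part parts }.

HB.instance Definition _ := [isSub for parts].
HB.instance Definition _ := [Choice of intpart by <:].

(* The block d^m is the pair (d, m). *)
Definition block := (nat * nat)%type.

Definition block_ge (x y : block) : bool :=
  (y.1 < x.1) || ((x.1 == y.1) && (y.2 <= x.2)).

Definition is_type (t : seq block) : bool :=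
  sorted block_ge t && all (fun b => (0 < b.1) && (0 < b.2)) t.

Record ptype := PType { blocks :> seq block; blocksP : is_type blocks }.

HB.instance Definition _ := [isSub for blocks].
HB.instance Definition _ := [Choice of ptype by <:].

Definition empty_ptype : ptype := @PType [::] isT.

Definition weight (t : ptype) : nat := \sum_(b <- t) b.1 * b.2.

Definition mults (t : seq block) (k : nat) : seq nat :=
  [seq b.2 | b <- t & b.1 == k].

Lemma mults_is_part (t : ptype) (k : nat) : is_part (mults t k).
Proof.
case: t => t /= /andP[t_sorted t_pos]; apply/andP; split; last first.
  apply/allP => _ /mapP[b + ->]; rewrite mem_filter => /andP[_].
  by move/(allP t_pos) => /andP[].
have block_ge_trans : transitive block_ge.
  move=> [y1 y2] [x1 x2] [z1 z2]; rewrite /block_ge /=.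
  case/orP=> [yx|/andP[/eqP-> yx]] /orP[zy|/andP[/eqP e zy]].
  - by rewrite (ltn_trans zy yx).
  - by rewrite -e yx.
  - by rewrite zy.
  - by rewrite e eqxx (leq_trans zy yx) orbT.
rewrite /mults sorted_map.
have /= s_sorted := sorted_filter block_ge_trans (fun b => b.1 == k) t_sorted.
apply: (@sub_in_sorted _ (fun b : block => b.1 == k) block_ge) s_sorted.
  by move=> x y /eqP xk /eqP yk; rewrite /block_ge xk yk ltnn eqxx.
exact: filter_all.
Qed.

Definition restr (t : ptype) (k : nat) : intpart := IntPart (mults_is_part t k).

Definition var := {p : nat * nat | (0 < p.1) && (0 < p.2)}.

Definition monomial := {cmonom var}.

Definition monomial_degree (m : monomial) : nat :=
  \sum_(v <- finsupp m) (val v).1 * m v.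

Local Open Scope ring_scope.

(* A series is given by the coefficients of its monomials. *)
Definition series := monomial -> rat.

Definition series_one : series := fun m => (m == mone)%:R.

(* A monomial has finitely many factorizations, so the sum is finite. *)
Definition series_mul (f g : series) : series := fun m =>
  \sum_(p \in [set p : monomial * monomial | mmul p.1 p.2 = m]) f p.1 * g p.2.

(* Replacing every variable by its r-th power sends the monomial m' to its r-th
   power; for r > 0 at most one m' contributes to the coefficient of m. *)
Definition series_frob (r : nat) (f : series) : series := fun m =>
  \sum_(m' \in [set m' : monomial | expcmn m' r = m]) f m'.

Definition Hdeg (d : nat) : series := fun m => (monomial_degree m == d)%:R.

Definition Htype (s : ptype) : series :=
  \big[series_mul/series_one]_(b <- s) series_frob b.2 (Hdeg b.1).

(* T is the list of rows of a filling; entries are positive integers. *)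
Definition is_ssyt (lam : seq nat) (T : seq (seq nat)) : Prop :=
  [/\ shape T = lam,
      all (all (ltn 0%N)) T,
      all (sorted leq) T
    & forall i j : nat, (i.+1 < size T)%N ->
        (j < size (nth [::] T i.+1))%N ->
        (nth 0%N (nth [::] T i) j < nth 0%N (nth [::] T i.+1) j)%N].

(* m is the monomial x^T written in the variables x_(k,1), x_(k,2), ... *)
Definition has_content (k : nat) (T : seq (seq nat)) (m : monomial) : Prop :=
  forall v : var,
    m v = if (val v).1 == k then count_mem (val v).2 (flatten T) else 0%N.

(* The Schur function s_lam in the variables x_(k,1), x_(k,2), ...: the
   coefficient of m is the (finite) number of semistandard tableaux T with
   x^T = m. *)
Definition schur (lam : intpart) (k : nat) : series := fun m =>
  \sum_(T \in [set T : seq (seq nat) | is_ssyt lam T /\ has_content k T m])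
    (1 : rat).

(* For k > weight t the partition restr t k is empty and the factor is 1. *)
Definition stensor (t : ptype) : series :=
  \big[series_mul/series_one]_(1 <= k < (weight t).+1) schur (restr t k) k.

Definition is_transition (M : ptype -> ptype -> rat) : Prop :=
  forall (sigma : ptype) (m : monomial),
    Htype sigma m = \sum_(tau \in [set tau : ptype | weight tau = weight sigma])
                  M tau sigma * stensor tau m.

(* The entries M tau sigma with weight tau = weight sigma are determined by
   is_transition, the functions s^(x)_tau being a basis; the others are junk. *)
Definition transition : ptype -> ptype -> rat :=
  xget (fun _ _ => 0) is_transition.

Local Open Scope nat_scope.

Definition box := (nat * nat)%type.

(* Boxes are (row, column), both counted from 1. *)
Definition dg (mu : seq nat) : seq box :=
  [seq (i, j) | i <- iota 1 (size mu), j <- iota 1 (nth 0 mu i.-1)].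

(* The boxes of nu/mu. *)
Definition skew (nu mu : seq nat) : seq box := [seq b <- dg nu | b \notin dg mu].

(* y is one unit left of or one unit below x. *)
Definition ribbon_step (x y : box) : bool :=
  ((y.1 == x.1) && (y.2.+1 == x.2)) || ((y.1 == x.1.+1) && (y.2 == x.2)).

Definition is_ribbon (r : nat) (nu mu : intpart) : Prop :=
  {subset dg mu <= dg nu} /\
  exists b : seq box,
    [/\ perm_eq b (skew nu mu), size b = r & sorted ribbon_step b].

Definition sgn_ribbon (nu mu : intpart) : rat :=
  ((-1) ^+ (size (undup [seq b.1 | b <- skew nu mu])).-1)%R.

(* The default size nu is only reached when
   nu/mu is empty. *)
Definition top_row (nu mu : intpart) : nat :=
  \big[minn/size nu]_(b <- skew nu mu) b.1.

Definition empty_part : intpart := @IntPart [::] isT.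

(* The list g = (g_0, ..., g_n) exhibits lam/mu as an r^n-polyribbon. *)
Definition polyribbon_chain (r n : nat) (lam mu : intpart) (g : seq intpart) :
    Prop :=
  let g_ := nth empty_part g in
  [/\ size g = n.+1, g_ 0 = mu, g_ n = lam,
      forall i, i < n -> is_ribbon r (g_ i.+1) (g_ i)
    & forall i, i.+1 < n -> top_row (g_ i.+2) (g_ i.+1) <= top_row (g_ i.+1) (g_ i)].

Definition is_polyribbon (r n : nat) (lam mu : intpart) : Prop :=
  exists g : seq intpart, polyribbon_chain r n lam mu g.

(* The chain (and its length) is unique if it exists, provided r > 0. *)
Definition the_chain (r : nat) (lam mu : intpart) : seq intpart :=
  xget [::] [set g | exists n : nat, polyribbon_chain r n lam mu g].

Definition sgn_polyribbon (r : nat) (lam mu : intpart) : rat :=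
  let g := the_chain r lam mu in
  (\prod_(i < (size g).-1)
     sgn_ribbon (nth empty_part g i.+1) (nth empty_part g i))%R.

Definition is_tensor_polyribbon (d r : nat) (tau rho : ptype) : Prop :=
  exists lam : intpart, sumn lam = d /\
    forall k : nat, 0 < k ->
      is_polyribbon r (count_mem k lam) (restr tau k) (restr rho k).

(* For k > weight tau both partitions are empty (rho being contained in tau)
   and the factor is 1. *)
Definition sgn_tensor (r : nat) (tau rho : ptype) : rat :=
  (\prod_(1 <= k < (weight tau).+1)
     sgn_polyribbon r (restr tau k) (restr rho k))%R.

Definition TPRT (tau sigma : ptype) : set (seq ptype) :=
  [set T : seq ptype |
    let T_ := nth empty_ptype T in
    [/\ size T = (size sigma).+1, T_ 0 = empty_ptype, T_ (size sigma) = tau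
      & forall i, i < size sigma ->
          is_tensor_polyribbon (nth (0, 0) sigma i).1 (nth (0, 0) sigma i).2
            (T_ i.+1) (T_ i)]].

Definition sgn_tableau (sigma : ptype) (T : seq ptype) : rat :=
  (\prod_(i < size sigma)
     sgn_tensor (nth (0%N, 0%N) sigma i).2
       (nth empty_ptype T i.+1) (nth empty_ptype T i))%R.

(* Main.v *)
(* Replacing a partition by the set of its beads la_i + N - i, adding an r-ribbon moves one bead
   from b to an empty position b + r; the sign of the ribbon is the sign of the permutation that
   sorts the beads again, and the condition on the top rows says that the sources b of successive
   moves increase. Hence the signed sum over all polyribbons starting from mu is an expansion of a
   single determinant: multiplying the alternant det(x_j^(bead i)) by prod_j 1/(1 - x_j^r)
   multiplies column j by g_j = 1 + x_j^r g_j, and applying this identity and multilinearity to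
   the rows, one source at a time in increasing order, produces exactly the chains of bead moves,
   two equal beads giving a vanishing determinant. With the bialternant formula (the differences
   of consecutive rows of an alternant turn its expansion along the last column into the branching
   rule for semistandard tableaux) this yields the plethystic Murnaghan-Nakayama rule for the
   series of all r-th powers times a Schur function, in all degrees at once. The alphabets for
   different k being disjoint, coefficients of a tensor product are products of coefficients, so
   the rule multiplies over k, and induction on the blocks of sigma gives the expansion of H_sigma. The
   entries of the transition matrix are determined by it because the s^(x)_tau are linearly
   independent (dominance triangularity of the Kostka numbers). *)

From HB Require Import structures.
From mathcomp Require Import all_boot all_order all_algebra.
From mathcomp Require Import fingroup perm.
From mathcomp Require Import finmap.
From mathcomp Require Import all_classical.
From mathcomp.multinomials Require Import monalg.
From mathcomp Require Import zify ring.
Require Import Defs.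

Set Implicit Arguments.
Unset Strict Implicit.
Unset Printing Implicit Defensive.

Import Order.TTheory GRing.Theory Num.Theory.

Local Open Scope classical_set_scope.
Local Open Scope ring_scope.

(** * The ring of formal series *)

(** The identities of series are proved coefficient by coefficient: a monomial [m] involves finitely
    many variables and has finite degree, so [m] itself supplies the cut-offs that the statements do
    not contain. The number [N] of variables and beads is taken at least as large as every index in
    [m], its degree and the length of the starting partition; nothing is then lost in passing from
    an infinite alphabet to [N] letters, and every partition of the right size fits into [N] rows.
    As an identity of series the splitting of beads never ends, since a moved bead may move by [r]
    again; but a row whose bead exceeds the degree of [m] cannot contribute to the coefficient of
    [m], and there the recursion stops. Taking all degrees together is what allows one geometric
    factor per column; the number of ribbons and the degree [d] are recovered afterwards from
    homogeneity. The Vandermonde factor is cancelled without division, because a difference of two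
    distinct variables is not a zero divisor. *)

Lemma finite_divisors (m : monomial) :
  finite_set [set a : monomial | exists b, mmul a b = m].
Proof.
pose h (f : {ffun finsupp m -> 'I_(mdeg m).+1}) : monomial :=
  [cmonom (f i : nat) | i : finsupp m]%M.
apply: (@sub_finite_set _ _ (h @` setT)); last exact/finite_image/finite_finset.
move=> a [b ab]; exists [ffun i => inord (a (val i))] => //.
apply/eqP/cmP => v; rewrite /h cmE fsfun_ffun /=.
case: insubP => [u _ uv|vm].
  rewrite /= ffunE uv inordK // ltnS.
  have: (a v <= m v)%N by rewrite -ab cmM leq_addr.
  move/leq_trans; apply; rewrite mdegE -uv.
  by rewrite (big_fsetD1 (val u)) ?leq_addr //= fsvalP.
by move: vm; rewrite -cmE_eq0 -ab cmM addn_eq0 => /andP[/eqP->].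
Qed.

(** A separate name for [series], so that the multiplication attached to it is the convolution
    [series_mul] and not a pointwise product. As a commutative ring it can hold the entries of
    determinants. *)
Definition pseries : Type := series.
HB.instance Definition _ := gen_eqMixin pseries.
HB.instance Definition _ := gen_choiceMixin pseries.
Definition padd (f g : pseries) : pseries := fun m => f m + g m.
Definition popp (f : pseries) : pseries := fun m => - f m.
Definition pzero : pseries := fun=> 0.

Fact paddA : associative padd.
Proof. by move=> f g h; apply/funext => m; rewrite /padd addrA. Qed.
Fact paddC : commutative padd.
Proof. by move=> f g; apply/funext => m; rewrite /padd addrC. Qed.
Fact padd0 : left_id pzero padd.
Proof. by move=> f; apply/funext => m; rewrite /padd add0r. Qed.
Fact paddN : left_inverse pzero popp padd.
Proof. by move=> f; apply/funext => m; rewrite /padd addNr. Qed.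
HB.instance Definition _ := GRing.isZmodule.Build pseries paddA paddC padd0 paddN.

Definition divisors_list (m : monomial) : seq monomial :=
  fset_set [set a : monomial | exists b, mmul a b = m].

Lemma mem_divisors_list m a : reflect (exists b, mmul a b = m) (a \in divisors_list m).
Proof.
rewrite in_fset_set ?inE; last exact: finite_divisors.
by apply: (iffP idP) => [/set_mem //|]; exact: mem_set.
Qed.

Lemma uniq_divisors_list m : uniq (divisors_list m).
Proof. exact: fset_uniq. Qed.

(** One list, the divisors of a fixed [m], indexes the products at every divisor [p] of [m]; with a
    common index list, commutativity and associativity become exchanges of finite sums. *)
Lemma series_mul_sum (f g : series) m p : p \in divisors_list m ->
  series_mul f g p = \sum_(a <- divisors_list m) \sum_(b <- divisors_list m)
     (mmul a b == p)%:R * (f a * g b).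
Proof.
move=> /mem_divisors_list[q pq].
rewrite /series_mul.
rewrite (@fsbigE _ _ _ _ _ [seq x <- allpairs pair (divisors_list m) (divisors_list m) | mmul x.1 x.2 == p]); first last.
- move=> [a b] /= ab; rewrite mem_filter /= ab eqxx /= => /negP[].
  apply/allpairsP; exists (a, b); split => //=; apply/mem_divisors_list.
    by exists (mmul b q); rewrite mulmA ab.
  by exists (mmul a q); rewrite mulmA (mulmC b) ab.
- by move=> x /=; rewrite mem_filter => /andP[/eqP].
- rewrite filter_uniq //; apply: allpairs_uniq; try exact: uniq_divisors_list.
  by move=> [? ?] [? ?].
have E (s : seq (monomial * monomial)) :
   \sum_(i <- s | i \in [set q0 | mmul q0.1 q0.2 = p]) f i.1 * g i.2 = 
   \sum_(i <- s | mmul i.1 i.2 == p) f i.1 * g i.2.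
  by apply: eq_bigl => i; apply/idP/eqP => [/set_mem//|]; exact: mem_set.
rewrite E big_filter_cond /= (eq_bigl (fun x => mmul x.1 x.2 == p)); last by move=> x; rewrite andbb.
rewrite big_mkcond big_allpairs_dep /=; apply: eq_bigr => a _; apply: eq_bigr => b _.
by case: ifP => _; rewrite ?mul1r ?mul0r.
Qed.

Lemma divisors_list_id m : m \in divisors_list m.
Proof. by apply/mem_divisors_list; exists mone; rewrite mulm1. Qed.

Fact pmulC : commutative (series_mul : pseries -> pseries -> pseries).
Proof.
move=> f g; apply/funext => m; rewrite !(series_mul_sum _ _ (divisors_list_id m)).
rewrite exchange_big /=; apply: eq_bigr => a _; apply: eq_bigr => b _.
by rewrite mulmC (mulrC (f b)).
Qed.

Lemma big_pred_uniq (T : eqType) (s : seq T) (y : T) (F : T -> rat) : uniq s ->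
  \sum_(x <- s) (y == x)%:R * F x = (y \in s)%:R * F y.
Proof.
move=> us; have [ys|ys] := boolP (y \in s).
  rewrite (bigD1_seq y) //= eqxx big1 ?addr0 // => x /negPf.
  by rewrite eq_sym => ->; rewrite mul0r.
rewrite big_seq big1 ?mul0r// => x xs.
by case: eqP ys => [->|]; rewrite ?xs // mul0r.
Qed.

Fact pmulA : associative (series_mul : pseries -> pseries -> pseries).
Proof.
have aux (f g h : pseries) m : series_mul f (series_mul g h) m =
    \sum_(a <- divisors_list m) \sum_(b <- divisors_list m) \sum_(c <- divisors_list m)
     (mmul a (mmul b c) == m)%:R * (f a * (g b * h c)).
  rewrite (series_mul_sum _ _ (divisors_list_id m)); apply: eq_bigr => a _.
  transitivity (\sum_(p <- divisors_list m) \sum_(b <- divisors_list m) \sum_(c <- divisors_list m)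
     (mmul b c == p)%:R * ((mmul a p == m)%:R * (f a * (g b * h c)))).
    apply: eq_big_seq => p pm; rewrite (series_mul_sum _ _ pm) !mulr_sumr.
    apply: eq_bigr => b _; rewrite !mulr_sumr; apply: eq_bigr => c _.
    ring.
  rewrite exchange_big /=; apply: eq_bigr => b _; rewrite exchange_big /=; apply: eq_bigr => c _.
  rewrite big_pred_uniq ?uniq_divisors_list //.
  case: (eqVneq (mmul a (mmul b c)) m) => [e|]; last by rewrite !mul0r mulr0.
  suff -> : mmul b c \in divisors_list m by rewrite !mul1r.
  by apply/mem_divisors_list; exists a; rewrite mulmC.
(* The bracketing [(fg)h] is turned into [h(fg)], so that the triple sum [aux] applies to both
   sides. *)
move=> f g h; apply/funext => m; rewrite [RHS](congr1 (fun F => F m) (pmulC _ _)) !aux.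
rewrite [RHS]exchange_big /=; apply: eq_bigr => a _.
rewrite [RHS]exchange_big /=; apply: eq_bigr => b _; apply: eq_bigr => c _.
by rewrite mulmA (mulmC c); ring.
Qed.

Lemma series_mul_single (f g : series) m a b : mmul a b = m ->
  (forall a' b', mmul a' b' = m -> (a', b') <> (a, b) -> f a' * g b' = 0) ->
  series_mul f g m = f a * g b.
Proof.
move=> ab H; rewrite /series_mul (@fsbigE _ _ _ _ _ [:: (a, b)]) //=.
- rewrite big_cons big_nil /= ifT ?addr0 //; exact: mem_set.
- by move=> x /=; rewrite inE => /eqP ->.
- by move=> [a' b'] /= e; rewrite inE => /eqP; exact: H.
Qed.

Lemma series_mul_eq0 (f g : series) m :
  (forall a b, mmul a b = m -> f a * g b = 0) -> series_mul f g m = 0.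
Proof. by move=> H; rewrite /series_mul fsbig1 // => -[a b] /=; exact: H. Qed.

Lemma eq_series_mul (f g f' g' : series) m :
  (forall a b, mmul a b = m -> f a * g b = f' a * g' b) ->
  series_mul f g m = series_mul f' g' m.
Proof. by move=> H; apply: eq_fsbigr => -[a b] /set_mem /= /H. Qed.

Fact pmul1 : left_id (series_one : pseries) series_mul.
Proof.
move=> f; apply/funext => m.
rewrite (@series_mul_single _ _ m mone m) ?mul1m /series_one ?eqxx ?mul1r //.
by move=> a b ab ne; case: eqP ab ne => [->|]; rewrite ?mul0r // mul1m => ->.
Qed.

Fact pmulDl : left_distributive (series_mul : pseries -> pseries -> pseries) padd.
Proof.
move=> f g h; apply/funext => m; rewrite /padd !(series_mul_sum _ _ (divisors_list_id m)).
rewrite -big_split; apply: eq_bigr => a _; rewrite -big_split; apply: eq_bigr => b _ /=.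
by rewrite mulrDl mulrDr.
Qed.

Fact pone_neq0 : (series_one : pseries) != 0.
Proof.
apply/eqP => /(congr1 (fun f : series => f mone)); rewrite /series_one eqxx => /eqP.
by rewrite oner_eq0.
Qed.

HB.instance Definition _ := GRing.Zmodule_isComNzRing.Build pseries
  pmulA pmulC pmul1 pmulDl pone_neq0.

Lemma pseries_mulE (f g : pseries) : f * g = series_mul f g. Proof. by []. Qed.
Lemma pseriesD m (f g : pseries) : (f + g) m = f m + g m. Proof. by []. Qed.
Lemma pseries0 m : (0 : pseries) m = 0. Proof. by []. Qed.
Lemma pseries1 m : (1 : pseries) m = (m == mone)%:R. Proof. by []. Qed.
Lemma pseries_sum m I (r : seq I) P (F : I -> pseries) :
  (\sum_(i <- r | P i) F i) m = \sum_(i <- r | P i) F i m.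
Proof. by apply: (big_morph (fun f : pseries => f m)). Qed.

Lemma expcmn_iter (m : monomial) n : expcmn m n = iter n (mmul m) mone.
Proof.
by case: n => [//|n]; rewrite /expcmn iteropS iterSr mulm1.
Qed.

Lemma expcmnE (m : monomial) n v : expcmn m n v = (n * m v)%N.
Proof.
rewrite expcmn_iter; elim: n => [|n IH]; first by rewrite cm1.
by rewrite /= cmM IH mulSn.
Qed.

(** * Monomials, cancellable elements and homogeneous series *)

Definition mono (a : monomial) : pseries := fun m => (m == a)%:R.

Lemma mono_coefM a f m : (mono a * f) (mmul a m) = f m.
Proof.
rewrite pseries_mulE (@series_mul_single _ _ _ a m) // /mono ?eqxx ?mul1r // => b c bc ne.
case: eqP => [ba|]; last by rewrite mul0r.
case: ne; rewrite ba; congr pair; apply/eqP/cmP => v.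
by move: (congr1 (fun m => cmonom_val m v) bc); rewrite !cmM ba => /addnI.
Qed.

Lemma mono_coef0 a f m : (forall b, mmul a b <> m) -> (mono a * f) m = 0.
Proof.
move=> H; apply: series_mul_eq0 => b c bc; rewrite /mono; case: eqP => [ba|]; last by rewrite mul0r.
by case: (H c); rewrite -ba.
Qed.

Lemma monoM a b : mono a * mono b = mono (mmul a b).
Proof.
apply/funext => m; case: (pselect (exists c, mmul a c = m)) => [[c <-]|H].
  rewrite mono_coefM /mono; congr (nat_of_bool _)%:R; apply/eqP/eqP => [->//|e].
  apply/eqP/cmP => v; move: (congr1 (fun m => cmonom_val m v) e).
  by rewrite !cmM => /addnI.
rewrite mono_coef0 /mono => [|c ac]; last by case: H; exists c.
by case: eqP => // e; case: H; exists b.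
Qed.

Lemma mono1 : mono mone = 1. Proof. by []. Qed.

Lemma monoX a n : mono a ^+ n = mono (expcmn a n).
Proof.
by rewrite expcmn_iter; elim: n => [|n IH]; rewrite ?expr0 ?mono1 //= exprS IH monoM.
Qed.

Lemma mono_coef_deg a f m : (mdeg m < mdeg a)%N -> (mono a * f) m = 0.
Proof.
by move=> lt; apply: mono_coef0 => b bm; move: lt; rewrite -bm mdegM ltnNge leq_addr.
Qed.

Definition var_series (v : var) : pseries := mono (ucm v).

Lemma var_seriesX v n : var_series v ^+ n = mono (expcmn (ucm v) n).
Proof. exact: monoX. Qed.

Lemma mdeg_expcmn (m : monomial) n : mdeg (expcmn m n) = (n * mdeg m)%N.
Proof.
by rewrite expcmn_iter; elim: n => [|n IH]; rewrite ?mdeg1 //= mdegM IH mulSn.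
Qed.

Lemma addn_subn_bool (a : nat) (p q : bool) : (q -> p = false) -> (q -> 0 < a)%N ->
  (p + a = q + (p + a - q))%N.
Proof.
case: p q => [] [] /= H1 H2; first by have := H1 isT.
- by rewrite subn0.
- by rewrite !add0n subnKC ?H2.
- by rewrite subn0.
Qed.

(** If x_u f = x_v f, comparing coefficients at x_u m gives f(m) = f(x_u m / x_v) when x_v divides
    m, and f(m) = 0 otherwise. Induction on the exponent of [v] in [m] kills every coefficient. *)
Lemma var_seriesB_reg u v (f : pseries) : u != v -> (var_series u - var_series v) * f = 0 -> f = 0.
Proof.
move=> uv; rewrite mulrBl => /eqP; rewrite subr_eq0 => /eqP E.
suff H k (m : monomial) : m v = k -> f m = 0 by apply/funext => m; exact: (H (m v)).
have Eu m' : (mono (ucm u) * f) m' = (mono (ucm v) * f) m' by exact: (congr1 (fun f : pseries => f m') E).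
elim: k m => [|k IH] m mv.
  have <- := mono_coefM (ucm u) f m.
  apply: etrans (Eu _) _.
  apply: mono_coef0.
  by move=> b /(congr1 (fun m => cmonom_val m v)); rewrite !cmM cmUU cmU mv (negPf uv).
pose m' : monomial := divcm (mmul (ucm u) m) (ucm v).
have m'v : m' v = k by rewrite divcmE cmM cmUU cmU mv (negPf uv) add0n subn1.
have <- := mono_coefM (ucm u) f m.
apply: etrans (Eu _) _.
have -> : mmul (ucm u) m = mmul (ucm v) m'.
  apply/eqP/cmP => w; rewrite !cmM divcmE cmM !cmU.
  have vw : (v == w -> 0 < m w)%N by move/eqP <-; rewrite mv.
  have vu : (v == w -> u == w = false) by move/eqP <-; rewrite (negPf uv).
  exact: addn_subn_bool vu vw.
by apply: etrans (mono_coefM (ucm v) f m') _; exact: IH.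
Qed.

(** Degree means [mdeg] here, the number of variables with multiplicity; the weights of the
    variables enter only through [monomial_degree]. *)
Definition hcomp D (f : pseries) : pseries := fun m => if mdeg m == D then f m else 0.
Definition homog D (f : pseries) := forall m, f m != 0 -> mdeg m = D.

Lemma hcomp_homogM D e V f : homog e V -> hcomp (D + e) (V * f) = V * hcomp D f.
Proof.
move=> HV; apply/funext => m; rewrite /hcomp; case: eqP => md.
  apply: eq_series_mul => a b ab; case: (eqVneq (V a) 0) => [->|/HV ae]; rewrite ?mul0r //.
  by move: md; rewrite -ab mdegM ae; case: eqP => //; lia.
rewrite [RHS]series_mul_eq0 // => a b ab; case: (eqVneq (V a) 0) => [->|/HV ae]; rewrite ?mul0r //.
by move: md; rewrite -ab mdegM ae; case: eqP => //; rewrite ?mulr0 //; lia.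
Qed.

Lemma homogM d e f g : homog d f -> homog e g -> homog (d + e) (f * g).
Proof.
move=> Hf Hg m; apply: contraNeq => md; apply/eqP/series_mul_eq0 => a b ab.
case: (eqVneq (f a) 0) => [->|/Hf ae]; rewrite ?mul0r //.
case: (eqVneq (g b) 0) => [->|/Hg be]; rewrite ?mulr0 //.
by move: md; rewrite -ab mdegM ae be eqxx.
Qed.

Lemma homog_sum d I (r : seq I) (P : pred I) (F : I -> pseries) :
  (forall i, P i -> homog d (F i)) -> homog d (\sum_(i <- r | P i) F i).
Proof.
move=> H m; rewrite pseries_sum; apply: contraNeq => md; apply/eqP/big1 => i Pi.
by apply: contraNeq md => /(H i Pi) ->.
Qed.

Lemma homog_mono a : homog (mdeg a) (mono a).
Proof. by move=> m; rewrite /mono pnatr_eq0 eqb0 negbK => /eqP->. Qed.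

(** * Products of series in disjoint sets of variables *)

Section Classes.
Variable cl : var -> nat.

Definition part_of i (m : monomial) : monomial :=
  [cmonom (if cl v == i then m v else 0%N) | v in finsupp m]%M.

Lemma part_ofE i m v : part_of i m v = if cl v == i then m v else 0%N.
Proof.
by rewrite cmE fsfun_fun; case: ifP => // /negbT; rewrite -cmE_eq0 => /eqP->; case: ifP.
Qed.

Definition supp_in i (f : pseries) := forall m : monomial, f m != 0 -> forall v, m v != 0%N -> cl v = i.

Lemma part_ofM i m1 m2 : part_of i (mmul m1 m2) = mmul (part_of i m1) (part_of i m2).
Proof. by apply/eqP/cmP => v; rewrite cmM !part_ofE cmM; case: ifP. Qed.

(** A monomial splits uniquely into its parts in the classes below [K], so at most one factorization
    contributes to its coefficient. *)
Lemma prod_classes K (f : nat -> pseries) (m : monomial) :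
  (forall i, (i < K)%N -> supp_in i (f i)) -> (forall v, m v != 0%N -> (cl v < K)%N) ->
  (\prod_(i < K) f i) m = \prod_(i < K) f i (part_of i m).
Proof.
have supp_prod L : (forall i, (i < L)%N -> supp_in i (f i)) ->
    forall m : monomial, (\prod_(i < L) f i) m != 0 -> forall v, m v != 0%N -> (cl v < L)%N.
  elim: L => [|L IH] H {}m; first by rewrite big_ord0 pseries1 pnatr_eq0 eqb0 negbK => /eqP -> v; rewrite cm1.
  rewrite big_ord_recr /= => nz v mv; apply/negPn/negP; rewrite -leqNgt => vL; move/negP: nz; apply.
  apply/eqP/series_mul_eq0 => a b ab; apply/eqP; rewrite mulf_eq0 -implyNb; apply/implyP.
  move=> /IH - /(_ (fun i iL => H i (ltnW iL))) aL; apply/negPn/negP => /H - /(_ (ltnSn _)) bL.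
  move: mv; rewrite -ab cmM addn_eq0 negb_and => /orP[/aL|/bL vE].
    by move=> aLv; move: vL; rewrite ltnNge ltnW.
  by move: vL; rewrite vE ltnn.
elim: K m => [|K IH] m H mK.
  rewrite !big_ord0 pseries1; suff -> : m = mone by rewrite eqxx.
  by apply/eqP/cmP => v; rewrite cm1; apply/eqP; apply/negPn/negP => /mK.
rewrite !big_ord_recr /=.
pose m0 : monomial := [cmonom (if cl v == K then 0%N else m v) | v in finsupp m]%M.
have m0E v : m0 v = if cl v == K then 0%N else m v.
  by rewrite cmE fsfun_fun; case: ifP => // /negbT; rewrite -cmE_eq0 => /eqP->; case: ifP.
rewrite pseries_mulE (@series_mul_single _ _ _ m0 (part_of K m)).
- congr (_ * _); rewrite IH => [|i iK|v].
  + apply: eq_bigr => i _; congr (f i _); apply/eqP/cmP => v; rewrite !part_ofE m0E.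
    by case: eqP => // ->; rewrite ltn_eqF.
  + exact/H/ltnW.
  + by rewrite m0E; case: (eqVneq (cl v) K) => // vK mv; have := mK v mv; rewrite ltnS leq_eqVlt (negPf vK).
- by apply/eqP/cmP => v; rewrite cmM m0E part_ofE; case: ifP => _; rewrite ?addn0.
move=> a b ab ne; apply/eqP; rewrite mulf_eq0 -implyNb; apply/implyP.
move=> /supp_prod - /(_ (fun i iL => H i (ltnW iL))) aL.
apply/negPn/negP => /H - /(_ (ltnSn _)) bL; apply: ne.
have aK v : cl v = K -> a v = 0%N by move=> vK; apply/eqP/negPn/negP => /aL; rewrite vK ltnn.
have bK v : cl v != K -> b v = 0%N by move=> vK; apply/eqP; apply: contraNT vK => bv; rewrite (bL v bv).
congr pair; apply/eqP/cmP => v.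
  by rewrite m0E -ab cmM; case: eqP => [/aK//|/eqP/bK ->]; rewrite addn0.
by rewrite part_ofE -ab cmM; case: eqP => [/aK ->//|/eqP/bK ->].
Qed.

End Classes.

(** * Alternants and Schur polynomials *)

(** Extension by zero, so that a shape picked from a finite type can again be used as a function on
    all row indices. *)
Definition fun_of_ffun N B (f : {ffun 'I_N -> 'I_B}) (i : nat) : nat :=
  if insub i is Some j then f j else 0%N.

Lemma fun_of_ffunE N B (f : {ffun 'I_N -> 'I_B}) (i : 'I_N) : fun_of_ffun f i = f i.
Proof. by rewrite /fun_of_ffun valK. Qed.

Section Alternants.
Variables (R : comNzRingType) (x : nat -> R).

(** The codomain ['I_(l 0).+1] makes the sum over inner shapes finite; for weakly decreasing [l] the
    interlacing bounds already force [f i <= l 0]. *)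
Definition interlaced N (l : nat -> nat) (f : {ffun 'I_N -> 'I_(l 0%N).+1}) : bool :=
  [forall i : 'I_N, (l i.+1 <= f i <= l i)%N].

(* The inner shape f interlaces l: l/f is the horizontal strip filled with the largest letter. *)
Fixpoint schur_poly N (l : nat -> nat) : R :=
  if N is N'.+1 then
    \sum_(f : {ffun 'I_N' -> 'I_(l 0%N).+1} | interlaced f)
      x N' ^+ (\sum_(i < N) l i - \sum_(i < N') f i) * schur_poly N' (fun_of_ffun f)
  else 1.

Definition alternant N (M : nat -> nat) : R := \det (\matrix_(i < N, j < N) x j ^+ M i).

Fixpoint vandermonde N : R :=
  if N is N'.+1 then vandermonde N' * \prod_(j < N') (x j - x N') else 1.

(** A telescoping sum. [e] will be the staircase shift of a row, and [B] is the bound of the index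
    type. *)
Lemma geom_interval (y z : R) a b e B : (a <= b < B)%N ->
  y ^+ (b.+1 + e) - z ^+ (b - a).+1 * y ^+ (a + e) =
  (y - z) * \sum_(f < B | (a <= f <= b)%N) y ^+ (f + e) * z ^+ (b - f).
Proof.
move=> /andP[ab bB]; pose G f := y ^+ (f + e) * z ^+ (b.+1 - f).
have -> : \sum_(f < B | (a <= f <= b)%N) y ^+ (f + e) * z ^+ (b - f) =
          \sum_(a <= f < b.+1) y ^+ (f + e) * z ^+ (b - f).
  rewrite big_geq_mkord (big_ord_widen_cond B (leq a) (fun f => y ^+ (f + e) * z ^+ (b - f))) //.
rewrite mulr_sumr.
transitivity (G b.+1 - G a).
  by rewrite /G subnn mulr1 subSn // [z ^+ _ * _]mulrC.
rewrite -telescope_sumr; last by lia.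
rewrite [LHS]big_nat [RHS]big_nat; apply: eq_bigr => f /andP[af fb].
by rewrite /G subSS addSn subSn // !exprS; ring.
Qed.

Lemma det_sum_rows N (B : nat) (P : 'I_N -> pred 'I_B) (c : 'I_N -> 'I_B -> R)
    (Q : 'I_N -> 'I_B -> 'I_N -> R) :
  \det (\matrix_(i, j) \sum_(f | P i f) c i f * Q i f j) =
  \sum_(F : {ffun 'I_N -> 'I_B} | [forall i, P i (F i)])
    (\prod_i c i (F i)) * \det (\matrix_(i, j) Q i (F i) j).
Proof.
rewrite /determinant.
under eq_bigr => s _.
  under eq_bigr => i _ do rewrite mxE.
  rewrite bigA_distr_big_dep mulr_sumr.
  over.
rewrite exchange_big /=; apply: eq_big => [F|F _].
  by apply/familyP/forallP => H i; have := H i.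
rewrite mulr_sumr; apply: eq_bigr => s _; rewrite big_split /= mulrCA; congr (_ * (_ * _)).
by apply: eq_bigr => i _; rewrite mxE.
Qed.

(** Subtracting [x N ^+ (M i - M i.+1)] times row [i.+1] from row [i] clears the last column above
    its bottom entry and makes the other entries of column [j] divisible by [x j - x N]. The
    quotients are geometric sums whose exponents, up to the staircase shift, run over the interval
    from [l i.+1] to [l i] allowed for part [i] of an inner shape; multilinearity then chooses one
    exponent per row. *)
Lemma alternant_rec N (l : nat -> nat) : (forall i, (i < N)%N -> (l i.+1 <= l i)%N) ->
  alternant N.+1 (fun i => l i + (N.+1 - i.+1))%N =
  (\prod_(j < N) (x j - x N)) * \sum_(f : {ffun 'I_N -> 'I_(l 0%N).+1} | interlaced f)
      x N ^+ (\sum_(i < N.+1) l i - \sum_(i < N) f i) *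
      alternant N (fun i => fun_of_ffun f i + (N - i.+1))%N.
Proof.
move=> anti; pose M i := (l i + (N.+1 - i.+1))%N.
have anti0 i : (i <= N)%N -> (l i <= l 0)%N.
  by elim: i => // i IH iN; apply: leq_trans (anti _ iN) (IH (ltnW iN)).
pose A : 'M[R]_N.+1 := \matrix_(i, j) x j ^+ M i.
(* Unitriangular, so multiplication by it leaves the determinant unchanged. *)
pose L : 'M[R]_N.+1 := \matrix_(i, j) 
  if i == j then 1 else if i.+1 == j then - x N ^+ (M i - M j) else 0.
have detL : \det L = 1.
  rewrite -det_tr det_trig; last first.
    apply/is_trig_mxP => i j ij; rewrite !mxE; case: eqP => [e|_]; first by rewrite e ltnn in ij.
    by case: eqP => // e; move: ij; rewrite -e; lia.
  by rewrite big1 // => i _; rewrite !mxE eqxx.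
have LA (i j : 'I_N.+1) : (L *m A) i j =
   if (i < N)%N then x j ^+ M i - x N ^+ (M i - M i.+1) * x j ^+ M i.+1 else x j ^+ M i.
  rewrite mxE (bigD1 i) //= !mxE eqxx mul1r; case: ltnP => iN; last first.
    rewrite big1 ?addr0 // => k ki; rewrite !mxE eq_sym (negPf ki).
    by case: eqP => [e|]; rewrite ?mul0r //; have := ltn_ord k; lia.
  have iN1 : (i.+1 < N.+1)%N by [].
  rewrite (bigD1 (Ordinal iN1)) /=; last by rewrite -val_eqE /=; lia.
  rewrite big1 ?addr0 => [|k /andP[ki ki1]]; last first.
    rewrite !mxE eq_sym (negPf ki); case: eqP => [e|]; rewrite ?mul0r //.
    by move: ki1; rewrite -val_eqE /= e eqxx.
  rewrite !mxE -val_eqE /=; have -> : (i == i.+1 :> nat) = false by lia.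
  by rewrite eqxx mulNr.
have -> : alternant N.+1 (fun i => l i + (N.+1 - i.+1))%N = \det (L *m A).
  by rewrite det_mulmx detL mul1r.
(* In the last column [x j] is [x N], so the two terms of a row difference cancel; only the bottom
   entry [x N ^+ l N] survives, and its cofactor has sign +1. *)
rewrite (expand_det_col _ ord_max) (bigD1 ord_max) //= big1 ?addr0 => [|i im]; last first.
  have iN : (i < N)%N by move: im; rewrite -val_eqE /=; have := ltn_ord i; lia.
  rewrite LA iN /= -exprD subnK ?subrr ?mul0r // /M.
  by have := anti i iN; lia.
rewrite LA ltnn /cofactor -signr_odd oddD addbb expr0 mul1r.
pose P (i : 'I_N) (f : 'I_(l 0%N).+1) := (l i.+1 <= f <= l i)%N.
pose Q : 'M[R]_N := \matrix_(i, j) 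
   \sum_(f < (l 0%N).+1 | P i f) x N ^+ (l i - f) * x j ^+ (f + (N - i.+1)).
have -> : row' ord_max (col' ord_max (L *m A)) = Q *m diag_mx (\row_j (x j - x N)).
  apply/matrixP; change 'I_N.+1.-1 with 'I_N => i j; rewrite mul_mx_diag [LHS]mxE [LHS]mxE LA !mxE.
  rewrite !lift_max ltn_ord [RHS]mulrC.
  rewrite [X in _ = _ * X](_ : _ = \sum_(f < (l 0%N).+1 | (l i.+1 <= f <= l i)%N)
      x j ^+ (f + (N - i.+1)) * x N ^+ (l i - f)); last first.
    by apply: eq_bigr => f _; rewrite mulrC.
  rewrite -geom_interval; last by rewrite anti // ltnS anti0 // ltnW.
  rewrite /M; have iN : (i < N)%N := ltn_ord i; have ai := anti i iN.
  congr (_ ^+ _ - _ ^+ _ * _ ^+ _); lia.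
rewrite det_mulmx det_diag det_sum_rows mulrA [RHS]mulrC.
rewrite mulr_sumr; congr (_ * _); last by apply: eq_bigr => j _; rewrite mxE.
apply: eq_big => [//|f /forallP fint]; rewrite mulrA prodrXr -exprD; congr (x N ^+ _ * _).
  rewrite /= big_ord_recr /= /M sumnB; last by move=> i _; have /andP[] := fint i.
  have le : (\sum_(i < N) f i <= \sum_(i < N) l i)%N.
    by apply: leq_sum => i _; have /andP[] := fint i.
  by rewrite subnn addn0 addnBA // addnC.
rewrite /alternant; congr (\det _); by apply/matrixP => i j; rewrite !mxE fun_of_ffunE.
Qed.

(** Stated as a product because the Vandermonde factor need not be invertible; both sides satisfy
    the same recursion on the number of variables. *)
Lemma bialternant N l : (forall i, (i.+1 < N)%N -> (l i.+1 <= l i)%N) ->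
  vandermonde N * schur_poly N l = alternant N (fun i => l i + (N - i.+1))%N.
Proof.
elim: N l => [|N IH] l anti; first by rewrite /alternant det_mx00 mulr1.
rewrite alternant_rec // [vandermonde _]/= [schur_poly _ _]/= [vandermonde N * _]mulrC -mulrA; congr (_ * _).
rewrite mulr_sumr; apply: eq_bigr => f /forallP fint; rewrite mulrCA IH // => i iN.
have i0N := ltnW iN.
have := fint (Ordinal iN); have := fint (Ordinal i0N).
rewrite -(fun_of_ffunE f (Ordinal iN)) -(fun_of_ffunE f (Ordinal i0N)) /=; lia.
Qed.

End Alternants.

(** * Bead moves as row operations on determinants *)

Section BeadMoves.
Variables (R : comNzRingType) (x g : nat -> R) (r : nat).
Hypothesis r0 : (0 < r)%N.
Hypothesis gE : forall j, g j = 1 + x j ^+ r * g j.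

(* With g j the sum of the x_j^(r i), a row M i >= b stands for all upward moves of that bead by
   multiples of r; raising b past a bead splits off the moves of this bead, one step at a time. *)
Definition movable_alternant N b (M : nat -> nat) : R :=
  \det (\matrix_(i < N, j < N) (x j ^+ M i * (if (b <= M i)%N then g j else 1))).

Lemma movable_alternant0 N M :
  movable_alternant N 0 M = (\prod_(j < N) g j) * alternant x N M.
Proof.
rewrite /movable_alternant (_ : (\matrix_(i, j) _) = (\matrix_(i < N, j < N) x j ^+ M i) *m diag_mx (\row_j g j)).
  rewrite det_mulmx det_diag mulrC; congr (_ * _).
  by apply: eq_bigr => j _; rewrite mxE.
by apply/matrixP => i j; rewrite mul_mx_diag !mxE.
Qed.

Lemma movable_alternant_id N b M : (forall i, (i < N)%N -> (M i < b)%N) ->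
  movable_alternant N b M = alternant x N M.
Proof.
move=> H; congr (\det _); apply/matrixP => i j; rewrite !mxE.
by rewrite leqNgt H ?mulr1 // ltn_ord.
Qed.

Lemma movable_alternant_fixed N b M : (forall i, (i < N)%N -> M i != b) ->
  movable_alternant N b M = movable_alternant N b.+1 M.
Proof.
move=> H; congr (\det _); apply/matrixP => i j; rewrite !mxE.
by rewrite leq_eqVlt eq_sym (negPf (H i (ltn_ord i))).
Qed.

Lemma movable_alternant_dup N b M i1 i2 : (i1 < N)%N -> (i2 < N)%N -> i1 != i2 ->
  M i1 = M i2 -> movable_alternant N b M = 0.
Proof.
move=> i1N i2N ne E; apply: (@determinant_alternate _ _ _ (Ordinal i1N) (Ordinal i2N)) => // j.
by rewrite !mxE /= E.
Qed.

(** Row [i1] splits along [g j = 1 + x j ^+ r * g j]: in the first summand the bead stays at [b] for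
    good, in the second it sits at [b + r], which is above [b] since [r > 0], and may move again. *)
Lemma movable_alternant_move N b M i1 : (i1 < N)%N -> M i1 = b ->
  (forall i, (i < N)%N -> i != i1 -> M i != b) ->
  movable_alternant N b M = movable_alternant N b.+1 M +
    movable_alternant N b.+1 (fun i => if i == i1 then (b + r)%N else M i).
Proof.
move=> i1N Mb H; rewrite /movable_alternant.
set A := \matrix_(i, j) _; set B := \matrix_(i, j) _; set C := \matrix_(i, j) _.
rewrite (@determinant_multilinear _ _ A B C (Ordinal i1N) 1 1) ?mul1r //.
- apply/rowP => j; rewrite !mxE /= !mul1r eqxx Mb leqnn ltnn.
  have -> : (b < b + r)%N by lia.
  by rewrite mulr1 {1}gE mulrDr mulr1 exprD mulrA.
- apply/matrixP => i j; rewrite !mxE.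
  have ne : (lift (Ordinal i1N) i : nat) != i1 by rewrite /= eq_sym neq_bump.
  have := H _ (ltn_ord (lift (Ordinal i1N) i)) ne.
  by rewrite [in RHS]leq_eqVlt eq_sym => /negPf ->.
- apply/matrixP => i j; rewrite !mxE.
  have ne : (lift (Ordinal i1N) i : nat) != i1 by rewrite /= eq_sym neq_bump.
  have := H _ (ltn_ord (lift (Ordinal i1N) i)) ne.
  by rewrite (negPf ne) [in RHS]leq_eqVlt eq_sym => /negPf ->.
Qed.

(** A moved bead overtakes [i1 - i0] others. [M'] lists the beads in order again: row [i1] is pulled
    up to [i0] and the rows in between slide down by one, a cycle of sign [(-1) ^+ (i1 - i0)]. *)
Lemma movable_alternant_cycle N b M M' i0 i1 : (i0 <= i1 < N)%N ->
  M' i0 = M i1 -> (forall i, (i < i0)%N || (i1 < i)%N -> M' i = M i) ->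
  (forall i, (i0 <= i < i1)%N -> M' i.+1 = M i) ->
  movable_alternant N b M = (-1) ^+ (i1 - i0) * movable_alternant N b M'.
Proof.
case: N => [|n]; first by rewrite ltn0 andbF.
move=> /andP[i01 i1N] top out inn.
have i0N : (i0 < n.+1)%N by exact: leq_ltn_trans i01 i1N.
(* This [lift_perm] of the identity sends [i0] to [i1] and keeps the order of the remaining
   indices. *)
pose s : 'S_n.+1 := lift_perm (Ordinal i0N) (Ordinal i1N) 1%g.
rewrite /movable_alternant; set A := \matrix_(i, j) _; set A' := \matrix_(i, j) _.
have -> : A' = row_perm s A.
  apply/matrixP => i j; rewrite !mxE; suff -> : M' i = M (s i) by [].
  case: (unliftP (Ordinal i0N) i) => [k ->|->]; last by rewrite lift_perm_id.
  rewrite lift_perm_lift perm1 /= /bump; case: (leqP i0 k) => k0; case: (leqP i1 k) => k1 //=.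
  - by rewrite !add1n out // ltnS k1 orbT.
  - by rewrite add1n add0n inn // k0.
  - by have := leq_ltn_trans (leq_trans i01 k1) k0; rewrite ltnn.
  - by rewrite !add0n out // k0.
rewrite row_permE det_mulmx det_perm odd_lift_perm odd_perm1 addbF /= mulrA.
suff -> : (-1) ^+ (i1 - i0) * (-1) ^+ (odd i0 (+) odd i1) = 1 :> R by rewrite mul1r.
by rewrite -oddD signr_odd -exprD addnA subnK // -signr_odd oddD addbb.
Qed.

End BeadMoves.

Local Open Scope nat_scope.

(** * Ribbons *)

Lemma nth_part_anti (la : intpart) i j : i <= j -> nth 0 la j <= nth 0 la i.
Proof.
move=> ij; case: (ltnP j (size la)) => [js|?]; last by rewrite [nth 0 la j]nth_default.
have /andP[srt _] := partsP la.
have geqT : transitive geq by move=> y x z /= yx zy; exact: leq_trans zy yx.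
have geqR : reflexive geq by move=> x /=.
exact: (sorted_leq_nth geqT geqR 0 srt) (leq_ltn_trans ij js) js ij.
Qed.

Lemma ltn_size_part (la : intpart) i : (i < size la) = (0 < nth 0 la i).
Proof.
case: ltnP => [il|?]; last by rewrite nth_default.
have /andP[_ /allP pos] := partsP la.
by apply/esym/pos/mem_nth.
Qed.

Lemma intpart_inj (la mu : intpart) : (forall i, nth 0 la i = nth 0 mu i) -> la = mu.
Proof.
move=> H; apply/val_inj/(@eq_from_nth _ 0) => [|i _]; last exact: H.
apply/eqP; rewrite eqn_leq; apply/andP; split; rewrite leqNgt; apply/negP.
  by rewrite ltn_size_part H -ltn_size_part ltnn.
by rewrite ltn_size_part -H -ltn_size_part ltnn.
Qed.

Lemma intpart_of_fun N (l : nat -> nat) : (forall i, i.+1 < N -> l i.+1 <= l i) ->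
  exists la : intpart, forall i, nth 0 la i = if i < N then l i else 0.
Proof.
move=> anti; have antiW i j : i <= j -> j < N -> l j <= l i.
  elim: j => [|j IH]; first by rewrite leqn0 => /eqP->.
  rewrite leq_eqVlt => /orP[/eqP-> //|ij jN].
  exact: leq_trans (anti _ jN) (IH ij (ltnW jN)).
(* The list of parts is cut at the first zero of [l]; monotonicity makes all later values zero. *)
pose k := find (fun i => l i == 0) (iota 0 N).
have kN : k <= N by rewrite -[X in _ <= X](size_iota 0 N) find_size.
have P : is_part (mkseq l k).
  apply/andP; split.
    apply/(sortedP 0) => i; rewrite size_mkseq => ik.
    by rewrite !nth_mkseq ?(ltnW ik) //; apply: anti; exact: leq_trans ik kN.
  apply/allP => _ /mapP[i + ->]; rewrite mem_iota add0n /= => ik.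
  have := before_find 0 ik; rewrite nth_iota ?add0n ?lt0n ?(leq_trans ik) // => /negbT.
  by [].
exists (IntPart P) => i /=; case: (ltnP i k) => ik.
  by rewrite nth_mkseq // (leq_trans ik kN).
rewrite nth_default ?size_mkseq //; case: ltnP => // iN; apply/esym/eqP.
have kN' : k < N by exact: leq_ltn_trans ik iN.
have := antiW _ _ ik iN; have := @nth_find _ 0 (fun i => l i == 0) (iota 0 N).
rewrite has_find size_iota -/k kN' nth_iota // add0n => /(_ isT)/eqP->.
by rewrite leqn0.
Qed.

Lemma mem_dg mu i j : ((i, j) \in dg mu) = [&& 0 < i, 0 < j & j <= nth 0 mu i.-1].
Proof.
apply/allpairsPdep/idP => [[a [b [+ + [-> ->]]]]|/and3P[i0 j0 ji]].
  by rewrite !mem_iota => /andP[-> _] /andP[-> /=]; rewrite add1n ltnS.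
exists i, j; split => //; rewrite mem_iota ?i0 ?j0 add1n ltnS //=.
case: i i0 ji => // i _ /= ji; rewrite ltnNge; apply/negP => /(nth_default 0) E.
by move: ji; rewrite E leqNgt j0.
Qed.

Lemma uniq_dg mu : uniq (dg mu).
Proof.
apply: allpairs_uniq_dep => [|i _|]; rewrite ?iota_uniq //.
by move=> [i j] [i' j'] _ _ /= [-> ->].
Qed.

Lemma mem_skew (nu mu : seq nat) i j :
  ((i, j) \in skew nu mu) = [&& 0 < i, nth 0 mu i.-1 < j & j <= nth 0 nu i.-1].
Proof.
rewrite mem_filter !mem_dg; case: i => //= i.
by case: j => //= j; rewrite -leqNgt ltnS.
Qed.

Lemma uniq_skew nu mu : uniq (skew nu mu).
Proof. exact/filter_uniq/uniq_dg. Qed.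

Lemma dg_subP (nu mu : seq nat) : {subset dg mu <= dg nu} <-> forall i, nth 0 mu i <= nth 0 nu i.
Proof.
split => [H i|H [i j]]; last first.
  by rewrite !mem_dg => /and3P[-> -> /leq_trans]; apply; exact: H.
case E: (nth 0 mu i) => [//|j].
by have := H (i.+1, j.+1); rewrite !mem_dg /= E => /(_ (leqnn _)).
Qed.

(* The ribbon nu/mu occupies exactly the rows i0, ..., i1, which count from 0 here but from 1 in
   the coordinates of a box. *)
Definition ribbon_rows r (nu mu : intpart) i0 i1 : Prop :=
  [/\ i0 <= i1,
      forall i, (i < i0) || (i1 < i) -> nth 0 nu i = nth 0 mu i,
      forall i, i0 <= i < i1 -> nth 0 nu i.+1 = (nth 0 mu i).+1
    & nth 0 nu i0 + (i1 - i0) = nth 0 mu i1 + r].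

Section RibbonPath.

Let below (x y : box) := (x.1 <= y.1) && (y.2 <= x.2).

Lemma ribbon_step_below x y : ribbon_step x y -> below x y.
Proof. by rewrite /ribbon_step /below => /orP[] /andP[/eqP e /eqP f]; lia. Qed.

Lemma below_trans : transitive below.
Proof. by move=> y x z /andP[a b] /andP[c d]; rewrite /below; lia. Qed.

Lemma ribbon_path_pairwise s : sorted ribbon_step s -> pairwise below s.
Proof. by rewrite -(sorted_pairwise below_trans); apply: sub_sorted; exact: ribbon_step_below. Qed.

(** Each step of a ribbon lowers the content, column minus row, by one; the equation is arranged to
    avoid truncated subtraction. *)
Lemma ribbon_path_content x p : path ribbon_step x p ->
  (last x p).1 + x.2 = x.1 + (last x p).2 + size p.
Proof.
elim: p x => [|y p IH] x /=; first by lia.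
by case/andP; rewrite /ribbon_step => + /IH => /orP[] /andP[/eqP e /eqP f]; lia.
Qed.

Lemma ribbon_path_down x p i : path ribbon_step x p -> x.1 <= i < (last x p).1 ->
  exists j pseries1 p2, x :: p = pseries1 ++ [:: (i, j), (i.+1, j) & p2].
Proof.
elim: p x => [|y p IH] x /=; first by lia.
case/andP=> xy yp ip; case: (leqP y.1 i) => yi.
  have [|j [pseries1 [p2 ->]]] := IH y yp; first by lia.
  by exists j, (x :: pseries1), p2.
move: xy; rewrite /ribbon_step => /orP[] /andP[/eqP e /eqP f]; first by lia.
exists x.2, [::], p; case: x y e f yi ip {yp} => [x1 x2] [y1 y2] /= -> -> ? ?.
by have -> : x1 = i by lia.
Qed.

(** The path starts at the top right box [x] and ends at the bottom left one. It contains all boxes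
    of the skew shape, and any two of them are comparable for [below]; a box violating one of the
    row conditions would have no place on it. *)
Lemma is_ribbon_rows r nu mu : 0 < r -> is_ribbon r nu mu ->
  exists i0 i1, ribbon_rows r nu mu i0 i1.
Proof.
move=> r0 [/dg_subP sub [b [bs br bsort]]].
case: b bs br bsort => [|x p] bs br bsort; first by rewrite -br in r0.
have inb i j : ((i, j) \in x :: p) = [&& 0 < i, nth 0 mu i.-1 < j & j <= nth 0 nu i.-1].
  by rewrite (perm_mem bs) mem_skew.
have lastin : last x p \in x :: p by exact: mem_last.
have pw := ribbon_path_pairwise bsort.
have xmin z : z \in x :: p -> below x z.
  rewrite inE => /orP[/eqP->|]; first by rewrite /below !leqnn.
  by move: pw => /= /andP[/allP + _]; apply.
have lmax z : z \in x :: p -> below z (last x p).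
  move: pw; rewrite lastI pairwise_rcons => /andP[/allP H _]; rewrite mem_rcons inE.
  by case/orP => [/eqP->|/H//]; rewrite /below !leqnn.
have xin : (x.1, x.2) \in x :: p by rewrite -surjective_pairing mem_head.
have lin : ((last x p).1, (last x p).2) \in x :: p by rewrite -surjective_pairing.
have cont := ribbon_path_content bsort.
have down := fun i => @ribbon_path_down x p i bsort.
move: (xin) (lin); rewrite !inb => /and3P[x1 xm xn] /and3P[l1 lm ln].
have := lmax _ xin; rewrite /below /= => /andP[xl1 xl2].
exists x.1.-1, (last x p).1.-1; split.
- by lia.
- move=> i ii; apply/eqP; rewrite eqn_leq sub andbT leqNgt; apply/negP => lt.
  have zin : (i.+1, nth 0 nu i) \in x :: p by rewrite inb /= lt leqnn.
  by have := lmax _ zin; have := xmin _ zin; rewrite /below /=; lia.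
(* The path passes from one row to the next in a single column [j]; a box just right of [j] in the
   lower row, or just left of [j] in the upper row, would be incomparable with one of the two boxes
   of the crossing. *)
- move=> i ii; have [|j [pseries1 [p2 E]]] := down i.+1; first by lia.
  have in1 : (i.+1, j) \in x :: p by rewrite E mem_cat !inE eqxx orbT.
  have in2 : (i.+2, j) \in x :: p by rewrite E mem_cat !inE eqxx !orbT.
  move: pw; rewrite E pairwise_cat /= => /and3P[/allrelP H1 _].
  case/and3P => _ /allP H2 _.
  move: (in1) (in2); rewrite !inb /= => /andP[m1 n1] /andP[m2 n2].
  have cases z : z \in x :: p -> [|| below z (i.+1, j) && below z (i.+2, j), z == (i.+1, j), z == (i.+2, j) | below (i.+2, j) z].
    rewrite E mem_cat !inE => /or4P[zp|->|->|/H2->]; rewrite ?orbT //.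
    by rewrite (H1 z (i.+1, j)) ?(H1 z (i.+2, j)) // !inE eqxx ?orbT.
  have -> : nth 0 nu i.+1 = j.
    apply/eqP; rewrite eqn_leq n2 andbT leqNgt; apply/negP => lt.
    have /cases : (i.+2, j.+1) \in x :: p by rewrite inb /= lt andbT; lia.
    by rewrite /below !xpair_eqE /=; lia.
  apply/eqP; rewrite eqn_leq m1 andbT leqNgt; apply/negP => lt.
  have /cases : (i.+1, j.-1) \in x :: p by rewrite inb /=; lia.
  by rewrite /below !xpair_eqE /=; lia.
(* The first box of the path is the right end of its row in [nu], the last one immediately follows
   its row in [mu]; the difference of their contents gives the equation with [r]. *)
have zin : (x.1, nth 0 nu x.1.-1) \in x :: p by rewrite inb x1 leqnn andbT; lia.
have win : ((last x p).1, (nth 0 mu (last x p).1.-1).+1) \in x :: p by rewrite inb l1 leqnn; lia.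
have := lmax _ win; have := xmin _ zin; rewrite /below /= => /andP[_ h1] /andP[_ h2].
by move: br => /=; lia.
Qed.

Lemma ribbon_rows_lt r nu mu i0 i1 i : 0 < r -> ribbon_rows r nu mu i0 i1 ->
  i0 <= i <= i1 -> nth 0 mu i < nth 0 nu i.
Proof.
move=> r0 [le out inn fin] ii.
case: (eqVneq i i1) => [->|ne].
  case: (eqVneq i0 i1) fin => [->|ne0 _]; first by lia.
  have -> : i1 = i1.-1.+1 by lia.
  rewrite inn; last by lia.
  by rewrite ltnS nth_part_anti.
have := inn i; have := @nth_part_anti nu i i.+1 (leqnSn _); lia.
Qed.

Lemma ribbon_rows_ge r nu mu i0 i1 : 0 < r -> ribbon_rows r nu mu i0 i1 ->
  forall i, nth 0 mu i <= nth 0 nu i.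
Proof.
move=> r0 R i; case: (boolP ((i < i0) || (i1 < i))) => [io|ii].
  by case: R => _ out _ _; rewrite out.
by apply/ltnW/(ribbon_rows_lt r0 R); lia.
Qed.

Lemma mem_skew_rows r nu mu i0 i1 i j : 0 < r -> ribbon_rows r nu mu i0 i1 ->
  ((i, j) \in skew nu mu) = [&& i0 < i, i <= i1.+1, nth 0 mu i.-1 < j & j <= nth 0 nu i.-1].
Proof.
move=> r0 [le out inn fin]; rewrite mem_skew; case: i => //= i.
have := out i; rewrite !ltnS; lia.
Qed.

(** The boxes are listed row by row, each row from right to left; the last box of row [i] lies
    directly above the first box of row [i.+1] because [nth 0 nu i.+1 = (nth 0 mu i).+1]. *)
Lemma ribbon_rows_is_ribbon r nu mu i0 i1 : 0 < r -> ribbon_rows r nu mu i0 i1 -> is_ribbon r nu mu.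
Proof.
move=> r0 R; split; first exact/dg_subP/(ribbon_rows_ge r0 R).
pose rl i := [seq (i.+1, nth 0 nu i - t) | t <- iota 0 (nth 0 nu i - nth 0 mu i)].
have lt i : i0 <= i <= i1 -> nth 0 mu i < nth 0 nu i by apply: ribbon_rows_lt R.
have rlP i : i0 <= i <= i1 -> exists p, [/\ rl i = (i.+1, nth 0 nu i) :: p,
     path ribbon_step (i.+1, nth 0 nu i) p & last (i.+1, nth 0 nu i) p = (i.+1, (nth 0 mu i).+1)].
  have gen n a : n < a -> exists p, [/\ [seq (i.+1, a - t) | t <- iota 0 n.+1] = (i.+1, a) :: p,
       path ribbon_step (i.+1, a) p & last (i.+1, a) p = (i.+1, a - n)].
    elim: n => [|n IH] na; first by exists [::]; rewrite /= subn0.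
    have [p [e1 e2 e3]] := IH (ltnW na); exists (rcons p (i.+1, a - n.+1)); split.
    - by rewrite -[n.+2]addn1 iotaD map_cat e1 /= cats1.
    - by rewrite rcons_path e2 e3 /ribbon_step /= eqxx /=; lia.
    - by rewrite last_rcons.
  move=> /lt ltm; have := gen (nth 0 nu i - nth 0 mu i).-1 (nth 0 nu i).
  rewrite prednK; last by lia.
  case; first by lia.
  move=> p [e1 e2 e3]; exists p; split=> //; rewrite e3; congr pair; lia.
have [i01 out inn fin] := R.
pose lst n := flatten [seq rl i | i <- iota i0 n.+1].
have lstP n : i0 + n <= i1 -> exists p, [/\ lst n = (i0.+1, nth 0 nu i0) :: p,
     path ribbon_step (i0.+1, nth 0 nu i0) p &
     last (i0.+1, nth 0 nu i0) p = ((i0 + n).+1, (nth 0 mu (i0 + n)).+1)].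
  elim: n => [|n IH] le.
    rewrite /lst /= cats0 addn0; apply: rlP; lia.
  have [|p [e1 e2 e3]] := IH; first by lia.
  have [|q [f1 f2 f3]] := rlP (i0 + n).+1; first by lia.
  exists (p ++ rl (i0 + n).+1); split.
  - by rewrite /lst -[n.+2]addn1 iotaD map_cat flatten_cat -/(lst n) e1 /= cats0 addnS.
  - rewrite cat_path e2 e3 f1 /= f2 andbT /ribbon_step /= inn; last by lia.
    by rewrite !eqxx orbT.
  - by rewrite last_cat e3 f1 /= f3 addnS.
have [|p [e1 e2 e3]] := lstP (i1 - i0); first by lia.
rewrite subnKC // in e3.
have memlst z : (z \in lst (i1 - i0)) = (z \in skew nu mu).
  case: z => i j; rewrite (mem_skew_rows _ _ r0 R).
  apply/flattenP/idP => [[_ /mapP[a + ->]]|].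
    rewrite mem_iota => ha /mapP[t + [-> ->]]; rewrite mem_iota /=; lia.
  case: i => //= i /and4P[h1 h2 h3 h4]; exists (rl i).
    by apply: (map_f rl (x := i) (s := iota i0 (i1 - i0).+1)); rewrite mem_iota; lia.
  apply/mapP; exists (nth 0 nu i - j); first by rewrite mem_iota; lia.
  by congr pair; lia.
exists (lst (i1 - i0)); split.
- apply: uniq_perm memlst; last exact: uniq_skew.
  (* Contents drop strictly along the path, so no box is repeated. *)
  pose content_lt (x y : box) := x.1 + y.2 < y.1 + x.2.
  apply: (@sorted_uniq _ content_lt).
  + by move=> y x z; rewrite /content_lt; lia.
  + by move=> x; rewrite /content_lt ltnn.
  apply: (@sub_sorted _ ribbon_step); last by rewrite e1.
  by move=> x y; rewrite /ribbon_step /content_lt; lia.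
- by have := ribbon_path_content e2; rewrite e1 e3 /=; lia.
- by rewrite e1.
Qed.

Lemma bigmin_seqE (T : eqType) (s : seq T) (f : T -> nat) k0 k :
  (forall x, x \in s -> k <= f x) -> k <= k0 -> (exists2 x, x \in s & f x = k) ->
  \big[minn/k0]_(x <- s) f x = k.
Proof.
move=> H kk [x xs fx]; apply/eqP; rewrite eqn_leq; apply/andP; split.
  elim: s xs {H} => // y s IH; rewrite inE big_cons => /orP[/eqP<-|/IH]; rewrite geq_min.
    by rewrite fx leqnn.
  by move->; rewrite orbT.
elim: s {xs} H => [|y s IH] H; rewrite ?big_nil // big_cons leq_min H ?mem_head //=.
by apply: IH => z zs; apply: H; rewrite inE zs orbT.
Qed.

Lemma ribbon_rows_top r nu mu i0 i1 : 0 < r -> ribbon_rows r nu mu i0 i1 ->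
  top_row nu mu = i0.+1.
Proof.
move=> r0 R; have i01 : i0 <= i1 by case: R.
have lt0 := ribbon_rows_lt r0 R (_ : i0 <= i0 <= i1).
apply: bigmin_seqE.
- by move=> [i j]; rewrite (mem_skew_rows _ _ r0 R) => /and4P[].
(* The default value [size nu] of the minimum is harmless: row [i0] of [nu] is non-empty. *)
- by rewrite ltn_size_part; lia.
- by exists (i0.+1, nth 0 nu i0); rewrite // (mem_skew_rows _ _ r0 R) /=; lia.
Qed.

Lemma ribbon_rows_sgn r nu mu i0 i1 : 0 < r -> ribbon_rows r nu mu i0 i1 ->
  sgn_ribbon nu mu = ((-1) ^+ (i1 - i0))%R.
Proof.
move=> r0 R; rewrite /sgn_ribbon; congr (_ ^+ _)%R.
suff -> : size (undup [seq b.1 | b <- skew nu mu]) = (i1 - i0).+1 by [].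
rewrite -(size_iota i0.+1 (i1 - i0).+1); apply/perm_size/uniq_perm; rewrite ?undup_uniq ?iota_uniq //.
move=> i; rewrite mem_undup mem_iota; apply/mapP/idP => [[[a b]]|ii].
  by rewrite (mem_skew_rows _ _ r0 R) => /and4P[h1 h2 h3 h4] /= ->; lia.
exists (i, nth 0 nu i.-1) => //; rewrite (mem_skew_rows _ _ r0 R) leqnn andbT.
case: i ii => // i ii /=.
by have := @ribbon_rows_lt _ _ _ _ _ i r0 R; case: R => ? _ _ _; lia.
Qed.

End RibbonPath.

(** * Beads *)

Section Beads.
Variables (N r : nat).
Implicit Types (la mu nu : intpart) (b : nat).

(** The beta-numbers of a partition with [N] rows, zero rows included; for a partition they decrease
    strictly in [i < N]. *)
Definition bead (la : seq nat) i := nth 0 la i + (N - i.+1).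
Definition beads (la : seq nat) := [seq bead la i | i <- iota 0 N].

Lemma beadsP la x : reflect (exists2 i, i < N & bead la i = x) (x \in beads la).
Proof.
apply: (iffP mapP) => [[i]|[i iN <-]]; rewrite ?mem_iota.
  by move=> iN ->; exists i.
by exists i; rewrite ?mem_iota.
Qed.

Lemma bead_lt la i j : i < j < N -> bead la j < bead la i.
Proof.
move=> ij; have := @nth_part_anti la i j; rewrite /bead; lia.
Qed.

Lemma bead_inj la i j : i < N -> j < N -> bead la i = bead la j -> i = j.
Proof.
move=> iN jN e; case: (ltngtP i j) => // ij.
  by have := @bead_lt la i j; rewrite e ltnn ij jN => /(_ isT).
by have := @bead_lt la j i; rewrite e ltnn ij iN => /(_ isT).
Qed.

Lemma beads_inj la mu : size la <= N -> size mu <= N -> beads la =i beads mu -> la = mu.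
Proof.
move=> sl sm E; apply: intpart_inj => i; case: (ltnP i N) => iN; last first.
  by rewrite !nth_default // (leq_trans _ iN).
have srt (ka : intpart) : sorted gtn (beads ka).
  apply/(sortedP 0) => j; rewrite size_map size_iota => jN.
  rewrite !(nth_map 0) ?size_iota ?(ltnW jN) // !nth_iota ?(ltnW jN) //.
  by apply: bead_lt; rewrite ltnSn.
have gtnT : transitive gtn by move=> y x z /= yx zy; exact: ltn_trans zy yx.
have gtnI : irreflexive gtn by move=> x /=; rewrite ltnn.
have /(congr1 (fun s => nth 0 s i)) := irr_sorted_eq gtnT gtnI (srt la) (srt mu) E.
rewrite !(nth_map 0) ?size_iota // nth_iota // add0n /bead; lia.
Qed.

(** The source is the bead of the bottom row [i1] of the ribbon, which jumps over the beads of the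
    rows from [i0] to [i1 - 1]. The size bound keeps [nu] within the [N] beads. *)
Definition bead_step b mu nu : Prop := size nu <= N /\
  exists i0 i1, [/\ ribbon_rows r nu mu i0 i1, i1 < N & bead mu i1 = b].

(** These three equations are what [movable_alternant_cycle] asks for when the rows are put back in
    order. *)
Lemma ribbon_rows_bead nu mu i0 i1 : ribbon_rows r nu mu i0 i1 -> i1 < N ->
  [/\ bead nu i0 = bead mu i1 + r,
      forall i, (i < i0) || (i1 < i) -> bead nu i = bead mu i
    & forall i, i0 <= i < i1 -> bead nu i.+1 = bead mu i].
Proof.
move=> [le out inn fin] iN; split => [|i io|i ii]; rewrite /bead.
- by lia.
- by rewrite out.
- by rewrite inn //; lia.
Qed.

Hypothesis r0 : 0 < r.

Lemma bead_step_beads b mu nu : bead_step b mu nu ->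
  [/\ b \in beads mu, b + r \notin beads mu
    & forall x, (x \in beads nu) = ((x \in beads mu) && (x != b)) || (x == b + r)].
Proof.
move=> [sn [i0 [i1 [R i1N <-]]]]; have [top out inn] := ribbon_rows_bead R i1N.
have le : i0 <= i1 by case: R.
have neq i : i < N -> bead mu i != bead mu i1 + r.
  move=> iN; apply/eqP; rewrite -top => e.
  case: (boolP ((i < i0) || (i1 < i))) => io.
    by move: e; rewrite -out // => /bead_inj; lia.
  case: (ltnP i i1) => ii; last first.
    have ei : i = i1 by lia.
    by move: e; rewrite ei top; lia.
  by move: e; rewrite -inn; [move/bead_inj; lia|lia].
split; first by apply/beadsP; exists i1.
  by apply/beadsP => -[i iN /eqP]; apply/negP/neq.
move=> x; apply/beadsP/idP => [[i iN <-]|].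
  case: (eqVneq i i0) => [->|ne]; first by rewrite top eqxx orbT.
  case: (boolP ((i < i0) || (i1 < i))) => io.
    rewrite out //; apply/orP; left; apply/andP; split; first by apply/beadsP; exists i.
    by apply/eqP => /bead_inj; lia.
  have -> : i = i.-1.+1 by lia.
  rewrite inn; last by lia.
  apply/orP; left; apply/andP; split; first by apply/beadsP; exists i.-1; lia.
  by apply/eqP => /bead_inj; lia.
case/orP=> [/andP[/beadsP[i iN <-] ne]|/eqP->]; last by exists i0; rewrite ?top //; lia.
have ni : i != i1 by apply: contraNneq ne => ->.
case: (boolP ((i < i0) || (i1 < i))) => io; first by exists i; rewrite ?out.
by exists i.+1; rewrite ?inn; lia.
Qed.

Lemma bead_step_uniq b mu nu nu' : bead_step b mu nu -> bead_step b mu nu' -> nu = nu'.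
Proof.
move=> S S'; apply: beads_inj; [by case: S|by case: S'|move=> x].
have [_ _ ->] := bead_step_beads S.
by have [_ _ ->] := bead_step_beads S'.
Qed.

Lemma bead_step_src b b' mu nu : bead_step b mu nu -> bead_step b' mu nu -> b = b'.
Proof.
move=> /bead_step_beads[bm brm Hb] /bead_step_beads[bm' brm' Hb'].
have := Hb b; rewrite Hb' bm eqxx /=.
have /negbTE -> : b != b + r by lia.
by case: eqVneq.
Qed.

(** The target [c] determines the top row: [i0] is the first row whose bead is smaller than [c]. *)
Lemma bead_step_ex b mu : size mu <= N -> b \in beads mu -> b + r \notin beads mu ->
  exists nu, bead_step b mu nu.
Proof.
move=> sm /beadsP[i1 i1N <-] /beadsP Hn.
pose c := bead mu i1 + r.
have neq i : i < N -> bead mu i != c by move=> iN; apply/eqP => e; apply: Hn; exists i.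
have ex0 : exists i, (i < N) && (bead mu i < c) by exists i1; rewrite i1N /c /=; lia.
pose i0 := ex_minn ex0.
have [i0N i0c i0min] : [/\ i0 < N, bead mu i0 < c & forall i, i < i0 -> c < bead mu i].
  rewrite /i0; case: ex_minnP => i /andP[iN ic] imin; split => // j ji.
  have jN : j < N by lia.
  rewrite ltn_neqAle eq_sym neq //= leqNgt; apply/negP => jc.
  by have := imin j; rewrite jN jc; lia.
have i01 : i0 <= i1.
  by rewrite leqNgt; apply/negP => /i0min; rewrite /c; lia.
(* The inverse of [bead] applied to the reordered beads. *)
pose l i := if i < i0 then nth 0 mu i else if i == i0 then c - (N - i0.+1) else
   if i <= i1 then (nth 0 mu i.-1).+1 else nth 0 mu i.
have [nu nuE] : exists nu : intpart, forall i, nth 0 nu i = if i < N then l i else 0.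
  apply: intpart_of_fun => i iN.
  have m1 := @nth_part_anti mu i i.+1 (leqnSn _).
  have m2 := @nth_part_anti mu i.-1 i (leq_pred _).
  have c0 := i0min i; rewrite /l; move: i0c c0 m1 m2; rewrite /bead.
  case: (ltngtP i.+1 i0) => [h|h|h].
  - by move=> _ _ m1 _; exact: m1.
  - case: eqP => [->|ne] ? ? /=; first by case: ifP => ?; lia.
    by case: (leqP i i1); case: (ltnP i i1); lia.
  - move=> ? ? ? ?; lia.
have nuEN i : i < N -> nth 0 nu i = l i by move=> iN; rewrite nuE iN.
exists nu; split.
  by rewrite leqNgt ltn_size_part nuE ltnn.
(* The subtraction in [l i0] is not truncated. *)
have cN : N - i0.+1 <= c.
  case: (eqVneq i0 i1) => [->|ne]; first by rewrite /c /bead; lia.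
  by move: i0c; rewrite /bead; lia.
exists i0, i1; split=> //; split=> //.
- move=> i io; case: (ltnP i N) => iN; last by rewrite nuE ltnNge iN nth_default ?(leq_trans sm).
  rewrite nuEN // /l; case: ifP => // h; have -> : (i == i0) = false by lia.
  by have -> : (i <= i1) = false by lia.
- move=> i ii; rewrite nuEN /l; last by lia.
  have [-> ->] : i.+1 < i0 = false /\ (i.+1 == i0) = false by lia.
  by have -> : i < i1 by lia.
- by rewrite nuEN // /l ltnn eqxx; move: cN; rewrite /c /bead; lia.
Qed.

(** [lo] bounds the next source from below; passing on [b.+1] makes the sources strictly
    increasing. *)
Fixpoint bead_chain lo mu (t : seq intpart) : Prop :=
  if t is nu :: t' then exists b, [/\ lo <= b, bead_step b mu nu & bead_chain b.+1 nu t']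
  else True.

Lemma bead_chain_weak lo lo' mu t : lo' <= lo -> bead_chain lo mu t -> bead_chain lo' mu t.
Proof.
case: t => //= nu t le [b [lob S C]]; exists b; split=> //; exact: leq_trans lob.
Qed.

(** Sources are at least [lo] and targets are larger still, so the positions below [lo] are
    frozen. *)
Lemma bead_chain_beads lo mu t : bead_chain lo mu t -> forall x, x < lo ->
  (x \in beads (last mu t)) = (x \in beads mu).
Proof.
elim: t lo mu => //= nu t IH lo mu [b [lob S C]] x xlo.
rewrite (IH _ _ C); last by lia.
have [_ _ ->] := bead_step_beads S.
have -> : x != b by lia.
have -> : (x == b + r) = false by lia.
by rewrite andbT orbF.
Qed.

(** The first source is vacated at once and never refilled, since all later moves take place above
    it. *)
Lemma bead_chain_src lo mu nu t : bead_chain lo mu (nu :: t) ->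
  exists b, [/\ lo <= b, bead_step b mu nu, bead_chain b.+1 nu t,
                b \in beads mu & b \notin beads (last nu t)].
Proof.
move=> [b [lob S C]]; exists b; have [bm brm H] := bead_step_beads S; split=> //.
rewrite (bead_chain_beads C) // H eqxx andbF /=; lia.
Qed.

(* The first source of a chain is the least bead that the chain moves. *)
Lemma bead_chain_uniq lo mu t t' : bead_chain lo mu t -> bead_chain lo mu t' ->
  last mu t = last mu t' -> t = t'.
Proof.
elim: t lo mu t' => [|nu t IH] lo mu [|nu' t'] //.
- by move=> _ /bead_chain_src[b [_ _ _ bm bl]] /= E; move: bl; rewrite -E bm.
- by move=> /bead_chain_src[b [_ _ _ bm bl]] _ /= E; move: bl; rewrite E bm.
move=> /bead_chain_src[b [lob S C bm bl]] /bead_chain_src[b' [lob' S' C' bm' bl']] /= E.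
have Bt : bead_chain b mu (nu :: t) by exists b.
have Bt' : bead_chain b' mu (nu' :: t') by exists b'.
case: (ltngtP b b') => [lt|lt|eb].
- by move: bl; rewrite E (bead_chain_beads Bt' lt) bm.
- by move: bl'; rewrite -E (bead_chain_beads Bt lt) bm'.
move: S' C'; rewrite -eb => S' C'; have en := bead_step_uniq S S'.
by move: C' E; rewrite -en => C' E; rewrite (IH _ _ _ C C' E).
Qed.

Lemma bead_chain_ge lo mu t : bead_chain lo mu t -> forall i, nth 0 mu i <= nth 0 (last mu t) i.
Proof.
elim: t lo mu => //= nu t IH lo mu [b [lob [sn [i0 [i1 [R _ _]]]] C]] i.
exact: leq_trans (ribbon_rows_ge r0 R i) (IH _ _ C i).
Qed.

Definition move_bead b mu : intpart := xget mu [set nu | bead_step b mu nu].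

Lemma move_beadP b mu : size mu <= N -> b \in beads mu -> b + r \notin beads mu ->
  bead_step b mu (move_bead b mu).
Proof. by move=> sm bm br; have [nu S] := bead_step_ex sm bm br; exact: (xgetPex mu (ex_intro _ nu S)). Qed.

(** The [L] positions from [b] on are scanned; a bead found there is left in place or, if its target
    is free, moved, in parallel with the splitting of [movable_alternant]. *)
Fixpoint chains L b mu : seq (seq intpart) :=
  if L is L'.+1 then chains L' b.+1 mu ++
    (if (b \in beads mu) && (b + r \notin beads mu)
     then [seq mu :: g | g <- chains L' b.+1 (move_bead b mu)] else [::])
  else [:: [:: mu]].

Lemma mem_chains L b mu g : size mu <= N -> g \in chains L b mu ->
  exists2 t, g = mu :: t & bead_chain b mu t.
Proof.
elim: L b mu g => [|L IH] b mu g sm /=; first by rewrite inE => /eqP->; exists [::].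
rewrite mem_cat => /orP[/IH[]// t -> C|].
  by exists t => //; apply: bead_chain_weak C.
case: ifP => // /andP[bm br] /mapP[g' g'in ->].
have S := move_beadP sm bm br.
have [|t -> C] := IH _ _ _ _ g'in; first by case: S.
by exists (move_bead b mu :: t) => //; exists b.
Qed.

Lemma chains_complete L b mu t : size mu <= N -> bead_chain b mu t ->
  (forall x, x \in beads (last mu t) -> x < b + L) -> mu :: t \in chains L b mu.
Proof.
elim: L b mu t => [|L IH] b mu t sm C bd /=.
  (* With no position left to scan, a move from [b' >= b] would leave row [i0] of the final shape
     with a bead at [b' + r] or higher, against the bound. *)
  case: t C bd => [|nu t /= [b' [bb' S C]] bd]; first by rewrite inE.
  case: S => sn [i0 [i1 [R i1N e]]]; have [top _ _] := ribbon_rows_bead R i1N.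
  have := bd (bead (last nu t) i0); have := bead_chain_ge C i0; move: top.
  have i01 : i0 <= i1 by case: R.
  have -> : bead (last nu t) i0 \in beads (last nu t) by apply/beadsP; exists i0 => //; lia.
  by rewrite /bead => ? ? /(_ isT); move: e; rewrite /bead; lia.
rewrite mem_cat; case: t C bd => [|nu t] C bd.
  by rewrite IH // => x /bd; rewrite addnS.
have [b' [lob S C' bm bl]] := bead_chain_src C.
move: lob; rewrite leq_eqVlt => /orP[/eqP eb|lt]; last first.
  by rewrite IH //; [exists b'|move=> x /bd; rewrite addnS].
move: S C' bm; rewrite -eb => S C' bm; have [_ br _] := bead_step_beads S.
rewrite bm br /= -(bead_step_uniq S (move_beadP sm bm br)).
rewrite map_f ?orbT //; apply: IH => // [|x /bd]; last by rewrite addnS.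
by case: S.
Qed.

Lemma uniq_chains L b mu : size mu <= N -> uniq (chains L b mu).
Proof.
elim: L b mu => [|L IH] b mu sm //=; rewrite cat_uniq IH //=.
case: ifP => //= /andP[bm br]; have S := move_beadP sm bm br.
have sn : size (move_bead b mu) <= N by case: S.
rewrite map_inj_uniq ?IH //; last by move=> g h [].
(* A chain from the second branch begins with source [b], one from the first can only begin with a
   source above [b], and [bead_step_src] recovers the source from the two shapes. *)
rewrite andbT; apply/hasPn => _ /mapP[g /mem_chains -/(_ sn)[t -> C] ->].
apply/negP => /mem_chains -/(_ sm)[t' [<-]] /= [b' [lt S' _]].
by have := bead_step_src S S'; lia.
Qed.

End Beads.

(** * Polyribbon chains as bead chains *)

Definition chain_sgn (g : seq intpart) : rat :=
  (\prod_(i < (size g).-1) sgn_ribbon (nth empty_part g i.+1) (nth empty_part g i))%R.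

Lemma chain_sgn1 mu : chain_sgn [:: mu] = 1%R.
Proof. by rewrite /chain_sgn big_ord0. Qed.

Lemma chain_sgn_cons mu nu t :
  chain_sgn [:: mu, nu & t] = (sgn_ribbon nu mu * chain_sgn (nu :: t))%R.
Proof. by rewrite /chain_sgn /= big_ord_recl. Qed.

Section Polyribbons.
Variables (r : nat) (r0 : 0 < r).
Implicit Types (la mu nu ka : intpart).

Lemma polyribbon_chain_cons n la mu nu t :
  polyribbon_chain r n.+1 la mu [:: mu, nu & t] <->
  [/\ is_ribbon r nu mu, polyribbon_chain r n la nu (nu :: t)
     & if t is ka :: _ then 0 < n -> top_row ka nu <= top_row nu mu else True].
Proof.
split=> [[/= [s] _ e R T]|[R [/= [s] _ e Rs T] top]].
  split; first exact: (R 0).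
    by split=> //= [|i ?|i ?]; [rewrite s|exact: (R i.+1)|exact: (T i.+1)].
  by case: t s e R T => // ka t s e R T n0; exact: (T 0).
split=> //=; first by rewrite s.
  by case=> [|i] ?; [|exact: Rs].
case=> [|i] ?; last exact: T.
clear r0; by case: t s top {e Rs T} => [|ka t] /= [s] top; [move: s; lia|apply: top].
Qed.

Lemma polyribbon_chain0 la mu g : polyribbon_chain r 0 la mu g <-> la = mu /\ g = [:: mu].
Proof.
split=> [[s g0 gn _ _]|[-> ->]]; last by split.
by case: g s g0 gn => [|x [|]] //= _ -> ->.
Qed.

Lemma polyribbon_chain_head n la mu g : polyribbon_chain r n la mu g ->
  exists2 t, g = mu :: t & size t = n /\ last mu t = la.
Proof.
case: g => [|x t]; case=> //= [[s] -> e _ _]; exists t => //; split=> //.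
by rewrite -e -s; case: t {s e} => //= y t; rewrite (last_nth empty_part).
Qed.

Variable N : nat.

(** The top row of a ribbon is the index of the bead at its target: [b + r] in row [i0] of [nu],
    [b' + r] in row [j0] of [ka]. Beads decrease with the index, so [j0 < i0] gives [b < b'] and
    [i0 < j0] gives [b' < b]; if the tops agree, the second ribbon raises the bead of that row, so
    again [b < b']. *)
Lemma top_row_sources b b' mu nu ka :
  bead_step N r b mu nu -> bead_step N r b' nu ka ->
  (top_row ka nu <= top_row nu mu) = (b < b').
Proof.
move=> [sn [i0 [i1 [R i1N <-]]]] [sk [j0 [j1 [R' j1N <-]]]].
rewrite (ribbon_rows_top r0 R) (ribbon_rows_top r0 R') ltnS.
have [top out inn] := ribbon_rows_bead R i1N.
have [top' out' inn'] := ribbon_rows_bead R' j1N.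
have i01 : i0 <= i1 by case: R.
have j01 : j0 <= j1 by case: R'.
have lt' := @ribbon_rows_lt _ _ _ _ _ j0 r0 R'.
case: (ltngtP j0 i0) => [lt|lt|e].
- have := @bead_lt N nu j0 i0; move: top top'; rewrite /bead; lia.
- have := @bead_lt N ka i0 j0; have := out' i0; move: top top'; rewrite /bead; lia.
by move: top top' lt'; rewrite e /bead; lia.
Qed.

Lemma polyribbon_bead_chain n la mu g : size la <= N -> polyribbon_chain r n la mu g ->
  bead_chain N r 0 mu (behead g) /\ size mu <= N.
Proof.
move=> sl; elim: n mu g => [|n IH] mu g.
  by move=> /polyribbon_chain0[e ->] /=; rewrite -e.
move=> P; have [[|nu t] eg [st el]] := polyribbon_chain_head P; first by [].
move: P; rewrite eg => /polyribbon_chain_cons[R P top].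
have [C sn] := IH _ _ P; rewrite [behead _]/= in C *.
have [i0 [i1 R']] := is_ribbon_rows r0 R.
have i1N : i1 < N.
  apply: leq_trans sn; rewrite ltn_size_part.
  by have := @ribbon_rows_lt _ _ _ _ _ i1 r0 R'; case: R'; lia.
have S : bead_step N r (bead N mu i1) mu nu by split=> //; exists i0, i1.
split; last first.
  rewrite leqNgt ltn_size_part -leqNgt; apply: leq_trans (ribbon_rows_ge r0 R' N) _.
  by rewrite leqNgt -ltn_size_part -leqNgt.
exists (bead N mu i1); split=> //.
case: t st top {el P eg} C => [|ka t] //= st top [b [_ S' C]].
exists b; split=> //; rewrite -(top_row_sources S S'); apply: top; lia.
Qed.

Lemma bead_chain_polyribbon lo mu t : bead_chain N r lo mu t ->
  polyribbon_chain r (size t) (last mu t) mu (mu :: t).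
Proof.
elim: t lo mu => [|nu t IH] lo mu; first by move=> _; apply/polyribbon_chain0.
move=> [b [lob S C]]; apply/polyribbon_chain_cons; split.
- by case: S => _ [i0 [i1 [R _ _]]]; exact: ribbon_rows_is_ribbon R.
- exact: IH C.
case: t C {IH} => //= ka t [b' [bb' S' _]] _.
by rewrite (top_row_sources S S').
Qed.

End Polyribbons.

(** * Semistandard tableaux *)

(** [T] is meant to have [N] rows; the new row [N] then starts from the default [[::]] and holds
    only the letter [N.+1]. *)
Definition add_letter N (l : nat -> nat) (T : seq (seq nat)) : seq (seq nat) :=
  mkseq (fun i => nth [::] T i ++ nseq (l i - size (nth [::] T i)) N.+1) N.+1.

Definition drop_letter N (T : seq (seq nat)) : seq (seq nat) :=
  mkseq (fun i => [seq a <- nth [::] T i | a <= N]) N.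

(* Tableaux are padded with empty rows to have exactly N rows. *)
Fixpoint tableaux N (l : nat -> nat) : seq (seq (seq nat)) :=
  if N is N'.+1 then
    [seq add_letter N' l T | f <- enum (@interlaced N' l), T <- tableaux N' (fun_of_ffun f)]
  else [:: [::]].

(** The same [N] bounds rows and letters: strict columns force the entries of row [i] to exceed [i],
    so letters up to [N] allow at most [N] non-empty rows. *)
Definition bounded_ssyt N (l : nat -> nat) T :=
  is_ssyt (mkseq l N) T /\ all (all (leq^~ N)) T.

Lemma size_nth_shape (T : seq (seq nat)) i : size (nth [::] T i) = nth 0 (shape T) i.
Proof.
case: (ltnP i (size T)) => h; first by rewrite (nth_map [::]).
by rewrite !nth_default // size_map.
Qed.

Lemma all_nth_nil (p : pred nat) (T : seq (seq nat)) i : all (all p) T -> all p (nth [::] T i).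
Proof.
move=> H; case: (ltnP i (size T)) => h; last by rewrite nth_default.
by move/allP: H; apply; exact: mem_nth.
Qed.

Lemma sorted_nth_nil (T : seq (seq nat)) i : all (sorted leq) T -> sorted leq (nth [::] T i).
Proof.
move=> H; case: (ltnP i (size T)) => h; last by rewrite nth_default.
by move/allP: H; apply; exact: mem_nth.
Qed.

Lemma ssyt_entry_gt lam T i j : (forall i, nth 0 lam i.+1 <= nth 0 lam i) ->
  is_ssyt lam T -> j < size (nth [::] T i) -> i < nth 0 (nth [::] T i) j.
Proof.
move=> anti [sh pos srt col]; elim: i => [|i IH] jT.
  by have /allP := all_nth_nil 0 pos; apply; exact: mem_nth.
have iT : i.+1 < size T.
  by rewrite ltnNge; apply/negP => h; rewrite nth_default in jT.
apply: leq_ltn_trans (IH _) (col _ _ iT jT).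
by move: jT; rewrite !size_nth_shape sh => /leq_trans; apply.
Qed.

Lemma sorted_split N s : sorted leq s -> all (leq^~ N.+1) s ->
  s = [seq a <- s | a <= N] ++ nseq (size s - size [seq a <- s | a <= N]) N.+1.
Proof.
elim: s => //= a s IH srt /andP[aN sN]; have srts := path_sorted srt.
case: (leqP a N) => h /=; first by rewrite subSS -IH.
have ea : a = N.+1 by apply/eqP; rewrite eqn_leq aN.
have es : s = nseq (size s) N.+1.
  apply/all_pred1P/allP => b bs /=; rewrite eqn_leq (allP sN) //=.
  by move: srt; rewrite (path_sortedE leq_trans) ea => /andP[/allP/(_ b bs)].
have -> : [seq a0 <- s | a0 <= N] = [::].
  by rewrite es; elim: (size s) => //= n ->; rewrite ltnn.
by rewrite /= ?subn0 ea /= -es.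
Qed.

Lemma nth_add_letter N l T i : i <= N ->
  nth [::] (add_letter N l T) i = nth [::] T i ++ nseq (l i - size (nth [::] T i)) N.+1.
Proof. by move=> iN; rewrite nth_mkseq // ltnS. Qed.

Lemma nth_drop_letter N T i : i < N ->
  nth [::] (drop_letter N T) i = [seq a <- nth [::] T i | a <= N].
Proof. by move=> iN; rewrite nth_mkseq. Qed.

Lemma add_letterK N l T : size T = N -> all (all (leq^~ N)) T ->
  drop_letter N (add_letter N l T) = T.
Proof.
move=> sT bT; apply: (@eq_from_nth _ [::]) => [|i]; rewrite size_mkseq // => iN.
rewrite nth_drop_letter // nth_add_letter ?(ltnW iN) // filter_cat.
rewrite (all_filterP (all_nth_nil i bT)) [X in _ ++ X](_ : _ = [::]) ?cats0 //.
by elim: (_ - _) => //= n ->; rewrite ltnn.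
Qed.

Definition antitone N (l : nat -> nat) := forall i, i.+1 < N -> l i.+1 <= l i.

Lemma interlaced_antitone N (l : nat -> nat) (f : {ffun 'I_N -> 'I_(l 0).+1}) :
  interlaced f -> antitone N (fun_of_ffun f).
Proof.
move=> /forallP fint i iN; have i0N := ltnW iN.
have := fint (Ordinal iN); have := fint (Ordinal i0N).
rewrite -(fun_of_ffunE f (Ordinal iN)) -(fun_of_ffunE f (Ordinal i0N)) /=; lia.
Qed.

Lemma interlacedP N (l : nat -> nat) (f : {ffun 'I_N -> 'I_(l 0).+1}) i :
  interlaced f -> i < N -> l i.+1 <= fun_of_ffun f i <= l i.
Proof.
by move=> /forallP fint iN; have := fint (Ordinal iN); rewrite -(fun_of_ffunE f (Ordinal iN)).
Qed.

Lemma bounded_ssyt_size N l T i : bounded_ssyt N l T ->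
  size (nth [::] T i) = if i < N then l i else 0.
Proof.
case=> [[sh _ _ _] _]; rewrite size_nth_shape sh; case: ltnP => iN; first by rewrite nth_mkseq.
by rewrite nth_default // size_mkseq.
Qed.

Lemma bounded_ssyt_height N l T : bounded_ssyt N l T -> size T = N.
Proof. by case=> [[/(congr1 size)]]; rewrite size_map size_mkseq. Qed.

Lemma bounded_ssyt_add N (l : nat -> nat) (f : nat -> nat) T :
  (forall i, i < N -> l i.+1 <= f i <= l i) -> bounded_ssyt N f T ->
  bounded_ssyt N.+1 l (add_letter N l T).
Proof.
move=> fl bT; have szT := fun i => bounded_ssyt_size i bT; have hT := bounded_ssyt_height bT.
case: bT => [[sh pos srt col] le].
have sz i : i <= N -> size (nth [::] (add_letter N l T) i) = l i.
  move=> iN; rewrite nth_add_letter // size_cat size_nseq szT.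
  by case: ltnP => h; [have := fl _ h; lia|lia].
split; [split|].
- apply: (@eq_from_nth _ 0) => [|i]; rewrite size_map !size_mkseq // => iN.
  by rewrite (nth_map [::]) ?size_mkseq // nth_mkseq // sz.
- apply/(all_nthP [::]) => i; rewrite size_mkseq => iN.
  by rewrite nth_add_letter // all_cat (all_nth_nil i pos) all_nseq orbT.
- apply/(all_nthP [::]) => i; rewrite size_mkseq => iN; rewrite nth_add_letter //.
  have := sorted_nth_nil i srt; rewrite !(sorted_pairwise leq_trans) pairwise_cat => ->.
  rewrite /= -(sorted_pairwise leq_trans); apply/andP; split.
    apply/allrelP => a b aT; rewrite mem_nseq => /andP[_ /eqP->].
    by rewrite ltnW // ltnS (allP (all_nth_nil i le)).
  by elim: (_ - _) => // -[//|n] IH /=; rewrite leqnn.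
- move=> i j; rewrite size_mkseq ltnS => iN; rewrite sz // => jl.
  (* Since [l i.+1 <= f i], the box above a box of row [i.+1] belongs to the old [T], so its entry
     is at most [N]. *)
  have fi := fl i iN; rewrite !nth_add_letter ?(ltnW iN) // !nth_cat.
  have hi : j < size (nth [::] T i) by rewrite szT iN; lia.
  rewrite hi; case: ifP => h.
    by apply: col => //; rewrite hT; move: h; rewrite szT; case: (ltnP i.+1 N).
  rewrite nth_nseq ifT; last by move: h; rewrite szT; lia.
  by rewrite ltnS (allP (all_nth_nil i le)) // mem_nth.
apply/(all_nthP [::]) => i; rewrite size_mkseq => iN; rewrite nth_add_letter // all_cat.
rewrite all_nseq leqnn orbT andbT; apply: sub_all (all_nth_nil i le) => a /= h; exact: leqW.
Qed.

Lemma bounded_ssyt_drop N (l : nat -> nat) T : antitone N.+1 l -> bounded_ssyt N.+1 l T ->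
  let f i := size (nth [::] (drop_letter N T) i) in
  [/\ forall i, i < N -> l i.+1 <= f i <= l i, bounded_ssyt N f (drop_letter N T)
    & add_letter N l (drop_letter N T) = T].
Proof.
move=> anti bT f; have szT := fun i => bounded_ssyt_size i bT; have hT := bounded_ssyt_height bT.
case: bT => [ssT le]; have [sh pos srt col] := ssT.
have nthl i : nth 0 (mkseq l N.+1) i = if i <= N then l i else 0.
  by case: leqP => h; [rewrite nth_mkseq|rewrite nth_default // size_mkseq].
have split i := sorted_split (sorted_nth_nil i srt) (all_nth_nil i le).
have szf i : i < N -> size [seq a <- nth [::] T i | a <= N] = f i.
  by move=> iN; rewrite /f nth_drop_letter.
have prefix i j : i < N -> j < f i -> nth 0 (nth [::] (drop_letter N T) i) j = nth 0 (nth [::] T i) j.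
  by move=> iN jf; rewrite nth_drop_letter // [in RHS]split nth_cat szf // jf.
have fl i : i < N -> l i.+1 <= f i <= l i.
  move=> iN; apply/andP; split; last first.
    by rewrite -szf // (leq_trans (size_subseq (filter_subseq _ _))) // szT ltnS (ltnW iN).
  (* Otherwise column [f i] of row [i] holds [N.+1], and the entry below it would have to be larger
     still. *)
  rewrite leqNgt; apply/negP => h.
  have := col i (f i); rewrite hT ltnS iN szT ltnS iN => /(_ isT h).
  have := allP (all_nth_nil i.+1 le) (nth 0 (nth [::] T i.+1) (f i)).
  rewrite mem_nth ?szT ?ltnS ?iN // => /(_ isT) h1 h2.
  have : nth 0 (nth [::] T i) (f i) = N.+1.
    rewrite split nth_cat szf // ltnn subnn nth_nseq ifT // szT ltnS (ltnW iN).
    by have := anti i iN; lia.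
  by lia.
split=> //.
- split; [split|].
  + apply: (@eq_from_nth _ 0) => [|i]; rewrite size_map !size_mkseq // => iN.
    by rewrite (nth_map [::]) ?size_mkseq // [RHS]nth_mkseq.
  + apply/(all_nthP [::]) => i; rewrite size_mkseq => iN; rewrite nth_drop_letter //.
    by apply/allP => a; rewrite mem_filter => /andP[_]; exact/allP/all_nth_nil.
  + apply/(all_nthP [::]) => i; rewrite size_mkseq => iN; rewrite nth_drop_letter //.
    exact: (sorted_filter leq_trans) (sorted_nth_nil i srt).
  + move=> i j; rewrite size_mkseq => iN jf; have i0N := ltnW iN.
    have /andP[f1 f2] := fl _ iN; have /andP[f3 f4] := fl _ i0N.
    have jf' : j < f i by exact: leq_trans jf (leq_trans f2 f3).
    rewrite (prefix i.+1) // (prefix i) //; apply: col; first by rewrite hT ltnS i0N.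
    by rewrite szT ltnS i0N; exact: leq_trans jf f2.
  + apply/(all_nthP [::]) => i; rewrite size_mkseq => iN; rewrite nth_drop_letter //.
    exact: filter_all.
apply: (@eq_from_nth _ [::]) => [|i]; rewrite size_mkseq ?hT // => iN.
rewrite nth_add_letter //.
case: (ltnP i N) => h; first by rewrite -/(f i) nth_drop_letter // [RHS]split szf // szT iN.
(* Entries of row [N] exceed [N], so [drop_letter] may omit that row. *)
have ei : i = N by apply/eqP; rewrite eqn_leq h andbT.
rewrite [nth _ (drop_letter _ _) _]nth_default ?size_mkseq // subn0 [RHS]split ei.
suff -> : [seq a <- nth [::] T N | a <= N] = [::] by rewrite szT ltnS leqnn subn0.
apply/eqP; rewrite -size_eq0 size_filter -leqn0 leqNgt -has_count.
apply/hasPn => a /(nthP 0)[j jN <-]; rewrite -ltnNge.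
apply: (ssyt_entry_gt _ ssT) => // k; rewrite !nthl; case: (ltnP k N) => // kN.
by rewrite (ltnW kN); exact: anti.
Qed.

Lemma mem_tableaux N l T : antitone N l -> T \in tableaux N l <-> bounded_ssyt N l T.
Proof.
elim: N l T => [|N IH] l T anti /=.
  rewrite inE; split=> [/eqP->|/bounded_ssyt_height/size0nil -> //]; split; split => //.
split.
  case/allpairsPdep => f [T' [fint T'in ->]]; rewrite mem_enum in fint.
  apply: (@bounded_ssyt_add _ _ (fun_of_ffun f)) => [i|]; first exact: interlacedP.
  by apply/IH => //; exact: interlaced_antitone.
move=> bT; have [fl bT' eT] := bounded_ssyt_drop anti bT.
set f := fun i => _ in fl bT'.
have anti0 i : i <= N -> l i <= l 0.
  by elim: i => // i IHi iN; apply: leq_trans (anti _ iN) (IHi (ltnW iN)).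
pose F : {ffun 'I_N -> 'I_(l 0).+1} := [ffun i : 'I_N => inord (f i)].
have FE (i : 'I_N) : fun_of_ffun F i = f i.
  rewrite fun_of_ffunE ffunE inordK // ltnS; have /andP[_ h] := fl i (ltn_ord i).
  exact: leq_trans h (anti0 _ (ltnW (ltn_ord i))).
have Fint : interlaced F.
  by apply/forallP => i; rewrite -fun_of_ffunE FE; exact: fl.
apply/allpairsPdep; exists F, (drop_letter N T); split; rewrite ?mem_enum //.
apply/IH; first exact: interlaced_antitone.
case: bT' => ss le; split => //; move: ss; congr is_ssyt.
by apply/eq_in_map => i; rewrite mem_iota => iN; rewrite -/(f i) -(FE (Ordinal iN)).
Qed.

Lemma uniq_tableaux N l : antitone N l -> uniq (tableaux N l).
Proof.
elim: N l => //= N IH l anti; apply: allpairs_uniq_dep; first exact: enum_uniq.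
  by move=> f; rewrite mem_enum => /interlaced_antitone/IH.
move=> [f T] [f' T'] /allpairsPdep[f0 [T0 [fi T0in [-> ->]]]] /allpairsPdep[f1 [T1 [fi' T1in [-> ->]]]] /= E.
rewrite !mem_enum in fi fi'.
move/(mem_tableaux _ (interlaced_antitone fi)): T0in => b0.
move/(mem_tableaux _ (interlaced_antitone fi')): T1in => b1.
have eT : T0 = T1.
  rewrite -(@add_letterK N l T0) ?(bounded_ssyt_height b0) //; last by case: b0.
  by rewrite E add_letterK ?(bounded_ssyt_height b1) //; case: b1.
suff ef : f0 = f1 by rewrite eT ef.
apply/ffunP => i; apply: val_inj; rewrite /= -!fun_of_ffunE.
have := bounded_ssyt_size i b0; have := bounded_ssyt_size i b1.
by rewrite ltn_ord eT => -> ->.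
Qed.

Local Open Scope ring_scope.

(** Indices are shifted to start from 0: this is x_(k+1,j+1), and its positivity holds by
    computation. *)
Definition xvar (k j : nat) : var := exist _ (k.+1, j.+1) isT.

Definition alphabet (k : nat) : nat -> pseries := fun j => var_series (xvar k j).

Definition content (k : nat) (T : seq (seq nat)) : monomial :=
  \big[mmul/mone]_(a <- flatten T) ucm (xvar k a.-1).

Lemma all_flatten (A : Type) (p : pred A) (ss : seq (seq A)) : all p (flatten ss) = all (all p) ss.
Proof. by elim: ss => //= s ss IH; rewrite all_cat IH. Qed.

Lemma addn_and_if (b c : bool) n : ((b && c) + (if b then n else 0) = if b then c + n else 0)%N.
Proof. by case: b. Qed.

Lemma contentE k T v : all (all (ltn 0%N)) T ->
  content k T v = if (val v).1 == k.+1 then count_mem (val v).2 (flatten T) else 0%N.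
Proof.
rewrite /content -all_flatten; case: v => -[p q] pq /=.
elim: (flatten T) => [|a s IH]; first by rewrite big_nil cm1; case: ifP.
move=> /= /andP[a0 /IH E]; rewrite big_cons cmM E cmU -addn_and_if; congr (nat_of_bool _ + _)%N.
by rewrite -val_eqE /= xpair_eqE prednK // eq_sym.
Qed.

Lemma mono_content k T : mono (content k T) = \prod_(a <- flatten T) alphabet k a.-1.
Proof.
rewrite /content; elim: (flatten T) => [|a s IH]; first by rewrite !big_nil mono1.
by rewrite !big_cons -monoM IH.
Qed.

Lemma mdeg_content k T : mdeg (content k T) = sumn (shape T).
Proof.
rewrite -size_flatten /content; elim: (flatten T) => [|a s IH]; first by rewrite big_nil mdeg1.
by rewrite big_cons mdegM IH mdegU.
Qed.

Lemma sum_subn_le N (l f : nat -> nat) : (forall i, (i < N)%N -> (f i <= l i)%N) ->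
  (\sum_(i < N) (l i - f i) = \sum_(i < N) l i - \sum_(i < N) f i)%N.
Proof. by move=> H; rewrite sumnB // => i _; exact: H. Qed.

Lemma mono_content_add k N (l f : nat -> nat) T :
  (forall i, (i < N)%N -> (f i <= l i)%N) -> bounded_ssyt N f T ->
  mono (content k (add_letter N l T)) =
  alphabet k N ^+ (\sum_(i < N.+1) l i - \sum_(i < N) f i) * mono (content k T).
Proof.
move=> fl bT; have szT := fun i => bounded_ssyt_size i bT; have hT := bounded_ssyt_height bT.
rewrite !mono_content big_flatten /= big_map -{1}[N.+1]subn0 -/(index_iota 0 N.+1) big_mkord.
have E (i : nat) : \prod_(a <- nth [::] T i ++ nseq (l i - size (nth [::] T i)) N.+1) alphabet k a.-1 =
    (\prod_(a <- nth [::] T i) alphabet k a.-1) * alphabet k N ^+ (l i - size (nth [::] T i)).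
  by rewrite big_cat /= big_nseq -Monoid.iteropE.
rewrite (eq_bigr _ (fun (i : 'I_N.+1) _ => E i)) big_split /= mulrC; congr (_ * _).
  rewrite prodrXr; congr (_ ^+ _); rewrite !big_ord_recr /= szT ltnn subn0.
  rewrite (eq_bigr (fun i : 'I_N => l i - f i)%N); last first.
    by move=> i _; rewrite szT ltn_ord.
  rewrite sum_subn_le //; have : (\sum_(i < N) f i <= \sum_(i < N) l i)%N.
    by apply: leq_sum => i _; exact: fl.
  move: (\sum_(i < N) f i)%N (\sum_(i < N) l i)%N (l N) => a b c; lia.
rewrite big_ord_recr /= [nth _ _ N]nth_default ?hT // big_nil mulr1.
by rewrite big_flatten /= (big_nth [::]) hT big_mkord.
Qed.

Lemma schur_poly_tableaux k N l : antitone N l ->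
  schur_poly (alphabet k) N l = \sum_(T <- tableaux N l) mono (content k T).
Proof.
elim: N l => [|N IH] l anti; first by rewrite /= big_seq1 /content big_nil mono1.
rewrite [schur_poly _ _ _]/= [tableaux _ _]/= big_allpairs_dep /= big_enum /=.
apply: eq_bigr => f fint; rewrite IH; last exact: interlaced_antitone.
rewrite mulr_sumr [LHS]big_seq [RHS]big_seq; apply: eq_bigr => T.
move/(mem_tableaux _ (interlaced_antitone fint)) => bT.
have e : (\sum_(i < N) f i = \sum_(i < N) fun_of_ffun f i)%N.
  by apply: eq_bigr => i _; rewrite fun_of_ffunE.
rewrite e; symmetry; apply: mono_content_add bT.
by move=> i iN; have /andP[] := interlacedP fint iN.
Qed.

Lemma is_ssyt_pad lam T q : is_ssyt lam T -> is_ssyt (lam ++ nseq q 0%N) (T ++ nseq q [::]).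
Proof.
move=> [sh pos srt col]; split.
- by rewrite /shape map_cat -/(shape T) sh map_nseq.
- by rewrite all_cat pos all_nseq orbT.
- by rewrite all_cat srt all_nseq orbT.
move=> i j; rewrite !nth_cat; case: (ltnP i.+1 (size T)) => iT _.
  by rewrite (ltnW iT); exact: col.
by rewrite nth_nseq if_same.
Qed.

Lemma is_ssyt_unpad lam T q : is_ssyt (lam ++ nseq q 0%N) T ->
  is_ssyt lam (take (size lam) T) /\ T = take (size lam) T ++ nseq q [::].
Proof.
move=> [sh pos srt col].
have sT : size T = (size lam + q)%N by rewrite -(size_map size) -/(shape T) sh size_cat size_nseq.
have stT : size (take (size lam) T) = size lam by rewrite size_takel // sT leq_addr.
have shn : shape (take (size lam) T) = lam by rewrite /shape map_take -/(shape T) sh take_size_cat.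
have E : T = take (size lam) T ++ nseq q [::].
  rewrite -{1}(cat_take_drop (size lam) T); congr (_ ++ _).
  have : shape (drop (size lam) T) = nseq q 0%N.
    by rewrite /shape map_drop -/(shape T) sh drop_size_cat.
  by elim: q (drop _ T) {sh sT} => [|q IH] [|x s] //= [/size0nil -> /IH ->].
split=> //; split=> //.
- by move: pos; rewrite {1}E all_cat => /andP[].
- by move: srt; rewrite {1}E all_cat => /andP[].
move=> i j iT; have iT' : (i.+1 < size T)%N by rewrite sT (leq_trans iT) // stT leq_addr.
rewrite !nth_take ?(leq_trans iT) ?stT //; first exact: col.
by rewrite (leq_trans (ltnW iT)) // stT.
Qed.

Lemma mkseq_nth_pad (la : seq nat) N : (size la <= N)%N ->
  mkseq (nth 0%N la) N = la ++ nseq (N - size la) 0%N.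
Proof.
move=> sl; apply: (@eq_from_nth _ 0%N) => [|i]; rewrite size_mkseq ?size_cat ?size_nseq ?subnKC //.
move=> iN; rewrite nth_mkseq // nth_cat nth_nseq; case: ltnP => h; rewrite ?if_same //.
by rewrite nth_default.
Qed.

Lemma schur_supp (la : seq nat) k m (H : is_part la) : schur (IntPart H) k m != 0 ->
  exists2 T, is_ssyt la T & has_content k T m.
Proof.
case: (pselect (exists2 T, is_ssyt la T & has_content k T m)) => // N /eqP[].
by rewrite /schur fsbig1 // => T [ss c]; case: N; exists T.
Qed.

Lemma has_contentE k T m : all (all (ltn 0%N)) T -> has_content k.+1 T m <-> m = content k T.
Proof.
move=> pos; split=> [H|-> v]; last by rewrite contentE.
by apply/eqP/cmP => v; rewrite contentE //; exact: H.
Qed.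

Lemma homog_schur (la : intpart) k : homog (sumn la) (schur la k.+1).
Proof.
case: la => la P m /schur_supp[T [sh pos _ _] /(has_contentE _ _ pos) ->].
by rewrite mdeg_content sh.
Qed.

Definition letter_class (v : var) : nat := (val v).1.-1.

Lemma supp_in_schur (la : intpart) k : supp_in letter_class k (schur la k.+1).
Proof.
case: la => la P m /schur_supp[T _ c] v; rewrite c /letter_class.
by case: (eqVneq (val v).1 k.+1) => [->|].
Qed.

Definition in_alphabet k N (m : monomial) :=
  forall v : var, m v != 0%N -> (val v).1 = k.+1 /\ ((val v).2 <= N)%N.

(** A tableau of content [m] uses only letters occurring in [m], all at most [N]. Padding with empty
    rows to exactly [N] rows matches these tableaux with the listed ones of content [m]. *)
Lemma schur_coef k N (la : intpart) m : (size la <= N)%N -> in_alphabet k N m ->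
  schur la k.+1 m = schur_poly (alphabet k) N (nth 0%N la) m.
Proof.
move=> sl mN; have anti : antitone N (nth 0%N la) by move=> i _; exact: nth_part_anti.
rewrite schur_poly_tableaux // pseries_sum.
rewrite (eq_bigr (fun T => if m == content k T then 1 else 0)); last first.
  by move=> T _; rewrite /mono; case: eqP.
rewrite -big_mkcond -big_filter /=.
have pad := mkseq_nth_pad sl.
have padK T : T \in tableaux N (nth 0%N la) -> is_ssyt la (take (size la) T) /\
    T = take (size la) T ++ nseq (N - size la) [::].
  by move=> /(mem_tableaux _ anti)[]; rewrite pad => /is_ssyt_unpad.
have contK (T : seq (seq nat)) q : content k (T ++ nseq q [::]) = content k T.
  rewrite /content flatten_cat (_ : flatten (nseq q [::]) = [::]) ?cats0 //.
  by elim: q.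
have inj : {in [seq T <- tableaux N (nth 0%N la) | m == content k T] &, injective (take (size la))}.
  move=> T T'; rewrite !mem_filter => /andP[_ /padK[_ eT]] /andP[_ /padK[_ eT']] e.
  by rewrite eT eT' e.
rewrite /schur (@fsbigE _ _ _ _ _ [seq take (size la) T | T <- tableaux N (nth 0%N la) & m == content k T]).
- rewrite big_map big_seq_cond [RHS]big_seq; apply: eq_bigl => T; rewrite andb_idr //.
  rewrite mem_filter => /andP[/eqP -> Tin]; have [ss eT] := padK _ Tin.
  apply: mem_set; split=> //; apply/has_contentE; first by case: ss.
  by rewrite {1}eT contK.
- by rewrite map_inj_in_uniq // filter_uniq // uniq_tableaux.
- move=> _ /= /mapP[T + ->]; rewrite mem_filter => /andP[/eqP -> Tin]; have [ss eT] := padK _ Tin.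
  split=> //; apply/has_contentE; first by case: ss.
  by rewrite {1}eT contK.
move=> T [ss c] /negP[]; have [sh pos _ _] := ss.
have sT : size T = size la by rewrite -sh size_map.
apply/mapP; exists (T ++ nseq (N - size la) [::]); last by rewrite take_size_cat.
rewrite mem_filter contK; apply/andP; split; first exact/eqP/has_contentE.
apply/(mem_tableaux _ anti); split; first by rewrite pad; exact: is_ssyt_pad.
rewrite all_cat all_nseq orbT andbT -all_flatten; apply/allP => a aT.
have a0 : (0 < a)%N by move: pos; rewrite -all_flatten => /allP; apply.
have := c (xvar k a.-1); rewrite /= eqxx prednK // => e.
have /mN[_] : m (xvar k a.-1) != 0%N by rewrite e -lt0n -has_count has_pred1.
by rewrite /= prednK.
Qed.

(** * The Murnaghan-Nakayama rule for all r-th powers *)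

Lemma finite_bounded_seqs (A : choiceType) (r : seq A) n :
  finite_set [set s : seq A | (size s <= n)%N /\ {subset s <= r}].
Proof.
apply: (@sub_finite_set _ _ ((fun s : n.-bseq (seq_sub r) => [seq val x | x <- s]) @` setT)); last first.
  exact/finite_image/finite_finset.
move=> s [sn sr]; have sz : (size (pmap insub s : seq (seq_sub r)) <= n)%N.
  by rewrite (leq_trans _ sn) // size_pmap_sub count_size.
exists (Bseq sz) => //=; rewrite -[RHS]map_id; elim: s sr {sn sz} => //= a s IH sr.
rewrite insubT /=; first by apply: sr; rewrite mem_head.
by move=> ar; congr cons; apply: IH => b bs; apply: sr; rewrite inE bs orbT.
Qed.

Lemma finite_parts D : finite_set [set la : intpart | sumn la = D].
Proof.
have H := finite_bounded_seqs (iota 0 D.+1) D.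
apply: sub_finite_set (finite_preimage (f := parts) _ H) => [la laD|]; last first.
  by move=> x y _ _; exact: val_inj.
rewrite /mkset in laD; have /andP[_ pos] := partsP la; split.
  by rewrite -laD; elim: (parts la) pos => //= a s IH /andP[a0 /IH]; lia.
move=> a al; rewrite mem_iota ltnS -laD.
elim: (parts la) al => //= b s IH; rewrite inE => /orP[/eqP->|/IH]; lia.
Qed.

Definition partitions D : seq intpart := fset_set [set la : intpart | sumn la = D].

Lemma mem_partitions D la : (la \in partitions D) = (sumn la == D).
Proof.
rewrite in_fset_set; last exact: finite_parts.
by apply/idP/eqP => [/set_mem|e] //; exact: mem_set.
Qed.

Lemma uniq_partitions D : uniq (partitions D).
Proof. exact: fset_uniq. Qed.

Lemma size_part_le (la : intpart) : (size la <= sumn la)%N.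
Proof.
have /andP[_] := partsP la; elim: (parts la) => //= a s IH /andP[a0 /IH]; lia.
Qed.

Lemma nth_part_le (la : seq nat) i : (nth 0%N la i <= sumn la)%N.
Proof.
elim: la i => [|a s IH] [|i] //=; rewrite ?leq_addr //.
by rewrite (leq_trans (IH i)) // leq_addl.
Qed.

(** A scalar viewed as a series, so that scalar multiples are products in the ring. *)
Definition const_series (c : rat) : pseries := fun m => c * (m == mone)%:R.

Lemma const_seriesM c f m : (const_series c * f) m = c * f m.
Proof.
rewrite pseries_mulE (@series_mul_single _ _ _ mone m) ?mul1m // /const_series ?eqxx ?mulr1 // => a b ab ne.
case: eqP => [e|]; last by rewrite mulr0 mul0r.
by case: ne; rewrite e; move: ab; rewrite e mul1m => ->.
Qed.

Lemma sign_seriesM n (f : pseries) m : ((-1) ^+ n * f) m = (-1) ^+ n * f m.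
Proof. by rewrite -signr_odd -[in RHS]signr_odd; case: odd; rewrite ?expr0 ?expr1 ?mul1r // !mulN1r. Qed.

Lemma xvar_eq (v : var) k j : (val v).1 = k.+1 -> (val v).2.-1 = j -> v = xvar k j.
Proof.
move=> e1 e2; apply: val_inj; have := valP v; move: e1 e2; rewrite /=.
by case: (val v) => p [|q] /= -> <- // /andP[].
Qed.

Definition var_powers r k j : pseries := fun m =>
  (`[< forall v : var, m v != 0%N -> v = xvar k j /\ (r %| m v)%N >])%:R.

(** For [r > 0], the sum over all n of the complete symmetric functions h_n in the [r]-th powers of
    x_(k+1,1), x_(k+1,2), ...; in [N] variables it is the product of the geometric series
    [var_powers]. *)
Definition powers r k : pseries := fun m =>
  (`[< forall v : var, m v != 0%N -> (val v).1 = k.+1 /\ (r %| m v)%N >])%:R.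

Lemma var_powersE r k j : (0 < r)%N ->
  var_powers r k j = 1 + alphabet k j ^+ r * var_powers r k j.
Proof.
move=> r0; apply/funext => m; rewrite pseriesD pseries1 var_seriesX.
set x := xvar k j; set xr : monomial := expcmn (ucm x) r.
have xrE v : xr v = (r * (x == v))%N by rewrite expcmnE cmU.
case: (pselect (exists b, mmul xr b = m)) => [[b <-]|N].
  rewrite mono_coefM; have -> : (mmul xr b == mone) = false.
    apply/eqP => /(congr1 (fun m => cmonom_val m x)); rewrite cmM cm1 xrE eqxx muln1.
    by move/eqP; rewrite addn_eq0 => /andP[/eqP e]; rewrite e in r0.
  rewrite add0r /var_powers; congr (nat_of_bool _)%:R; apply/asboolP/asboolP => H v.
    move=> bv; have : mmul xr b v != 0%N by rewrite cmM addn_eq0 (negPf bv) andbF.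
    by move=> /H[-> ]; rewrite cmM xrE eqxx muln1 dvdn_addr.
  rewrite cmM xrE; case: (eqVneq x v) => [<- _|xv].
    split=> //; rewrite muln1 dvdn_addr //; case: (eqVneq (b x) 0%N) => [->//|/H[]//].
  by rewrite muln0 add0n => /H[e]; rewrite e eqxx in xv.
rewrite mono_coef0; last by move=> b e; case: N; exists b.
rewrite addr0 /var_powers; congr (nat_of_bool _)%:R; apply/asboolP/eqP => [H|->]; last first.
  by move=> v; rewrite cm1.
apply/eqP/cmP => v; rewrite cm1; apply/eqP; apply: contraT => mv; have [ev dv] := H v mv.
case: N; exists (divcm m xr : monomial).
apply/eqP/cmP => w; rewrite cmM divcmE xrE; case: (eqVneq x w) => [<-|_].
  by rewrite muln1 subnKC // /x -ev; apply: dvdn_leq => //; rewrite lt0n.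
by rewrite muln0 add0n subn0.
Qed.

Lemma prod_bool n (b : 'I_n -> bool) : \prod_(i < n) (b i)%:R = ([forall i, b i])%:R :> rat.
Proof.
case: (boolP [forall i, b i]) => [/forallP H|/forallPn[i bi]].
  by rewrite big1 // => i _; rewrite H.
by rewrite (bigD1 i) //= (negPf bi) mul0r.
Qed.

Lemma prod_var_powers r k N m : in_alphabet k N m ->
  (\prod_(j < N) var_powers r k j) m = powers r k m.
Proof.
(* Each variable of the alphabet is a class of its own; variables of other alphabets get the class
   [N], outside the range of the product. *)
move=> mN; pose cl (v : var) := if (val v).1 == k.+1 then (val v).2.-1 else N.
have clE v : m v != 0%N -> (cl v < N)%N.
  move=> /mN[e le]; rewrite /cl e eqxx; case: v {e} le => -[p q] /= /andP[_ q0] le.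
  by rewrite prednK.
rewrite (@prod_classes cl N (var_powers r k)) //; last first.
  move=> j jN a; rewrite /var_powers pnatr_eq0 eqb0 negbK => /asboolP H v /H[-> _].
  by rewrite /cl /= eqxx.
rewrite /var_powers prod_bool /powers; congr (nat_of_bool _)%:R.
apply/forallP/asboolP => H v; last first.
  apply/asboolP => w; rewrite part_ofE; case: (eqVneq (cl w) (v : nat)) => // cw mw; have [_ d] := H w mw.
  split=> //; have [e _] := mN w mw; apply: xvar_eq => //.
  by move: cw; rewrite /cl e eqxx.
move=> mv; have [e _] := mN v mv; split=> //.
have /asboolP/(_ v) := H (Ordinal (clE v mv)).
by rewrite part_ofE /= eqxx => /(_ mv)[].
Qed.

(** Every term of the expansion along row [i] has degree at least [e]. This cuts off beads beyond
    the degree of the observed monomial. *)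
Lemma det_row_coef0 N (A : 'M[pseries]_N) (i : 'I_N) e (B : 'I_N -> pseries) (w : 'I_N -> var) m :
  (forall j, A i j = var_series (w j) ^+ e * B j) -> (mdeg m < e)%N -> (\det A) m = 0.
Proof.
move=> AE lt; rewrite (expand_det_row _ i) pseries_sum big1 // => j _.
rewrite AE -mulrA var_seriesX; apply: mono_coef_deg.
by rewrite mdeg_expcmn mdegU muln1.
Qed.

Lemma bead_chain_size N r lo (mu : intpart) t : (size mu <= N)%N -> bead_chain N r lo mu t ->
  (size (last mu t) <= N)%N.
Proof. by elim: t lo mu => //= nu t IH lo mu sm [b [_ [sn _] /(IH _ _ sn)]]. Qed.

Section Murnaghan.
Variables (r k N : nat).
Implicit Types (la mu : intpart).
Hypothesis r0 : (0 < r)%N.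
Let X := alphabet k.
Let g := var_powers r k.
Let E := movable_alternant X g N.
Let alt (la : intpart) := alternant X N (bead N la).

(** Induction on the number [L] of positions still to scan. Once [b] exceeds the degree of [m],
    either no bead is movable any more, or a bead at [b] or above makes the coefficient of [m]
    vanish on both sides. *)
Lemma movable_alternant_chains L b (mu : intpart) m : (size mu <= N)%N -> (mdeg m < b + L)%N ->
  E b (bead N mu) m =
  \sum_(c <- chains N r L b mu) chain_sgn c * alt (last empty_part c) m.
Proof.
have gE j : g j = 1 + X j ^+ r * g j by exact: var_powersE.
elim: L b mu => [|L IH] b mu sm mb.
  rewrite /= big_seq1 chain_sgn1 mul1r /=; rewrite addn0 in mb.
  case: (pselect (forall i, (i < N)%N -> (bead N mu i < b)%N)) => [H|/existsNP[i /not_implyP[iN /negP]]].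
    by rewrite /E movable_alternant_id.
  rewrite -leqNgt => bi; have lt := leq_trans mb bi.
  have -> : alt mu m = 0.
    apply: (@det_row_coef0 _ _ (Ordinal iN) (bead N mu i) (fun=> 1) (fun j => xvar k j)) => // j.
    by rewrite mxE mulr1.
  apply: (@det_row_coef0 _ _ (Ordinal iN) (bead N mu i)
    (fun j => if (b <= bead N mu i)%N then g j else 1) (fun j => xvar k j)) => // j.
  by rewrite mxE.
rewrite addnS -addSn in mb; rewrite [chains _ _ _ _ _]/= big_cat /= -IH //.
case: (boolP (b \in beads N mu)) => [bm|bm] /=; last first.
  rewrite big_nil addr0 /E movable_alternant_fixed // => i iN.
  by apply: contraNneq bm => e; apply/beadsP; exists i.
have [i1 i1N bE] := beadsP _ _ _ bm.
rewrite {1}/E (movable_alternant_move r0 gE i1N bE) ?pseriesD; last first.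
  move=> i iN; apply: contra => /eqP e; apply/eqP; apply: (bead_inj (la := mu) iN i1N).
  by rewrite e bE.
(* The summand in which the bead stays is the first branch of [chains]. A move onto an occupied
   position makes two rows equal; otherwise the rows are sorted into the beads of [nu]. *)
congr (_ + _); case: (boolP (b + r \in beads N mu)%N) => [brm|brm] /=.
  rewrite big_nil; have [i2 i2N bE2] := beadsP _ _ _ brm.
  have ne : i2 != i1 by apply: contraTneq r0 => e; move: bE2; rewrite e bE; lia.
  rewrite (@movable_alternant_dup _ _ _ _ _ _ i2 i1) ?pseries0 //.
  by rewrite eqxx (negPf ne).
have S := move_beadP r0 sm bm brm; set nu := move_bead N r b mu in S *.
have [sn [j0 [j1 [R j1N ej]]]] := S.
have e1 : j1 = i1 by apply: (bead_inj (la := mu) j1N i1N); rewrite ej bE.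
move: R; rewrite e1 => R; have [top out inn] := ribbon_rows_bead R i1N.
have j01 : (j0 <= i1)%N by case: R.
rewrite (@movable_alternant_cycle _ _ _ _ _ _ (bead N nu) j0 i1) ?j01 //.
- rewrite sign_seriesM -/E IH // -(ribbon_rows_sgn r0 R) big_map mulr_sumr big_seq [RHS]big_seq.
  apply: eq_bigr => c cin; have [t -> _] := mem_chains r0 sn cin.
  by rewrite chain_sgn_cons mulrA.
- by rewrite top bE eqxx.
- move=> i io; rewrite out //; case: eqP => // ei; move: io; rewrite ei; lia.
- by move=> i ii; rewrite inn //; case: eqP => // ei; move: ii; rewrite ei; lia.
Qed.

(** The guard matters: if there is no chain, [the_chain] takes its default [[::]] and
    [sgn_polyribbon] is the empty product 1. *)
Definition polyribbon_coef (la mu : intpart) : rat :=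
  if `[< exists n, is_polyribbon r n la mu >] then sgn_polyribbon r la mu else 0.

(** By uniqueness of bead chains the sum has at most one term; [L] lies above all beads of [la], so
    the scan does not miss it. *)
Lemma sum_chains L (la mu : intpart) : (size la <= N)%N -> (size mu <= N)%N ->
  (forall x, x \in beads N la -> (x < L)%N) ->
  \sum_(c <- chains N r L 0 mu | last empty_part c == la) chain_sgn c = polyribbon_coef la mu.
Proof.
move=> sl sm bl; rewrite /polyribbon_coef; case: asboolP => [[n [h0 hP]]|no]; last first.
  rewrite big_seq_cond big1 // => c /andP[/(mem_chains r0 sm)[t -> C] /eqP /= e].
  case: no; exists (size t), (mu :: t); rewrite -e; exact: (bead_chain_polyribbon r0 C).
have [n' cP] : exists n, polyribbon_chain r n la mu (the_chain r la mu).
  exact: (@xgetPex _ [::] [set g | exists n, polyribbon_chain r n la mu g] (ex_intro _ h0 (ex_intro _ n hP))).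
have [C _] := polyribbon_bead_chain r0 sl cP.
have [t et [_ el]] := polyribbon_chain_head cP; rewrite et /= in C.
have cin : the_chain r la mu \in chains N r L 0 mu.
  by rewrite et; apply: chains_complete => // x; rewrite el => /bl.
rewrite -big_filter (_ : [seq c <- _ | _] = [:: the_chain r la mu]) ?big_seq1 //.
apply: perm_small_eq => //; apply: uniq_perm => //; first exact/filter_uniq/uniq_chains.
move=> c; rewrite mem_filter inE; apply/andP/eqP => [[/eqP e /(mem_chains r0 sm)[t' ec C']]|->].
  rewrite ec et; congr cons; apply: (bead_chain_uniq r0 C' C).
  by rewrite el -e ec.
by rewrite cin et /= el.
Qed.

Let S (la : intpart) := schur_poly X N (nth 0%N la).
Let V := vandermonde X N.

Lemma vandermonde_homog n : exists e, homog e (vandermonde X n).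
Proof.
elim: n => [|n [e He]]; first by exists 0%N => m; rewrite /= pseries1 pnatr_eq0 eqb0 negbK => /eqP ->; rewrite mdeg1.
suff /(_ n)[d Hd] : forall q, exists d, homog d (\prod_(j < q) (X j - X n)).
  by exists (e + d)%N; exact: homogM.
elim=> [|q [d Hd]].
  by exists 0%N => m; rewrite big_ord0 pseries1 pnatr_eq0 eqb0 negbK => /eqP ->; rewrite mdeg1.
exists (d + 1)%N; rewrite big_ord_recr /=; apply: homogM Hd _ => m.
have H v : homog 1 (var_series v) by move=> a /homog_mono ->; rewrite mdegU.
apply: contraNeq => md.
have Hz v : var_series v m = 0 by apply/eqP; apply: contraNT md => /H ->.
apply/eqP; exact: (etrans (congr2 (fun a b => a - b) (Hz (xvar k q)) (Hz (xvar k n))) (subrr 0)).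
Qed.

Lemma vandermonde_reg n f : vandermonde X n * f = 0 -> f = 0.
Proof.
elim: n f => [|n IH] f /=; first by rewrite mul1r.
rewrite -mulrA => /IH; suff: forall q, (q <= n)%N -> (\prod_(j < q) (X j - X n)) * f = 0 -> f = 0.
  by move/(_ n (leqnn _)).
elim=> [|q IHq] qn; first by rewrite big_ord0 mul1r.
rewrite big_ord_recr /= mulrAC mulrC => /var_seriesB_reg H; apply: (IHq (ltnW qn)); apply: H.
by rewrite -val_eqE /= xpair_eqE eqxx /= eqSS ltn_eqF.
Qed.

Lemma homog_schur_poly la : (size la <= N)%N -> homog (sumn la) (S la).
Proof.
move=> sl; have anti : antitone N (nth 0%N la) by move=> i _; exact: nth_part_anti.
rewrite /S schur_poly_tableaux // big_seq; apply: homog_sum => T /(mem_tableaux _ anti)[[sh _ _ _] _].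
have <- : mdeg (content k T) = sumn la.
  by rewrite mdeg_content sh mkseq_nth_pad // sumn_cat sumn_nseq mul0n addn0.
exact: homog_mono.
Qed.

Lemma schur_poly_alt la : V * S la = alt la.
Proof. by rewrite /V /S bialternant // => i _; exact: nth_part_anti. Qed.

(** After multiplication by the Vandermonde factor both sides are expansions in alternants, and
    grouping the chains by their last shape yields the coefficients. [D <= N] lets every partition
    of [D] fit into [N] rows. *)
Lemma powers_schur_poly D (mu : intpart) : (size mu <= N)%N -> (D <= N)%N ->
  hcomp D ((\prod_(j < N) g j) * S mu) =
  \sum_(la <- partitions D) const_series (polyribbon_coef la mu) * S la.
Proof.
move=> sm DN; apply/eqP; rewrite -subr_eq0; apply/eqP; apply: (@vandermonde_reg N).
have [e Ve] := vandermonde_homog N.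
have partN la : la \in partitions D -> sumn la = D /\ (size la <= N)%N.
  by rewrite mem_partitions => /eqP e1; split=> //; rewrite (leq_trans (size_part_le la)) ?e1.
rewrite mulrBr -(hcomp_homogM D _ Ve) mulrCA schur_poly_alt -movable_alternant0 -/E.
have HS la : la \in partitions D -> homog (D + e) (alt la).
  by move=> /partN[<- sl]; rewrite -schur_poly_alt addnC; apply: homogM => //; exact: homog_schur_poly.
rewrite mulr_sumr (eq_bigr (fun la => const_series (polyribbon_coef la mu) * alt la)); last first.
  by move=> la _; rewrite mulrCA schur_poly_alt.
apply/eqP; rewrite subr_eq0; apply/eqP/funext => m; rewrite pseries_sum.
under eq_bigr => la _ do rewrite const_seriesM.
rewrite /hcomp; case: eqP => [md|/eqP md]; last first.
  rewrite big_seq big1 // => la /HS H; rewrite (_ : alt la m = 0) ?mulr0 //.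
  by apply/eqP; apply: contraNT md => /H ->.
(* [L] has to exceed the degree of [m], for the expansion, and every bead of a partition of [D],
   which is less than [D + N <= N + N], for [sum_chains]. *)
pose L := (N + N + (mdeg m).+1)%N.
have mL : (mdeg m < 0 + L)%N by rewrite /L; lia.
rewrite (movable_alternant_chains (L := L)) //.
transitivity (\sum_(c <- chains N r L 0 mu) \sum_(la <- partitions D | last empty_part c == la)
   chain_sgn c * alt la m).
  rewrite big_seq [RHS]big_seq; apply: eq_bigr => c /(mem_chains r0 sm)[t ec C].
  have [inD|ninD] := boolP (last empty_part c \in partitions D).
    rewrite -big_filter (_ : [seq la <- _ | _] = [:: last empty_part c]) ?big_seq1 //.
    apply: perm_small_eq => //; apply: uniq_perm => //; first exact/filter_uniq/uniq_partitions.
    move=> la; rewrite mem_filter inE; apply/andP/eqP => [[/eqP elv _]|->]; last by rewrite eqxx.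
    exact/esym/val_inj.
  (* A last shape of size other than [D] contributes nothing: its alternant is homogeneous of a
     degree different from that of [m]. *)
  rewrite [RHS]big_seq_cond big1 => [|la /andP[lain /eqP e1]]; last by move: ninD; rewrite e1 lain.
  have sl : (size (last empty_part c) <= N)%N by rewrite ec; exact: bead_chain_size C.
  suff -> : alt (last empty_part c) m = 0 by rewrite mulr0.
  have H : homog (e + sumn (last empty_part c)) (alt (last empty_part c)).
    by rewrite -schur_poly_alt; apply: homogM => //; exact: homog_schur_poly.
  apply/eqP; apply: contraNT ninD => /H; rewrite md mem_partitions.
  by move: (sumn _) => q; lia.
rewrite (exchange_big_dep predT) //= big_seq [RHS]big_seq; apply: eq_bigr => la lain.
have [e1 sl] := partN _ lain.
rewrite -(sum_chains (L := L)) // ?mulr_suml // => x /beadsP[i iN <-].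
by have := nth_part_le la i; rewrite e1 /bead /L; lia.
Qed.

End Murnaghan.

Theorem powers_schur r k (mu : intpart) m : (0 < r)%N ->
  series_mul (powers r k) (schur mu k.+1) m =
  \sum_(la <- partitions (mdeg m)) polyribbon_coef r la mu * schur la k.+1 m.
Proof.
move=> r0; case: (pselect (forall v : var, m v != 0%N -> (val v).1 = k.+1)) => [mk|/existsNP[v /not_implyP[mv nk]]].
  (* The three summands bound the indices of the variables in [m], the sizes of the partitions
     involved, and the length of [mu]. *)
  pose N := (\max_(v <- finsupp m) (val v).2 + mdeg m + size mu)%N.
  have mN : in_alphabet k N m.
    move=> v mv; split; first exact: mk.
    rewrite /N -addnA; apply: leq_trans (leq_addr _ _).
    by rewrite (big_fsetD1 v) ?leq_maxl //= -cmE_neq0.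
  have sm : (size mu <= N)%N by rewrite /N leq_addl.
  transitivity (hcomp (mdeg m) ((\prod_(j < N) var_powers r k j) * schur_poly (alphabet k) N (nth 0%N mu)) m).
    rewrite /hcomp eqxx; apply: eq_series_mul => a b ab.
    have aN : in_alphabet k N a.
      by move=> v av; apply: mN; rewrite -ab cmM addn_eq0 negb_and av.
    have bN : in_alphabet k N b.
      by move=> v bv; apply: mN; rewrite -ab cmM addn_eq0 negb_and bv orbT.
    by rewrite prod_var_powers // (schur_coef sm).
  have mdN : (mdeg m <= N)%N by rewrite /N -addnA addnCA leq_addr.
  rewrite powers_schur_poly // pseries_sum big_seq [RHS]big_seq; apply: eq_bigr => la.
  rewrite mem_partitions const_seriesM => /eqP e; rewrite (schur_coef (N := N)) //.
  by rewrite (leq_trans (size_part_le la)) ?e.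
(* A variable of [m] outside the alphabet makes both sides zero. *)
rewrite big1 => [|la _]; last first.
  rewrite (_ : schur la k.+1 m = 0) ?mulr0 //; apply/eqP; apply: contra_notT nk.
  move=> /supp_in_schur/(_ _ mv); rewrite /letter_class => <-.
  by have /andP[] := valP v => v0 _; rewrite prednK.
apply: series_mul_eq0 => a b ab; apply/eqP; rewrite mulf_eq0 -implyNb; apply/implyP.
rewrite pnatr_eq0 eqb0 negbK => /asboolP Ha.
apply: contra_notT nk => /supp_in_schur Hb.
have: (a v != 0%N) || (b v != 0%N) by move: mv; rewrite -ab cmM addn_eq0 negb_and.
case/orP=> [/Ha[]//|/Hb]; rewrite /letter_class => <-.
by have /andP[] := valP v => v0 _; rewrite prednK.
Qed.

Local Open Scope nat_scope.

(** * Types *)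

Lemma block_ge_trans : transitive block_ge.
Proof. by move=> [y1 y2] [x1 x2] [z1 z2]; rewrite /block_ge /=; lia. Qed.

Lemma block_ge_anti : antisymmetric block_ge.
Proof.
move=> [x1 x2] [y1 y2]; rewrite /block_ge /= => h.
have [-> ->] : x1 = y1 /\ x2 = y2 by lia.
by [].
Qed.

Lemma block_gt0 (t : ptype) b : b \in blocks t -> 0 < b.1 /\ 0 < b.2.
Proof. by have /andP[_ /allP H] := blocksP t; move/H/andP. Qed.

Lemma count_mults (t : seq block) k a : count_mem (k, a) t = count_mem a (mults t k).
Proof.
rewrite /mults count_map count_filter; apply: eq_count => -[x y] /=.
by rewrite xpair_eqE andbC.
Qed.

Lemma ptype_inj (t t' : ptype) : (forall k, restr t k = restr t' k) -> t = t'.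
Proof.
move=> H; apply: val_inj => /=.
have /andP[srt _] := blocksP t; have /andP[srt' _] := blocksP t'.
apply: (sorted_eq block_ge_trans block_ge_anti srt srt').
rewrite /perm_eq; apply/allP => -[k a] _ /=; apply/eqP.
by rewrite !count_mults (congr1 parts (H k) : mults t k = mults t' k).
Qed.

Lemma restr0 (t : ptype) k : (forall b, b \in blocks t -> b.1 != k) -> restr t k = empty_part.
Proof.
move=> H; apply: val_inj; rewrite /= /mults (_ : [seq b <- t | b.1 == k] = [::]) //.
by apply/eqP; rewrite -(negbK (_ == _)) -has_filter; apply/hasPn => b /H.
Qed.

Lemma weight_block (t : ptype) b : b \in blocks t -> b.1 * b.2 <= weight t.
Proof. by move=> bt; rewrite /weight (big_rem b) //= leq_addr. Qed.

Lemma restr_out (t : ptype) k : weight t < k -> restr t k = empty_part.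
Proof.
move=> wk; apply: restr0 => b bt; have [b1 b2] := block_gt0 bt.
have := weight_block bt; apply: contraTneq => e; rewrite -ltnNge -e in wk *.
by apply: leq_trans wk _; rewrite leq_pmulr.
Qed.

Lemma weight_restr (t : ptype) K : (forall k, K < k -> restr t k = empty_part) ->
  weight t = \sum_(k < K) k.+1 * sumn (restr t k.+1).
Proof.
move=> out; have H b : b \in blocks t -> 0 < b.1 <= K.
  move=> bt; have [b1 _] := block_gt0 bt; rewrite b1 leqNgt; apply/negP => /out e.
  have : b.2 \in parts (restr t b.1) by apply/mapP; exists b; rewrite // mem_filter eqxx.
  by rewrite e.
rewrite /weight /=; elim: (blocks t) H => [|b s IH] H.
  by rewrite big_nil big1 // => k _; rewrite muln0.
rewrite big_cons IH => [|c cs]; last by apply: H; rewrite inE cs orbT.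
have /andP[b1 bK] := H b (mem_head _ _).
have bK' : b.1.-1 < K by rewrite prednK.
rewrite (bigD1 (Ordinal bK')) // [RHS](bigD1 (Ordinal bK')) //= addnA; congr (_ + _).
  by rewrite prednK // /mults /= eqxx /= mulnDr.
apply: eq_bigr => k; rewrite -val_eqE /= => kb; rewrite /mults /= ifF //.
by apply/eqP => e; move: kb; rewrite e eqxx.
Qed.

(** The blocks of degree [K.+1] are put in front, where the order of blocks wants the largest
    degree. *)
Lemma ptype_of_family (f : nat -> intpart) K :
  exists t : ptype, forall k, restr t k = if 0 < k <= K then f k else empty_part.
Proof.
elim: K => [|K [t tE]].
  by exists empty_ptype => k; rewrite restr0 //; case: k.
pose s := [seq (K.+1, a) | a <- f K.+1] ++ blocks t.
have tK b : b \in blocks t -> b.1 <= K.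
  move=> bt; rewrite leqNgt; apply/negP => Kb.
  have : b.2 \in parts (restr t b.1).
    by apply/mapP; exists b; rewrite // mem_filter eqxx.
  by rewrite tE [b.1 <= K]leqNgt Kb andbF.
have /andP[srt pos] := partsP (f K.+1).
have /andP[srt' pos'] := blocksP t.
have geqT : transitive geq by move=> y x z /= yx zy; exact: leq_trans zy yx.
have sP : is_type s.
  apply/andP; split; last first.
    by rewrite all_cat pos' andbT all_map; apply: sub_all pos => a /= ->.
  rewrite (sorted_pairwise block_ge_trans) pairwise_cat -(sorted_pairwise block_ge_trans t) srt' andbT.
  apply/andP; split.
    by apply/allrelP => _ b /mapP[a _ ->] /tK bK; rewrite /block_ge /= ltnS bK.
  rewrite pairwise_map; move: srt; rewrite (sorted_pairwise geqT).
  by apply: sub_pairwise => a b /= ab; rewrite /block_ge /= ltnn eqxx.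
exists (PType sP) => k; apply: val_inj; rewrite /= /mults filter_cat map_cat.
rewrite -/(mults t k) (congr1 parts (tE k) : mults t k = _) filter_map.
case: (eqVneq k K.+1) => [->|ne].
  rewrite ltnn andbF ltnS leqnn cats0 (eq_filter (a2 := predT)) => [|a] /=; last by rewrite eqxx.
  by rewrite filter_predT -map_comp map_id.
rewrite (eq_filter (a2 := pred0)) => [|a] /=; last by rewrite eq_sym (negPf ne).
by rewrite filter_pred0 /= [k <= K.+1]leq_eqVlt (negPf ne).
Qed.

Lemma finite_types n : finite_set [set t : ptype | weight t = n].
Proof.
pose r := [seq (i, j) | i <- iota 0 n.+1, j <- iota 0 n.+1].
have H := finite_bounded_seqs r n.
apply: sub_finite_set (finite_preimage (f := blocks) _ H) => [t tn|]; last first.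
  by move=> x y _ _; exact: val_inj.
rewrite /mkset in tn; split=> [|b bt].
  rewrite -tn /weight /= -[X in X <= _]sum1_size big_seq [X in _ <= X]big_seq.
  by apply: leq_sum => b /block_gt0[b1 b2]; rewrite muln_gt0 b1.
have [b1 b2] := block_gt0 bt; have le := weight_block bt; rewrite tn in le.
apply/allpairsP; exists b; split; last by case: b {bt b1 b2 le}.
  by rewrite mem_iota ltnS (leq_trans _ le) // leq_pmulr.
by rewrite mem_iota ltnS (leq_trans _ le) // leq_pmull.
Qed.

Definition types n : seq ptype := fset_set [set t : ptype | weight t = n].

Lemma mem_types n t : (t \in types n) = (weight t == n).
Proof.
rewrite in_fset_set; last exact: finite_types.
by apply/idP/eqP => [/set_mem|e] //; exact: mem_set.
Qed.

Lemma uniq_types n : uniq (types n). Proof. exact: fset_uniq. Qed.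

Lemma part_of_mdeg cl i (m : monomial) :
  mdeg (part_of cl i m) = \sum_(v <- finsupp m) (if cl v == i then m v else 0).
Proof.
rewrite (@mdegEw _ _ (finsupp m)).
  by apply: eq_bigr => v _; rewrite part_ofE.
apply/fsubsetP => v; rewrite -!cmE_neq0 part_ofE; case: ifP => //.
Qed.

Lemma monomial_degreeE K (m : monomial) : (forall v, m v != 0 -> letter_class v < K) ->
  monomial_degree m = \sum_(k < K) k.+1 * mdeg (part_of letter_class k m).
Proof.
move=> H; transitivity (\sum_(k < K) \sum_(v <- finsupp m) k.+1 * (if letter_class v == k then m v else 0)); last first.
  by apply: eq_bigr => k _; rewrite part_of_mdeg big_distrr.
rewrite exchange_big /= /monomial_degree big_seq [RHS]big_seq.
apply: eq_bigr => v; rewrite -cmE_neq0 => /H vK.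
rewrite (bigD1 (Ordinal vK)) //= eqxx big1 ?addn0 => [|k]; last first.
  by rewrite -val_eqE /= eq_sym => /negPf ->; rewrite muln0.
by rewrite /letter_class prednK //; case/andP: (valP v).
Qed.

(** Together with the weights of the types at hand it gives a finite range of degrees beyond which
    all factors are trivial. *)
Definition class_bound (m : monomial) := \max_(v <- finsupp m) (letter_class v).+1.

Lemma class_boundP (m : monomial) v : m v != 0 -> letter_class v < class_bound m.
Proof.
by move=> mv; rewrite /class_bound (big_fsetD1 v) -?cmE_neq0 //= leq_max leqnn.
Qed.

Lemma monomial_degreeM (a b : monomial) :
  monomial_degree (mmul a b) = monomial_degree a + monomial_degree b.
Proof.
pose K := class_bound (mmul a b).
have HK v : mmul a b v != 0 -> letter_class v < K by exact: class_boundP.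
have Ha v : a v != 0 -> letter_class v < K.
  by move=> av; apply: HK; rewrite cmM addn_eq0 negb_and av.
have Hb v : b v != 0 -> letter_class v < K.
  by move=> bv; apply: HK; rewrite cmM addn_eq0 negb_and bv orbT.
rewrite (monomial_degreeE HK) (monomial_degreeE Ha) (monomial_degreeE Hb) -big_split.
by apply: eq_bigr => k _; rewrite part_ofM mdegM mulnDr.
Qed.

Lemma monomial_degree1 : monomial_degree mone = 0.
Proof. by rewrite /monomial_degree mdom1 big_seq_fset0. Qed.

Lemma monomial_degreeX (a : monomial) n : monomial_degree (expcmn a n) = n * monomial_degree a.
Proof.
by rewrite expcmn_iter; elim: n => [|n IH]; rewrite ?monomial_degree1 //= monomial_degreeM IH mulSn.
Qed.

Local Open Scope ring_scope.

(** * Tensor Schur functions and products over the degrees *)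

Lemma empty_partE (la : intpart) : sumn la = 0%N -> la = empty_part.
Proof. by move=> e; apply/val_inj/size0nil/eqP; rewrite -leqn0 -e size_part_le. Qed.

Lemma schur_empty k : schur empty_part k.+1 = series_one.
Proof.
apply/funext => m; rewrite /series_one; case: eqP => [->|ne]; last first.
  apply/eqP; apply: contra_notT ne => /homog_schur/= /mdeg_eq0I; exact.
rewrite /schur (@fsbigE _ _ _ _ _ [:: [::]]) //.
- rewrite big_cons big_nil ifT ?addr0 //; apply: mem_set; split; first by split.
  by move=> v; rewrite cm1; case: ifP.
- move=> T /=; rewrite inE => /eqP ->; split; first by split.
  by move=> v; rewrite cm1; case: ifP.
by move=> T /= [[sh _ _ _] _]; rewrite (size0nil (etrans (esym (size_map size T)) (congr1 size sh))) mem_head.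
Qed.

(** Factors beyond the weight are 1, so the tensor Schur functions of different types can be written
    over one common range [K]. *)
Lemma stensorE (t : ptype) K : (weight t <= K)%N ->
  stensor t = (\prod_(k < K) (schur (restr t k.+1) k.+1 : pseries) : pseries).
Proof.
move=> wK; transitivity (\prod_(0 <= k < weight t) (schur (restr t k.+1) k.+1 : pseries)).
  by rewrite /stensor big_add1.
rewrite -(big_mkord xpredT (fun k => schur (restr t k.+1) k.+1 : pseries)).
rewrite (big_cat_nat _ wK) //= [X in _ * X]big_nat [X in _ * X]big1 ?mulr1 // => k /andP[wk _].
by rewrite restr_out // schur_empty.
Qed.

Lemma stensor_coef (t : ptype) K (m : monomial) : (weight t <= K)%N ->
  (forall v : var, m v != 0%N -> (letter_class v < K)%N) ->
  stensor t m = \prod_(k < K) schur (restr t k.+1) k.+1 (part_of letter_class k m).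
Proof.
move=> wK mK; rewrite (stensorE wK).
rewrite (@prod_classes letter_class K (fun k => schur (restr t k.+1) k.+1)) // => k _.
exact: supp_in_schur.
Qed.

Lemma stensor_supp (t : ptype) m : stensor t m != 0 ->
  forall k, mdeg (part_of letter_class k m) = sumn (restr t k.+1).
Proof.
move=> nz k; pose K := maxn k.+1 (maxn (weight t) (class_bound m)).
have kK : (k < K)%N by rewrite leq_maxl.
move: nz; rewrite (@stensor_coef _ K).
- by rewrite (bigD1 (Ordinal kK)) //= mulf_eq0 negb_or => /andP[/homog_schur].
- by rewrite /K leq_max [X in _ || X]leq_max leqnn orbT.
by move=> v /class_boundP h; rewrite (leq_trans h) // /K !leq_max leqnn !orbT.
Qed.

Lemma stensor_degree (t : ptype) m : stensor t m != 0 -> monomial_degree m = weight t.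
Proof.
move=> nz; pose K := maxn (weight t) (class_bound m).
rewrite (@monomial_degreeE K) => [|v /class_boundP h]; last first.
  by rewrite (leq_trans h) // leq_maxr.
rewrite (@weight_restr t K) => [|k wk]; last by rewrite restr_out // (leq_ltn_trans _ wk) ?leq_maxl.
apply: eq_bigr => k _.
by rewrite (stensor_supp nz).
Qed.

Lemma prod_sum_seq (I : eqType) (L : seq I) K (P : nat -> pred I) (F : nat -> I -> rat) x0 :
  \prod_(k < K) (\sum_(x <- L | P k x) F k x) =
  \sum_(f : {ffun 'I_K -> 'I_(size L)} | [forall k : 'I_K, P k (nth x0 L (f k))])
    \prod_(k < K) F k (nth x0 L (f k)).
Proof.
transitivity (\prod_(k < K) \sum_(j < size L | P k (nth x0 L j)) F k (nth x0 L j)).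
  by apply: eq_bigr => k _; rewrite (big_nth x0) big_mkord.
rewrite bigA_distr_big_dep; apply: eq_bigl => f.
by apply/familyP/forallP => H k; have := H k.
Qed.

(** Expanding the product chooses a partition of [d k] for each degree [k.+1]; such a family is the
    same thing as a type, whose weight is the sum of the [k.+1 * d k]. *)
Lemma prod_sum_partitions K (d : nat -> nat) (F : nat -> intpart -> rat) :
  (forall k, (K <= k)%N -> d k = 0%N) ->
  (\sum_(k < K) k.+1 * d k <= K)%N ->
  \prod_(k < K) \sum_(la <- partitions (d k)) F k la =
  \sum_(t <- types (\sum_(k < K) k.+1 * d k) | [forall k : 'I_K, sumn (restr t k.+1) == d k])
     \prod_(k < K) F k (restr t k.+1).
Proof.
move=> dK; set n := (\sum_(k < K) _)%N => nK.
(* A single list containing every partition that can occur, so that families become functions into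
   one finite index type. *)
pose L := flatten [seq partitions i | i <- iota 0 n.+1].
have memL la : (la \in L) = (sumn la <= n)%N.
  apply/flattenP/idP => [[_ /mapP[i + ->]]|le].
    by rewrite mem_iota mem_partitions => h /eqP ->.
  exists (partitions (sumn la)); last by rewrite mem_partitions.
  by apply: map_f; rewrite mem_iota ltnS.
have uL : uniq L.
  rewrite /L; elim: (n.+1) 0%N => //= q IH a; rewrite cat_uniq uniq_partitions IH andbT.
  apply/hasPn => la /flattenP[_ /mapP[i + ->]]; rewrite mem_iota !mem_partitions.
  by move=> h /eqP ->; apply/eqP => e; move: h; rewrite e ltnn.
have dn k : (d k <= n)%N.
  case: (ltnP k K) => [kK|/dK -> //]; rewrite /n (bigD1 (Ordinal kK)) //=.
  by rewrite (leq_trans _ (leq_addr _ _)) // mulSn leq_addr.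
have HL k : \sum_(la <- partitions (d k)) F k la = \sum_(la <- L | sumn la == d k) F k la.
  rewrite -[RHS]big_filter; apply: perm_big; apply: uniq_perm; rewrite ?uniq_partitions ?filter_uniq //.
  by move=> la; rewrite mem_filter memL mem_partitions; case: eqP => // ->; rewrite dn.
rewrite (eq_bigr _ (fun (k : 'I_K) _ => HL k)).
rewrite (@prod_sum_seq _ L K (fun k la => sumn la == d k) F empty_part).
have eL : (index empty_part L < size L)%N by rewrite index_mem memL.
(* The default index [eL], that of the empty partition, is never reached for a type satisfying
   [Q]. *)
pose phi (t : ptype) : {ffun 'I_K -> 'I_(size L)} :=
  [ffun k : 'I_K => insubd (Ordinal eL) (index (restr t k.+1) L)].
have phiE t (k : 'I_K) : sumn (restr t k.+1) == d k -> nth empty_part L (phi t k) = restr t k.+1.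
  move=> /eqP e; have inL : restr t k.+1 \in L by rewrite memL e dn.
  by rewrite ffunE val_insubd index_mem inL nth_index.
pose Q (t : ptype) := [forall k : 'I_K, sumn (restr t k.+1) == d k].
pose P (f : {ffun 'I_K -> 'I_(size L)}) := [forall k : 'I_K, sumn (nth empty_part L (f k)) == d k].
transitivity (\sum_(f <- [seq phi t | t <- types n & Q t]) \prod_(k < K) F k (nth empty_part L (f k))); last first.
  rewrite big_map big_filter; apply: eq_bigr => t /forallP Qt; apply: eq_bigr => k _.
  by rewrite phiE.
have inj : {in [seq t <- types n | Q t] &, injective phi}.
  move=> t t'; rewrite !mem_filter !mem_types => /andP[/forallP Qt /eqP wt] /andP[/forallP Qt' /eqP wt'] e.
  apply: ptype_inj => -[|k].
    by rewrite !restr0 // => b /block_gt0[]; rewrite lt0n.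
  case: (ltnP k K) => kK; last by rewrite !restr_out ?wt ?wt' ?ltnS ?(leq_trans nK).
  by rewrite -(phiE t (Ordinal kK)) // -(phiE t' (Ordinal kK)) // e.
rewrite -/P -big_enum; apply: perm_big; apply: uniq_perm.
- exact: enum_uniq.
- by rewrite map_inj_in_uniq // filter_uniq // uniq_types.
move=> f; rewrite mem_enum; apply/idP/mapP => [/forallP Pf|[t]].
  have [t tE] := ptype_of_family (fun k => if insub k.-1 is Some i then nth empty_part L (f i) else empty_part) K.
  have tE' (k : 'I_K) : restr t k.+1 = nth empty_part L (f k) by rewrite tE /= ltn_ord valK.
  have Qt : Q t by apply/forallP => k; rewrite tE'.
  have wt : weight t = n.
    rewrite (@weight_restr t K) => [|k Kk]; last by rewrite tE [(k <= K)%N]leqNgt Kk andbF.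
    by apply: eq_bigr => k _; rewrite tE' (eqP (Pf k)).
  exists t; first by rewrite mem_filter Qt mem_types wt eqxx.
  apply/ffunP => k; rewrite ffunE tE'; apply: val_inj; rewrite val_insubd.
  by rewrite index_uniq // ltn_ord.
rewrite mem_filter => /andP[/forallP Qt _] ->; apply/forallP => k.
by rewrite phiE.
Qed.

(** * The product of one block factor with a tensor Schur function *)

Lemma size_dg (mu : seq nat) : size (dg mu) = sumn mu.
Proof.
rewrite /dg size_allpairs_dep -[in RHS](mkseq_nth 0%N mu) /mkseq.
rewrite -[X in iota X _]addn0 iotaDl -map_comp; congr sumn; apply: eq_map => i /=.
by rewrite size_iota.
Qed.

Lemma is_ribbon_sumn r (nu mu : intpart) : is_ribbon r nu mu -> sumn nu = (sumn mu + r)%N.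
Proof.
move=> [sub [b [/perm_size sb <- _]]]; rewrite sb -!size_dg -size_cat; apply/perm_size/uniq_perm.
- exact: uniq_dg.
- rewrite cat_uniq uniq_dg uniq_skew andbT; apply/hasPn => x.
  by rewrite mem_filter => /andP[].
move=> x; rewrite mem_cat mem_filter; case: (boolP (x \in dg mu)) => [/sub|] //=.
Qed.

Lemma is_polyribbon_sumn r n (la mu : intpart) : is_polyribbon r n la mu ->
  sumn la = (sumn mu + n * r)%N.
Proof.
move=> [g P]; elim: n mu g P => [|n IH] mu g P.
  by have /polyribbon_chain0[-> _] := P; rewrite mul0n addn0.
have [[|nu t] eg [st _]] := polyribbon_chain_head P; first by [].
rewrite eg in P; have [R Q _] := (polyribbon_chain_cons _ _ _ _ _ _).1 P; rewrite (IH _ _ Q).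
by rewrite (is_ribbon_sumn R) mulSn addnA.
Qed.

Lemma sgn_polyribbon_empty r : (0 < r)%N -> sgn_polyribbon r empty_part empty_part = 1.
Proof.
move=> r0; have P0 : exists n, polyribbon_chain r n empty_part empty_part [:: empty_part].
  by exists 0%N; apply/polyribbon_chain0.
have [n P] : exists n, polyribbon_chain r n empty_part empty_part (the_chain r empty_part empty_part).
  exact: (@xgetPex _ [::] [set g | exists n, polyribbon_chain r n empty_part empty_part g] (ex_intro _ _ P0)).
have n0 : n = 0%N.
  have : is_polyribbon r n empty_part empty_part by exists (the_chain r empty_part empty_part).
  by move=> /is_polyribbon_sumn/= /esym/eqP; rewrite muln_eq0 [r == _]gtn_eqF // orbF => /eqP.
move: P; rewrite n0 => /polyribbon_chain0[_ e].
by rewrite /sgn_polyribbon e big_ord0.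
Qed.

(** For [r > 0] this is the sum of the H_(d^r) over all [d]; it is also the product of the series
    [powers r k] over all alphabets. *)
Definition allpowers r : pseries := fun m => (`[< forall v : var, (r %| m v)%N >])%:R.

Lemma prod_powers r K (m : monomial) : (forall v : var, m v != 0%N -> (letter_class v < K)%N) ->
  (\prod_(k < K) powers r k) m = allpowers r m.
Proof.
move=> mK; rewrite (@prod_classes letter_class K (powers r)) //; last first.
  move=> k _ a; rewrite /powers pnatr_eq0 eqb0 negbK => /asboolP H v /H[e _].
  by rewrite /letter_class e.
rewrite /powers prod_bool /allpowers; congr (nat_of_bool _)%:R.
apply/forallP/asboolP => H v; last first.
  apply/asboolP => w; rewrite part_ofE; case: (eqVneq (letter_class w) (v : nat)) => // <- _.
  by split=> //; rewrite /letter_class prednK //; case/andP: (valP w).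
case: (eqVneq (m v) 0%N) => [->|mv]; first by rewrite dvdn0.
have /asboolP/(_ v) := H (Ordinal (mK v mv)).
by rewrite part_ofE /= eqxx => /(_ mv)[].
Qed.

Lemma supp_inM cl i f g : supp_in cl i f -> supp_in cl i g -> supp_in cl i (f * g).
Proof.
move=> Hf Hg m nz v mv; apply/eqP; apply: contraNT nz => ne; apply/eqP/series_mul_eq0 => a b ab.
case: (eqVneq (f a) 0) => [->|/Hf Ha]; rewrite ?mul0r //.
case: (eqVneq (g b) 0) => [->|/Hg Hb]; rewrite ?mulr0 //.
have: (a v != 0%N) || (b v != 0%N) by move: mv; rewrite -ab cmM addn_eq0 negb_and.
by case/orP=> [/Ha|/Hb] e; rewrite e eqxx in ne.
Qed.

Lemma allpowers_stensor r (rho : ptype) K (m : monomial) : (0 < r)%N ->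
  (weight rho <= K)%N -> (monomial_degree m <= K)%N ->
  (forall v : var, m v != 0%N -> (letter_class v < K)%N) ->
  series_mul (allpowers r) (stensor rho) m =
  \sum_(t <- types (monomial_degree m))
    (\prod_(k < K) polyribbon_coef r (restr t k.+1) (restr rho k.+1)) * stensor t m.
Proof.
move=> r0 rK degK mK.
transitivity ((\prod_(k < K) (powers r k * (schur (restr rho k.+1) k.+1 : pseries))) m).
  rewrite big_split /= -stensorE // pseries_mulE; apply: eq_series_mul => a b ab.
  rewrite prod_powers // => v av; apply: mK.
  by rewrite -ab cmM addn_eq0 negb_and av.
rewrite (@prod_classes letter_class K (fun k => powers r k * (schur (restr rho k.+1) k.+1 : pseries))) //; last first.
  move=> k _; apply: supp_inM; last exact: supp_in_schur.
  move=> a; rewrite /powers pnatr_eq0 eqb0 negbK => /asboolP H v /H[e _].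
  by rewrite /letter_class e.
pose d k := mdeg (part_of letter_class k m).
pose F k la := polyribbon_coef r la (restr rho k.+1) * schur la k.+1 (part_of letter_class k m).
rewrite (eq_bigr (fun k : 'I_K => \sum_(la <- partitions (d k)) F k la)); last first.
  by move=> k _; exact: powers_schur.
have degE : monomial_degree m = (\sum_(k < K) k.+1 * d k)%N by exact: monomial_degreeE.
rewrite prod_sum_partitions -?degE //; last first.
  move=> k Kk; rewrite /d part_of_mdeg big1_seq // => v /andP[_].
  rewrite -cmE_neq0 => /mK; case: eqP => // ->; by rewrite ltnNge Kk.
rewrite big_mkcond big_seq [RHS]big_seq; apply: eq_bigr => t; rewrite mem_types => /eqP wt.
case: ifPn => [Q|/forallPn[k nk]].
  by rewrite (@stensor_coef t K) ?wt // -big_split.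
(* The monomial [m] does not occur for a type whose partitions have other sizes than the class parts
   of [m] prescribe. *)
rewrite (_ : stensor t m = 0) ?mulr0 //; apply/eqP; apply: contraNT nk => nz.
by rewrite /d (stensor_supp nz k) eqxx.
Qed.

(** A monomial with all exponents divisible by [r] has exactly one [r]-th root, of degree smaller by
    the factor [r]; hence H_(d^r) is the part of [allpowers r] of degree [d * r]. *)
Lemma series_frob_Hdeg r d (m : monomial) : (0 < r)%N ->
  series_frob r (Hdeg d) m = if monomial_degree m == (d * r)%N then allpowers r m else 0.
Proof.
move=> r0; rewrite /allpowers; case: asboolP => [H|N]; last first.
  rewrite if_same /series_frob fsbig1 // => m' /= e; case: N => v.
  by rewrite -e expcmnE dvdn_mulr.
pose m1 : monomial := [cmonom (m v %/ r)%N | v in finsupp m]%M.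
have m1E v : m1 v = (m v %/ r)%N.
  by rewrite cmE fsfun_fun; case: ifP => // /negbT; rewrite -cmE_eq0 => /eqP->; rewrite div0n.
have e1 : expcmn m1 r = m by apply/eqP/cmP => v; rewrite expcmnE m1E mulnC divnK.
rewrite /series_frob (@fsbigE _ _ _ _ _ [:: m1]) //.
- rewrite big_cons big_nil ifT ?addr0; last exact: mem_set.
  rewrite /Hdeg -[in RHS]e1 monomial_degreeX mulnC eqn_pmul2r //; by case: eqP.
- by move=> m' /=; rewrite inE => /eqP ->.
move=> m' /= e' /negP[]; rewrite inE; apply/cmP => v; rewrite m1E -e' expcmnE mulKn //.
Qed.

Definition tensor_coef r (t rho : ptype) : rat :=
  if `[< forall k, (0 < k)%N -> exists n, is_polyribbon r n (restr t k) (restr rho k) >]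
  then sgn_tensor r t rho else 0.

Lemma prod_polyribbon_coef r (t rho : ptype) K : (0 < r)%N ->
  (weight t <= K)%N -> (weight rho <= K)%N ->
  \prod_(k < K) polyribbon_coef r (restr t k.+1) (restr rho k.+1) = tensor_coef r t rho.
Proof.
move=> r0 tK rK; rewrite /tensor_coef; case: asboolP => [H|/existsNP[k /not_implyP[k0 N]]]; last first.
  case: k k0 N => // k _ N.
  have kK : (k < K)%N.
    (* From [K] on both partitions are empty and the trivial chain exists, so the obstruction occurs
       inside the range of the product. *)
    rewrite ltnNge; apply/negP => Kk; apply: N; exists 0%N, [:: empty_part].
    by rewrite !restr_out ?ltnS ?(leq_trans _ Kk) //; apply/polyribbon_chain0.
  by rewrite (bigD1 (Ordinal kK)) //= /polyribbon_coef asboolF // mul0r.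
rewrite (eq_bigr (fun k : 'I_K => sgn_polyribbon r (restr t k.+1) (restr rho k.+1))); last first.
  by move=> k _; rewrite /polyribbon_coef asboolT //; exact: H.
rewrite /sgn_tensor big_add1 /= -(big_mkord xpredT (fun k => sgn_polyribbon r (restr t k.+1) (restr rho k.+1))).
rewrite (big_cat_nat _ tK) //= [X in _ * X]big_nat [X in _ * X]big1 ?mulr1 // => k /andP[wk _].
have e := restr_out (t := t) (k := k.+1) wk; rewrite e.
have [n] := H k.+1 isT; rewrite e => /is_polyribbon_sumn/= /esym/eqP.
rewrite addn_eq0 => /andP[/eqP e0 _]; rewrite (@empty_partE (restr rho k.+1) e0).
exact: sgn_polyribbon_empty.
Qed.

Lemma sumn_count (s : seq nat) K : all (fun a => 0 < a <= K)%N s ->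
  (\sum_(k < K) k.+1 * count_mem k.+1 s = sumn s)%N.
Proof.
elim: s => [|a s IH] /=; first by rewrite big1 // => k _; rewrite muln0.
move=> /andP[/andP[a0 aK] /IH <-].
have aK' : (a.-1 < K)%N by rewrite prednK.
rewrite (bigD1 (Ordinal aK')) // [in RHS](bigD1 (Ordinal aK')) //= addnA; congr (_ + _)%N.
  by rewrite prednK // eqxx mulnDr muln1.
apply: eq_bigr => k; rewrite -val_eqE /= => ka.
by rewrite (_ : (a == k.+1) = false) //; apply/eqP => e; move: ka; rewrite e eqxx.
Qed.

Lemma is_tensor_polyribbon_weight d r (t rho : ptype) : is_tensor_polyribbon d r t rho ->
  weight t = (weight rho + d * r)%N.
Proof.
move=> [la [<- H]].
pose K := (weight t + weight rho + sumn la)%N.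
rewrite (@weight_restr t K) => [|k Kk]; last by rewrite restr_out //; rewrite /K in Kk; lia.
rewrite (@weight_restr rho K) => [|k Kk]; last by rewrite restr_out //; rewrite /K in Kk; lia.
rewrite -(@sumn_count la K); last first.
  apply/allP => a al; have /andP[_ /allP pos] := partsP la; have a0 : (0 < a)%N := pos a al.
  rewrite a0 /= /K (leq_trans _ (leq_addl _ _)) //; have := nth_part_le la (index a la).
  by rewrite nth_index.
rewrite big_distrl -big_split; apply: eq_bigr => k _ /=.
by rewrite (is_polyribbon_sumn (H k.+1 isT)) mulnDr mulnA.
Qed.

(** Sizes force the partition of [d] to have [e k] parts equal to [k], and the weight equation makes
    its size [d]. The condition is thus freed from [d], as a rule in all degrees at once
    requires. *)
Lemma is_tensor_polyribbonP d r (t rho : ptype) : (0 < r)%N -> weight t = (weight rho + d * r)%N ->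
  is_tensor_polyribbon d r t rho <->
  (forall k, (0 < k)%N -> exists n, is_polyribbon r n (restr t k) (restr rho k)).
Proof.
move=> r0 wt; split=> [[la [_ H]] k k0|H]; first by exists (count_mem k la); exact: H.
pose e k := ((sumn (restr t k) - sumn (restr rho k)) %/ r)%N.
have He k : (0 < k)%N -> is_polyribbon r (e k) (restr t k) (restr rho k).
  by move=> /H[n P]; rewrite /e (is_polyribbon_sumn P) addKn mulnK.
pose s := flatten [seq nseq (e k) k | k <- iota 1 (weight t)].
have sP : is_part (sort geq s).
  apply/andP; split; first by apply: sort_sorted => a b; exact: leq_total.
  rewrite all_sort; apply/allP => a /flattenP[_ /mapP[k + ->]].
  by rewrite mem_iota mem_nseq => /andP[k1 _] /andP[_ /eqP ->].
have cs k : (0 < k)%N -> count_mem k s = e k.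
  move=> k0; rewrite /s count_flatten -map_comp.
  rewrite (eq_map (g := fun j => (j == k) * e k)%N) => [|j /=]; last first.
    by rewrite count_nseq /=; case: eqP => [->|].
  case: (leqP k (weight t)) => kw.
    rewrite sumnE big_map (bigD1_seq k) ?iota_uniq //=; last by rewrite mem_iota; lia.
    by rewrite eqxx mul1n big1 ?addn0 // => j /negPf ->.
  rewrite [in RHS]/e (restr_out kw) /= div0n sumnE big_map big_seq big1 // => j.
  by rewrite mem_iota; case: eqP => // ->; lia.
exists (IntPart sP); split; last first.
  move=> k k0; have -> : count_mem k (IntPart sP) = e k; last exact: He.
  by rewrite -cs //; apply/seq.permP; rewrite perm_sort.
have -> : sumn (IntPart sP) = sumn s by apply: perm_sumn; rewrite perm_sort.
apply/eqP; rewrite -(eqn_pmul2r r0) -(eqn_add2l (weight rho)) -wt.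
rewrite -(@sumn_count s (weight t)); last first.
  apply/allP => a /flattenP[_ /mapP[k + ->]].
  by rewrite mem_iota mem_nseq => h /andP[_ /eqP ->]; lia.
rewrite [X in _ == X](@weight_restr t (weight t)) => [|k]; last exact: restr_out.
rewrite (@weight_restr rho (weight t)) => [|k Kk]; last by rewrite restr_out //; lia.
rewrite big_distrl -big_split; apply/eqP; apply: eq_bigr => k _ /=.
by rewrite cs // [in RHS](is_polyribbon_sumn (He k.+1 isT)) mulnDr mulnA.
Qed.

Definition block_coef (b : block) (t rho : ptype) : rat :=
  if `[< is_tensor_polyribbon b.1 b.2 t rho >] then sgn_tensor b.2 t rho else 0.

(** All monomials of [stensor rho] have degree [weight rho], so at degree [weight rho + b.1 * b.2]
    only the component of [allpowers] of degree [b.1 * b.2] takes part; at any other degree both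
    sides vanish. *)
Lemma frob_stensor (b : block) (rho : ptype) m : (0 < b.2)%N ->
  series_mul (series_frob b.2 (Hdeg b.1)) (stensor rho) m =
  \sum_(t <- types (weight rho + b.1 * b.2)) block_coef b t rho * stensor t m.
Proof.
case: b => d r /= r0; case: (eqVneq (monomial_degree m) (weight rho + d * r)%N) => [dm|dm]; last first.
  rewrite series_mul_eq0 => [|a c ac].
    rewrite big_seq big1 // => t; rewrite mem_types => /eqP wt.
    rewrite (_ : stensor t m = 0) ?mulr0 //; apply/eqP; apply: contraNT dm => /stensor_degree ->.
    by rewrite wt.
  rewrite series_frob_Hdeg //; case: (eqVneq (stensor rho c) 0) => [->|/stensor_degree dc]; first by rewrite mulr0.
  case: eqP => da; last by rewrite mul0r.
  by move: dm; rewrite -ac monomial_degreeM da dc addnC eqxx.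
pose K := maxn (weight rho) (maxn (monomial_degree m) (class_bound m)).
transitivity (series_mul (allpowers r) (stensor rho) m).
  apply: eq_series_mul => a c ac; case: (eqVneq (stensor rho c) 0) => [->|/stensor_degree dc]; first by rewrite !mulr0.
  rewrite series_frob_Hdeg // ifT // -(eqn_add2r (weight rho)).
  by rewrite -{1}dc -monomial_degreeM ac dm addnC.
have rK : (weight rho <= K)%N by rewrite leq_maxl.
have mK : (monomial_degree m <= K)%N by rewrite /K !leq_max leqnn orbT.
rewrite (@allpowers_stensor r rho K) // -?dm; last first.
  by move=> v /class_boundP h; rewrite (leq_trans h) // /K !leq_max leqnn !orbT.
rewrite big_seq [RHS]big_seq; apply: eq_bigr => t; rewrite mem_types => /eqP wt; congr (_ * _).
rewrite prod_polyribbon_coef ?wt // /tensor_coef /block_coef /=.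
by congr (if _ then _ else _); apply: asbool_equiv_eq; apply: iff_sym; apply: is_tensor_polyribbonP; rewrite ?wt.
Qed.

(** * Tensor polyribbon tableaux *)

(** [TPRT] for an arbitrary list of blocks, so that the last block can be removed without showing
    that the rest is a type; for the blocks of a type it is [TPRT] itself. *)
Definition block_tableaux (t : ptype) (s : seq block) (T : seq ptype) : Prop :=
  let T_ := nth empty_ptype T in
  [/\ size T = (size s).+1, T_ 0%N = empty_ptype, T_ (size s) = t
    & forall i, (i < size s)%N ->
        is_tensor_polyribbon (nth (0%N, 0%N) s i).1 (nth (0%N, 0%N) s i).2 (T_ i.+1) (T_ i)].

Definition blocks_sgn (s : seq block) (T : seq ptype) : rat :=
  \prod_(i < size s) sgn_tensor (nth (0%N, 0%N) s i).2 (nth empty_ptype T i.+1) (nth empty_ptype T i).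

Definition blocks_weight (s : seq block) : nat := (\sum_(b <- s) b.1 * b.2)%N.

Lemma block_tableaux_nil t T : block_tableaux t [::] T <-> t = empty_ptype /\ T = [:: empty_ptype].
Proof.
split=> [[s T0 Tt _]|[-> ->]]; last by split.
by case: T s T0 Tt => [|x [|]] //= _ -> ->.
Qed.

Lemma block_tableaux_rcons t s b T : block_tableaux t (rcons s b) T <->
  exists rho T', [/\ T = rcons T' t, block_tableaux rho s T'
    & is_tensor_polyribbon b.1 b.2 t rho].
Proof.
split.
  case; rewrite size_rcons; case/lastP: T => // T' x; rewrite size_rcons => -[sT'] T0 Tt H.
  have ex : x = t by rewrite -Tt nth_rcons sT' ltnn eqxx.
  exists (nth empty_ptype T' (size s)), T'; split.
  - by rewrite ex.
  - split=> //; first by move: T0; rewrite nth_rcons sT'.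
    move=> i is_; have := H i (leqW is_).
    by rewrite !nth_rcons sT' is_ !ltnS is_ (ltnW is_).
  have := H (size s) (ltnSn _).
  by rewrite !nth_rcons sT' ltnn eqxx ltnSn ltnn eqxx ex.
move=> [rho [T' [-> [sT' T0 Tt H] R]]]; split.
- by rewrite !size_rcons sT'.
- by rewrite nth_rcons sT'.
- by rewrite size_rcons nth_rcons sT' ltnn eqxx.
move=> i; rewrite size_rcons ltnS leq_eqVlt => /orP[/eqP ->|is_].
  by rewrite !nth_rcons sT' ltnn eqxx ltnSn ltnn eqxx Tt.
by rewrite !nth_rcons sT' is_ !ltnS is_ (ltnW is_); exact: H.
Qed.

Lemma block_tableaux_weight t s T : block_tableaux t s T -> weight t = blocks_weight s.
Proof.
elim/last_ind: s t T => [|s b IH] t T.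
  by move=> /block_tableaux_nil[-> _]; rewrite /weight /blocks_weight !big_nil.
move=> /block_tableaux_rcons[rho [T' [_ /IH e /is_tensor_polyribbon_weight ->]]].
by rewrite e /blocks_weight -cats1 big_cat big_seq1.
Qed.

(** The list of blocks is reversed, since the recursion removes the last block first. The preceding
    shape is searched among the finitely many types of the weight it must have. *)
Fixpoint tableau_list (rs : seq block) (t : ptype) : seq (seq ptype) :=
  if rs is b :: rs' then
    [seq rcons T t | rho <- [seq rho <- types (blocks_weight rs') |
         `[< is_tensor_polyribbon b.1 b.2 t rho >]], T <- tableau_list rs' rho]
  else if t == empty_ptype then [:: [:: empty_ptype]] else [::].

Lemma blocks_weight_rev s : blocks_weight (rev s) = blocks_weight s.
Proof. by apply: perm_big; rewrite perm_rev. Qed.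

Lemma mem_tableau_list rs t T : T \in tableau_list rs t <-> block_tableaux t (rev rs) T.
Proof.
elim: rs t T => [|b rs IH] t T.
  split; first by rewrite /=; case: eqP => // ->; rewrite inE => /eqP ->; apply/block_tableaux_nil.
  by move=> /block_tableaux_nil[-> ->]; rewrite /= ?eqxx mem_head.
rewrite rev_cons; split.
  move=> /allpairsPdep[rho [T' [+ /IH BT ->]]]; rewrite mem_filter => /andP[/asboolP R _].
  by apply/block_tableaux_rcons; exists rho, T'.
move=> /block_tableaux_rcons[rho [T' [-> BT R]]]; apply/allpairsPdep; exists rho, T'; split=> //.
  by rewrite mem_filter mem_types (block_tableaux_weight BT) blocks_weight_rev eqxx andbT; apply/asboolP.
exact/IH.
Qed.

Lemma uniq_tableau_list rs t : uniq (tableau_list rs t).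
Proof.
elim: rs t => [|b rs IH] t /=; first by case: ifP.
apply: allpairs_uniq_dep; [exact/filter_uniq/uniq_types|by []|].
move=> [rho T] [rho' T'] /allpairsPdep[x [y [_ /mem_tableau_list[sy _ ey _] [-> ->]]]].
move=> /allpairsPdep[x' [y' [_ /mem_tableau_list[sy' _ ey' _] [-> ->]]]] /= /rcons_inj[e].
by rewrite -ey -ey' e.
Qed.

Lemma sum_block_tableaux s t (F : seq ptype -> rat) :
  \sum_(T \in [set T | block_tableaux t s T]) F T = \sum_(T <- tableau_list (rev s) t) F T.
Proof.
rewrite (@fsbigE _ _ _ _ _ (tableau_list (rev s) t)).
- rewrite big_seq_cond [RHS]big_seq; apply: eq_bigl => T; rewrite andb_idr // => /mem_tableau_list.
  by rewrite revK; exact: mem_set.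
- exact: uniq_tableau_list.
- by move=> T /= /mem_tableau_list; rewrite revK.
by move=> T /= BT /negP[]; apply/mem_tableau_list; rewrite revK.
Qed.

Definition tableau_coef (s : seq block) (t : ptype) : rat :=
  \sum_(T \in [set T | block_tableaux t s T]) blocks_sgn s T.

Lemma tableau_coef_rcons s b t :
  tableau_coef (rcons s b) t =
  \sum_(rho <- types (blocks_weight s)) block_coef b t rho * tableau_coef s rho.
Proof.
rewrite /tableau_coef sum_block_tableaux rev_rcons /= big_allpairs_dep /= big_filter big_mkcond.
rewrite blocks_weight_rev; apply: eq_bigr => rho _; rewrite /block_coef.
case: ifP => _; last by rewrite mul0r.
rewrite sum_block_tableaux mulr_sumr big_seq [RHS]big_seq; apply: eq_bigr => T.
move=> /mem_tableau_list; rewrite revK => -[sT _ eT _].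
rewrite /blocks_sgn size_rcons big_ord_recr /= mulrC; congr (_ * _).
  by rewrite !nth_rcons sT ltnn eqxx ltnSn ltnn eqxx eT.
apply: eq_bigr => i _; rewrite !nth_rcons sT ltn_ord !ltnS ltn_ord ltnW //.
Qed.

Lemma Hblocks_expansion (s : seq block) m : all (fun b => 0 < b.2)%N s ->
  (\prod_(b <- s) (series_frob b.2 (Hdeg b.1) : pseries)) m =
  \sum_(t <- types (blocks_weight s)) tableau_coef s t * stensor t m.
Proof.
elim/last_ind: s m => [|s b IH] m.
  move=> _; have w0 : weight empty_ptype = 0%N by rewrite /weight big_nil.
  have t0 t : (t \in types (blocks_weight [::])) = (t == empty_ptype).
    rewrite mem_types /blocks_weight big_nil; apply/eqP/eqP => [wt|->//].
    apply: ptype_inj => -[|k]; last by rewrite !restr_out ?wt ?w0.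
    by rewrite !restr0 // => c /block_gt0[]; rewrite lt0n.
  rewrite big_nil (bigD1_seq empty_ptype) ?uniq_types ?t0 //= big_seq_cond big1 ?addr0; last first.
    by move=> t /andP[]; rewrite t0 => ->.
  rewrite /tableau_coef sum_block_tableaux /= ?eqxx big_seq1 /blocks_sgn big_ord0 mul1r.
  by rewrite (@stensorE _ 0) ?w0 // big_ord0.
rewrite all_rcons => /andP[b0 /IH Hs].
rewrite -cats1 big_cat big_seq1 /= mulrC.
have -> : \prod_(c <- s) (series_frob c.2 (Hdeg c.1) : pseries) =
   \sum_(t <- types (blocks_weight s)) const_series (tableau_coef s t) * (stensor t : pseries).
  by apply/funext => a; rewrite Hs pseries_sum; apply: eq_bigr => t _; rewrite const_seriesM.
rewrite mulr_sumr pseries_sum.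
transitivity (\sum_(rho <- types (blocks_weight s)) \sum_(t <- types (blocks_weight (s ++ [:: b])))
    tableau_coef s rho * (block_coef b t rho * stensor t m)).
  rewrite big_seq [RHS]big_seq; apply: eq_bigr => rho; rewrite mem_types => /eqP wr.
  rewrite mulrCA const_seriesM -mulr_sumr; congr (_ * _).
  by rewrite pseries_mulE frob_stensor // wr /blocks_weight big_cat big_seq1.
rewrite exchange_big /=; apply: eq_bigr => t _; rewrite cats1 tableau_coef_rcons mulr_suml.
by apply: eq_bigr => rho _; rewrite mulrCA mulrA.
Qed.

(** * Linear independence *)

Definition partial_sum (la : seq nat) i : nat := (\sum_(j < i) nth 0 la j)%N.

(** The tableau of shape and content [mu]; its monomial is where triangularity is read off. *)
Definition superstandard (mu : seq nat) : seq (seq nat) :=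
  mkseq (fun i => nseq (nth 0%N mu i) i.+1) (size mu).

Lemma superstandard_ssyt (mu : intpart) : is_ssyt mu (superstandard mu).
Proof.
split.
- apply: (@eq_from_nth _ 0%N) => [|i]; rewrite size_map size_mkseq // => is_.
  by rewrite (nth_map [::]) ?size_mkseq // nth_mkseq // size_nseq.
- by apply/(all_nthP [::]) => i; rewrite size_mkseq => is_; rewrite nth_mkseq // all_nseq orbT.
- apply/(all_nthP [::]) => i; rewrite size_mkseq => is_; rewrite nth_mkseq //.
  by elim: (nth _ _ _) => // -[//|n] IH /=; rewrite leqnn.
move=> i j; rewrite size_mkseq => is_; rewrite !nth_mkseq ?(ltnW is_) // size_nseq => jn.
by rewrite !nth_nseq jn (leq_trans jn) // nth_part_anti.
Qed.

Lemma count_flatten_rows (p : pred nat) T N : (size T <= N)%N ->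
  count p (flatten T) = (\sum_(j < N) count p (nth [::] T j))%N.
Proof.
move=> sT; rewrite count_flatten sumnE big_map (big_nth [::]) big_mkord.
rewrite (big_ord_widen N (fun j => count p (nth [::] T j)) sT) big_mkcond.
by apply: eq_bigr => j _; case: ltnP => // h; rewrite nth_default.
Qed.

Lemma partial_sum_widen la i N : (i <= N)%N ->
  partial_sum la i = (\sum_(j < N) if (j < i)%N then nth 0 la j else 0)%N.
Proof. by move=> iN; rewrite /partial_sum (big_ord_widen N (fun j => nth 0%N la j) iN) big_mkcond. Qed.

Lemma count_superstandard (mu : intpart) i :
  count (fun a => a <= i)%N (flatten (superstandard mu)) = partial_sum mu i.
Proof.
pose N := (size mu + i)%N.
rewrite (@count_flatten_rows _ _ N) ?size_mkseq ?leq_addr //.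
rewrite (@partial_sum_widen _ _ N) ?leq_addl //; apply: eq_bigr => j _.
case: (ltnP j (size mu)) => js.
  by rewrite nth_mkseq // count_nseq; case: ltnP; rewrite ?mul1n ?mul0n.
by rewrite nth_default ?size_mkseq // [nth 0%N _ _]nth_default // if_same.
Qed.

(** Strict columns confine the letters up to [i] to the first [i] rows. *)
Lemma count_ssyt_le (la : intpart) T i : is_ssyt la T ->
  (count (fun a => a <= i)%N (flatten T) <= partial_sum la i)%N.
Proof.
move=> ss; pose N := (size T + i)%N.
rewrite (@count_flatten_rows _ _ N) ?leq_addr // (@partial_sum_widen _ _ N) ?leq_addl //.
apply: leq_sum => j _; case: ltnP => ij.
  by rewrite (leq_trans (count_size _ _)) // size_nth_shape; case: ss => ->.
rewrite leqn0 -leqn0 leqNgt -has_count; apply/hasPn => a /(nthP 0%N)[q qT <-].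
rewrite -ltnNge (leq_ltn_trans ij) //; apply: ssyt_entry_gt ss qT => p.
exact: nth_part_anti.
Qed.

(** A non-zero coefficient provides a tableau of shape [la] with the same letters as the
    superstandard tableau of [mu]. *)
Lemma schur_dominance (la mu : intpart) k i :
  schur la k.+1 (content k (superstandard mu)) != 0 -> (partial_sum mu i <= partial_sum la i)%N.
Proof.
case: la => la P /schur_supp[T ss c]; have [_ pos _ _] := superstandard_ssyt mu.
rewrite -count_superstandard; apply: leq_trans (count_ssyt_le (la := IntPart P) i ss).
have posT : all (all (ltn 0%N)) T by case: ss.
suff /seq.permP -> : perm_eq (flatten (superstandard mu)) (flatten T) by [].
rewrite /perm_eq; apply/allP => a _ /=; apply/eqP; case: a => [|a].
  have z U : all (all (ltn 0%N)) U -> count_mem 0%N (flatten U) = 0%N.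
    move=> H; apply/eqP; rewrite -leqn0 leqNgt -has_count has_pred1; apply/negP => h.
    by move: H; rewrite -all_flatten => /allP/(_ _ h).
  by rewrite !z.
by have := c (xvar k a); rewrite contentE //= eqxx.
Qed.

(** The superstandard tableau itself contributes 1, and no other tableau contributes a negative
    term. *)
Lemma schur_superstandard (la : intpart) k : schur la k.+1 (content k (superstandard la)) != 0.
Proof.
have ss := superstandard_ssyt la; have [sh pos srt col] := ss.
have le : all (all (leq^~ (size la))) (superstandard la).
  apply/(all_nthP [::]) => i; rewrite size_mkseq => is_; rewrite nth_mkseq // all_nseq.
  by rewrite is_ orbT.
have mN : in_alphabet k (size la) (content k (superstandard la)).
  move=> v; rewrite contentE //; case: (eqVneq (val v).1 k.+1) => // e.
  rewrite -lt0n -has_count has_pred1 => h; split=> //.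
  by move: le; rewrite -all_flatten => /allP/(_ _ h).
rewrite (schur_coef (leqnn _) mN).
have anti : antitone (size la) (nth 0%N la) by move=> i _; exact: nth_part_anti.
rewrite schur_poly_tableaux // pseries_sum (bigD1_seq (superstandard la)) /=; last first.
- exact: uniq_tableaux.
- by apply/(mem_tableaux _ anti); split; rewrite // mkseq_nth_pad // subnn cats0.
rewrite lt0r_neq0 // ltr_pwDl //; first by rewrite /mono eqxx ltr01.
by apply: sumr_ge0 => T _; rewrite /mono ler0n.
Qed.

Lemma seq_argmax (A : eqType) (s : seq A) (f : A -> nat) x0 : x0 \in s ->
  exists2 x, x \in s & forall y, y \in s -> (f y <= f x)%N.
Proof.
elim: s x0 => // a s IH x0 _; case: s IH => [|b s] IH.
  by exists a; rewrite ?mem_head // => y; rewrite inE => /eqP ->.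
have [x xs Hx] := IH b (mem_head _ _); case: (leqP (f a) (f x)) => h.
  by exists x => [|y]; rewrite inE ?xs ?orbT // => /orP[/eqP->|/Hx].
exists a; rewrite ?mem_head // => y; rewrite inE => /orP[/eqP->//|/Hx fy].
exact: leq_trans fy (ltnW h).
Qed.

Lemma leq_sum_eq n (f g : 'I_n -> nat) : (forall i, f i <= g i)%N ->
  (\sum_i g i <= \sum_i f i)%N -> forall i, f i = g i.
Proof.
move=> fg; rewrite leqNgt => /negP H i; apply/eqP; rewrite eqn_leq fg /= leqNgt; apply/negP => lt.
apply: H; rewrite (bigD1 i) // [X in (_ < X)%N](bigD1 i) //= -addSn leq_add //.
by apply: leq_sum.
Qed.

Definition type_monomial n (t : ptype) : monomial :=
  \big[mmul/mone]_(k < n) content k (superstandard (restr t k.+1)).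

Lemma part_of_content (mu : intpart) j k :
  part_of letter_class k (content j (superstandard mu)) =
  if j == k then content k (superstandard mu) else mone.
Proof.
have [_ pos _ _] := superstandard_ssyt mu.
apply/eqP/cmP => v; rewrite part_ofE (contentE _ _ pos) /letter_class.
have -> : ((val v).1.-1 == k) = ((val v).1 == k.+1).
  by case/andP: (valP v); case: (val v).1.
case: (eqVneq j k) => [->|ne]; first by rewrite (contentE _ _ pos); case: eqP.
by rewrite cm1; case: eqP => // ->; rewrite eqSS eq_sym (negPf ne).
Qed.

Lemma part_of_type_monomial n (t : ptype) k : (k < n)%N ->
  part_of letter_class k (type_monomial n t) = content k (superstandard (restr t k.+1)).
Proof.
move=> kn; have part1 : part_of letter_class k mone = mone.
  by apply/eqP/cmP => v; rewrite part_ofE cm1; case: ifP.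
rewrite /type_monomial (big_morph (part_of letter_class k) (part_ofM letter_class k) part1).
rewrite (bigD1 (Ordinal kn)) // part_of_content eqxx big1 => [|j jk]; first exact: mulm1.
by rewrite part_of_content; move: jk; rewrite -val_eqE /= => /negPf ->.
Qed.

Lemma type_monomial_class n (t : ptype) v : type_monomial n t v != 0%N -> (letter_class v < n)%N.
Proof.
move=> nz; rewrite ltnNge; apply/negP => nv; move/negP: nz; apply; apply/eqP.
have big0 (r : seq 'I_n) : (\big[mmul/mone]_(k <- r) content k (superstandard (restr t k.+1)) : monomial) v = 0%N.
  elim: r => [|k r IH]; first by rewrite big_nil cm1.
  rewrite big_cons cmM IH addn0; have [_ pos _ _] := superstandard_ssyt (restr t k.+1).
  rewrite contentE //; case: eqP => // e; move: nv; rewrite /letter_class e /=.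
  by rewrite leqNgt ltn_ord.
exact: big0.
Qed.

(** [Phi] is monotone for dominance taken in all degrees together. Let [t0] maximize it among the
    types with non-zero coefficient and read the relation at [type_monomial n t0]: another
    contributing type would dominate [t0] in every degree, maximality would turn the inequalities
    between partial sums into equalities, and the type would be [t0]. *)
Lemma stensor_independent n (a : ptype -> rat) :
  (forall m, \sum_(t <- types n) a t * stensor t m = 0) ->
  forall t, weight t = n -> a t = 0.
Proof.
move=> H t1 wt1; apply/eqP; apply: contraT => at1.
(* Lengths are at most [n], so a partition is determined by its first [n] parts, the differences of
   the partial sums with indices 0 to [n]. *)
pose Phi (t : ptype) := (\sum_(k < n) \sum_(i < n.+1) partial_sum (restr t k.+1) i)%N.
have t1in : t1 \in [seq t <- types n | a t != 0] by rewrite mem_filter at1 mem_types wt1 eqxx.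
have [t0] := seq_argmax Phi t1in; rewrite mem_filter mem_types => /andP[at0 /eqP wt0] tmax.
pose m := type_monomial n t0.
have coefE t : weight t = n -> stensor t m = \prod_(k < n) schur (restr t k.+1) k.+1 (content k (superstandard (restr t0 k.+1))).
  move=> wt; rewrite (@stensor_coef t n) ?wt //; last exact: type_monomial_class.
  by apply: eq_bigr => k _; rewrite part_of_type_monomial.
have sz t : weight t = n -> forall k, (k < n)%N -> (sumn (restr t k.+1) <= n)%N.
  move=> wt k kn; rewrite -wt (@weight_restr t n) => [|j]; last by rewrite -wt; exact: restr_out.
  by rewrite (bigD1 (Ordinal kn)) //= mulSn -addnA leq_addr.
have := H m; rewrite (bigD1_seq t0) ?mem_types ?wt0 ?uniq_types //= big_seq_cond big1 ?addr0; last first.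
  move=> t; rewrite mem_types => /andP[/eqP wt ne]; case: (eqVneq (a t) 0) => [->|at_]; first by rewrite mul0r.
  case: (eqVneq (stensor t m) 0) => [->|]; first by rewrite mulr0.
  rewrite coefE // => /prodf_neq0 nz; case/eqP: ne.
  have dom (k : 'I_n) i : (partial_sum (restr t0 k.+1) i <= partial_sum (restr t k.+1) i)%N.
    exact: schur_dominance (nz k isT).
  have le := tmax t; rewrite mem_filter at_ mem_types wt eqxx in le.
  have row_le (k : 'I_n) : (\sum_(i < n.+1) partial_sum (restr t0 k.+1) i <=
      \sum_(i < n.+1) partial_sum (restr t k.+1) i)%N.
    by apply: leq_sum => i _; exact: dom.
  have eqk := leq_sum_eq row_le (le isT).
  have eqi k i : (i < n.+1)%N -> partial_sum (restr t0 (k : 'I_n).+1) i = partial_sum (restr t k.+1) i.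
    move=> iN; apply: (leq_sum_eq (f := fun i : 'I_n.+1 => partial_sum (restr t0 k.+1) i)
      (g := fun i : 'I_n.+1 => partial_sum (restr t k.+1) i) (dom k) _ (Ordinal iN)).
    by rewrite (eqk k).
  apply: ptype_inj => -[|k]; first by rewrite !restr0 // => c /block_gt0[]; rewrite lt0n.
  case: (ltnP k n) => kn; last by rewrite !restr_out ?wt ?wt0.
  apply: intpart_inj => i; case: (ltnP i n) => iN; last first.
    by rewrite !nth_default // (leq_trans (size_part_le _)) // (leq_trans (sz _ _ _ kn)).
  have := eqi (Ordinal kn) i.+1 iN; rewrite /partial_sum !big_ord_recr /=.
  have := eqi (Ordinal kn) i (leqW iN); rewrite /partial_sum /= => ->.
  by move/eqP; rewrite eqn_add2l => /eqP.
move/eqP; rewrite mulf_eq0 (negPf at0) coefE //= => /prodf_eq0[k _].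
by rewrite (negPf (schur_superstandard _ _)).
Qed.

(** * Identification of the transition matrix *)

Lemma sum_types n (F : ptype -> rat) :
  \sum_(t \in [set t : ptype | weight t = n]%classic) F t = \sum_(t <- types n) F t.
Proof. by rewrite fsbig_finite //; exact: finite_types. Qed.

Local Open Scope classical_set_scope.

Theorem corollary22 (n : nat) (sigma tau : ptype)
    (hsigma : weight sigma = n) (htau : weight tau = n) :
  transition tau sigma = \sum_(T \in TPRT tau sigma) sgn_tableau sigma T.
Proof.
(* At [tau] and [sigma] this candidate unfolds to the right-hand side. *)
pose M0 (t s : ptype) := tableau_coef s t.
have M0P : is_transition M0.
  move=> s m; rewrite sum_types; apply: (Hblocks_expansion m).
  by apply/allP => b /block_gt0[].
(* [transition] is obtained by choice; as [M0] witnesses existence, the chosen matrix satisfies the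
   defining equations and is not the default 0. *)
have TP : is_transition transition by exact: (xgetPex (fun _ _ => 0) (ex_intro _ M0 M0P)).
rewrite -[RHS]/(M0 tau sigma); apply/eqP; rewrite -subr_eq0; apply/eqP.
apply: (stensor_independent (n := n) (a := fun t => transition t sigma - M0 t sigma)) => // m.
transitivity (\sum_(t <- types n) transition t sigma * stensor t m -
              \sum_(t <- types n) M0 t sigma * stensor t m).
  by rewrite -sumrB; apply: eq_bigr => t _; rewrite mulrBl.
by rewrite -!sum_types -hsigma -TP -M0P subrr.
Qed.
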